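(* For all $\epsilon>0$, the Heisenberg taming X-ray transform $I^\epsilon:L^1(\mathbb{H})\to L^1(\mathcal{G}^\epsilon,d\mathcal{G}^\epsilon)$, $I^\epsilon f(z,t,\lambda)=I^\epsilon_\lambda f(z,t)$, is injective. In particular, if $f\in L^1(\mathbb{H})$ and there is $\eta>0$ such that $I^\epsilon_\lambda f=0$ (in $L^1(\mathcal{G}^\epsilon_\lambda)$) for all $\lambda\in(0,\eta)$, then $f=0$ in $L^1(\mathbb{H})$.
   Context: The Heisenberg group is $\mathbb{H}=\mathbb{C}\times\mathbb{R}$ with group law $(x+iy,t)(u+iv,s)=\left(x+u+i(y+v),\,t+s+\tfrac12(xv-yu)\right)$ and Haar measure equal to Lebesgue measure. For $\epsilon>0$ it carries the left-invariant Riemannian (taming) metric $g_\epsilon=dx^2+dy^2+\epsilon^{-2}\Theta^2$, $\Theta=dt-\tfrac12(x\,dy-y\,dx)$. For $\lambda>0$, $R=1/\lambda$, put $\gamma^\epsilon_\lambda(s)=\left(Re^{is/R},\,s\frac{R^2+2\epsilon^2}{2R}\right)$, $s\in\mathbb{R}$. The unoriented $g_\epsilon$-geodesics of charge $\lambda$ are the left translates $s\mapsto(z,t)\gamma^\epsilon_\lambda(s)$, $(z,t)\in\mathbb{H}$ (parameterized so that the projection to $\mathbb{C}$ has unit speed); negative charges give the same unoriented curves, and geodesics of charge $0$ are disregarded. The stabilizer of $\gamma^\epsilon_\lambda$ is $\Gamma^\epsilon_\lambda=\{(0,k\pi(R^2+2\epsilon^2)):k\in\mathbb{Z}\}$, so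 the set $\mathcal{G}^\epsilon_\lambda$ of geodesics of charge $\lambda$ is identified with $\mathbb{H}/\Gamma^\epsilon_\lambda$ by $(z,t)\gamma^\epsilon_\lambda\mapsto(z,t)\Gamma^\epsilon_\lambda$. $\mathcal{G}^\epsilon_\lambda$ carries the measure $d\mathcal{G}^\epsilon_\lambda=\lambda\,dx\,dy\,dt$ (with $dx\,dy\,dt$ Lebesgue measure on $\mathbb{C}\times[0,\pi(R^2+2\epsilon^2))$), and $\mathcal{G}^\epsilon=\{(z,t,\lambda):\lambda>0,\ (z,t)\in\mathbb{H}/\Gamma^\epsilon_\lambda\}$ carries $d\mathcal{G}^\epsilon=\lambda e^{-\lambda}\,dx\,dy\,dt\,d\lambda$. For $f\in C_c(\mathbb{H})$, $I^\epsilon_\lambda f(z,t)=\int_{\mathbb{R}}f\left((z,t)\gamma^\epsilon_\lambda(s)\right)ds$ and $I^\epsilon f(z,t,\lambda)=I^\epsilon_\lambda f(z,t)$. The maps $I^\epsilon_\lambda:L^1(\mathbb{H})\to L^1(\mathcal{G}^\epsilon_\lambda,d\mathcal{G}^\epsilon_\lambda)$ and $I^\epsilon:L^1(\mathbb{H})\to L^1(\mathcal{G}^\epsilon,d\mathcal{G}^\epsilon)$ are the bounded extensions from $C_c(\mathbb{H})$. *)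

(* Defs.v *)
From HB Require Import structures.
From mathcomp Require Import all_boot all_order all_algebra complex.
From mathcomp Require Import all_classical all_reals all_analysis.
From mathcomp Require Import measurable_realfun.
From mathcomp Require Import ring.

Set Implicit Arguments.
Unset Strict Implicit.
Unset Printing Implicit Defensive.
Import Order.TTheory GRing.Theory Num.Theory.
Import numFieldNormedType.Exports.

Local Open Scope classical_set_scope.
Local Open Scope ring_scope.

(* MathComp-Analysis has no integration of complex-valued functions: they are
   integrated componentwise. *)
Section complex_L1.
Context d (T : measurableType d) (R : realType).
Variable mu : {measure set T -> \bar R}.

Definition cintegrable (f : T -> R[i]) : Prop :=
  mu.-integrable setT (fun x => (complex.Re (f x))%:E) /\
  mu.-integrable setT (fun x => (complex.Im (f x))%:E).

Definition cintegral (f : T -> R[i]) : R[i] :=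
  Complex (\int[mu]_x complex.Re (f x)) (\int[mu]_x complex.Im (f x)).

Definition cintegrable_pred : {pred T -> R[i]^o} :=
  mem [set f : T -> R[i]^o | cintegrable f].

Lemma cintegrable_submod_closed : submod_closed cintegrable_pred.
Proof.
split.
  rewrite inE /=; split; exact: integrable0.
move=> a f g; rewrite !inE /= => -[f1 f2] [g1 g2]; split.
- have := integrableD measurableT (integrableB measurableT
    (integrableZl measurableT (complex.Re a) f1)
    (integrableZl measurableT (complex.Im a) f2)) g1.
  apply: eq_integrable => // x _ /=.
  rewrite -!EFinM -EFinB -EFinD; congr (_%:E).
  rewrite /GRing.scale /= -[(a *: f + g) x]/(a * f x + g x).
  by case: a (f x) (g x) => [a b] [c e] [p q].
- have := integrableD measurableT (integrableD measurableT
    (integrableZl measurableT (complex.Re a) f2)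
    (integrableZl measurableT (complex.Im a) f1)) g2.
  apply: eq_integrable => // x _ /=.
  rewrite -!EFinM -!EFinD; congr (_%:E).
  rewrite -[(a *: f + g) x]/(a * f x + g x).
  by case: a (f x) (g x) => [a b] [c e] [p q].
Qed.

HB.instance Definition _ := GRing.isSubmodClosed.Build _ _ cintegrable_pred
  cintegrable_submod_closed.

Record L1fun : Type := MkL1fun {
  L1fun_val :> T -> R[i]^o ;
  L1fun_valP : L1fun_val \in cintegrable_pred }.

HB.instance Definition _ := [isSub for L1fun_val].
HB.instance Definition _ := [Choice of L1fun by <:].
HB.instance Definition _ := [SubChoice_isSubLmodule of L1fun by <:].

Definition L1ae (f g : L1fun) : bool := `[< {ae mu, forall x, f x = g x} >].

Lemma L1ae_refl : reflexive L1ae.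
Proof. by move=> f; apply/asboolP; exact: aeW. Qed.

Lemma L1ae_sym : symmetric L1ae.
Proof.
by move=> f g; apply/idP/idP => /asboolP h; apply/asboolP;
  apply: filterS h => x ->.
Qed.

Lemma L1ae_trans : transitive L1ae.
Proof.
move=> g f h /asboolP fg /asboolP gh; apply/asboolP.
by apply: filterS2 fg gh => x -> ->.
Qed.

Canonical L1ae_equiv := EquivRel L1ae L1ae_refl L1ae_sym L1ae_trans.

Local Open Scope quotient_scope.

Definition L1 : Type := {eq_quot L1ae}.
HB.instance Definition _ := Choice.on L1.
HB.instance Definition _ := EqQuotient.on L1.

Lemma L1_eqP (f g : L1fun) :
  {ae mu, forall x, f x = g x} -> \pi_L1 f = \pi_L1 g.
Proof. by move=> fg; apply/eqP; rewrite eqmodE; exact/asboolP. Qed.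

Lemma L1_reprP (f : L1fun) : {ae mu, forall x, repr (\pi_L1 f) x = f x}.
Proof. by apply/asboolP; rewrite -/(L1ae _ _) -eqmodE reprK. Qed.

Definition L1_add (F G : L1) : L1 := \pi_L1 (repr F + repr G).
Definition L1_opp (F : L1) : L1 := \pi_L1 (- repr F).
Definition L1_scale (a : R[i]) (F : L1) : L1 := \pi_L1 (a *: repr F).

Lemma L1_addE f g : L1_add (\pi_L1 f) (\pi_L1 g) = \pi_L1 (f + g).
Proof.
apply: L1_eqP; apply: filterS2 (L1_reprP f) (L1_reprP g) => x fx gx.
by rewrite -[LHS]/(repr (\pi_L1 f) x + repr (\pi_L1 g) x) fx gx.
Qed.

Lemma L1_oppE f : L1_opp (\pi_L1 f) = \pi_L1 (- f).
Proof.
apply: L1_eqP; apply: filterS (L1_reprP f) => x fx.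
by rewrite -[LHS]/(- repr (\pi_L1 f) x) fx.
Qed.

Lemma L1_scaleE a f : L1_scale a (\pi_L1 f) = \pi_L1 (a *: f).
Proof.
apply: L1_eqP; apply: filterS (L1_reprP f) => x fx.
by rewrite -[LHS]/(a *: (repr (\pi_L1 f) x : R[i]^o)) fx.
Qed.

Fact L1_addA : associative L1_add.
Proof.
move=> F G H; rewrite -(reprK F) -(reprK G) -(reprK H).
by rewrite (L1_addE (repr G)) (L1_addE (repr F) (repr G)) !L1_addE addrA.
Qed.

Fact L1_addC : commutative L1_add.
Proof. by move=> F G; rewrite /L1_add addrC. Qed.

Fact L1_add0 : left_id (\pi_L1 0) L1_add.
Proof. by move=> F; rewrite -(reprK F) L1_addE add0r. Qed.

Fact L1_addN : left_inverse (\pi_L1 0) L1_opp L1_add.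
Proof. by move=> F; rewrite -(reprK F) L1_oppE !L1_addE addNr. Qed.

HB.instance Definition _ := GRing.isZmodule.Build L1
  L1_addA L1_addC L1_add0 L1_addN.

Fact L1_scaleA a b F : L1_scale a (L1_scale b F) = L1_scale (a * b) F.
Proof. by rewrite -(reprK F) (L1_scaleE b) !L1_scaleE scalerA. Qed.

Fact L1_scale1 : left_id 1 L1_scale.
Proof. by move=> F; rewrite -(reprK F) L1_scaleE scale1r. Qed.

Fact L1_scaleDr : right_distributive L1_scale +%R.
Proof.
move=> a F G; rewrite -(reprK F) -(reprK G).
rewrite -[RHS]/(L1_add _ _) -[X in L1_scale _ X]/(L1_add _ _).
by rewrite L1_addE (L1_scaleE a (repr F)) (L1_scaleE a (repr G)) L1_scaleE
  L1_addE scalerDr.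
Qed.

Fact L1_scaleDl F : {morph L1_scale^~ F : a b / a + b}.
Proof.
move=> a b; rewrite -(reprK F).
rewrite -[RHS]/(L1_add _ _) (L1_scaleE a) (L1_scaleE b) L1_scaleE L1_addE.
by rewrite scalerDl.
Qed.

HB.instance Definition _ := GRing.Zmodule_isLmodule.Build R[i] L1
  L1_scaleA L1_scale1 L1_scaleDr L1_scaleDl.

Definition L1norm (F : L1) : \bar R :=
  (\int[mu]_x (ComplexField.Normc.normc (repr F x))%:E)%E.

(* [f] is a representative of the class [F]. *)
Definition L1rep (F : L1) (f : T -> R[i]) : Prop :=
  cintegrable f /\ {ae mu, forall x, repr F x = f x}.

End complex_L1.

Section bounded_extension.
Context d1 d2 (T1 : measurableType d1) (T2 : measurableType d2) (R : realType).
Variables (mu : {measure set T1 -> \bar R}) (nu : {measure set T2 -> \bar R}).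
Variables (D : set (T1 -> R[i])) (A : (T1 -> R[i]) -> (T2 -> R[i])).

Definition is_bounded_ext (S : L1 mu -> L1 nu) : Prop :=
  [/\ linear S,
      exists M : R, forall F, (L1norm (S F) <= M%:E * L1norm F)%E &
      forall F f, D f -> L1rep F f -> L1rep (S F) (A f)].

(* The bounded extension of [A] from [D] to L^1; it is unique when [D] is dense
   in L^1.  The value 0 is taken only when there is no such extension. *)
Definition bounded_ext : L1 mu -> L1 nu := xget (fun=> 0) is_bounded_ext.

End bounded_extension.

Section density_measure.
Local Open Scope ereal_scope.
Context d (T : measurableType d) (R : realType).
Variable mu : {measure set T -> \bar R}.
Variables (w : T -> R) (mw : measurable_fun setT w) (w0 : forall x, (0 <= w x)%R).

Definition density_measure of measurable_fun setT w & (forall x, (0 <= w x)%R) :=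
  fun A : set T => \int[mu]_(x in A) (w x)%:E.

Local Notation nu := (density_measure mw w0).

Let nu0 : nu set0 = 0.
Proof. exact: integral_set0. Qed.

Let nu_ge0 A : 0 <= nu A.
Proof. by apply: integral_ge0 => x _; rewrite lee_fin. Qed.

Let nu_sigma_additive : semi_sigma_additive nu.
Proof.
move=> F mF tF mUF; rewrite /density_measure; apply: cvg_toP.
  apply: ereal_nondecreasing_is_cvgn => m n mn.
  by apply: lee_sum_nneg_natr => // k _ _; exact: nu_ge0.
rewrite ge0_integral_bigcup//=.
- by apply: measurable_funTS; exact/measurable_EFinP.
- by move=> x _; rewrite lee_fin.
Qed.

HB.instance Definition _ := isMeasure.Build _ _ _ nu
  nu0 nu_ge0 nu_sigma_additive.

End density_measure.

Section heisenberg.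
Variable R : realType.

(* The carrier of H is C x R, with x + i y : C written as the pair (x, y).
   [measurableTypeR R] is R with its Borel sigma-algebra. *)
Local Notation mR := (measurableTypeR R).
Local Notation H := (mR * mR * mR)%type.
Local Notation leb := (@lebesgue_measure R).

Definition hmul (p q : H) : H :=
  let: (x, y, t) := p in let: (u, v, s) := q in
  (x + u, y + v, t + s + 2^-1 * (x * v - y * u)).

Definition haar : {measure set H -> \bar R} := ((leb \x leb) \x leb)%E.

Definition geodesic (eps lam : R) (s : R) : H :=
  let r := lam^-1 in
  (r * cos (s / r), r * sin (s / r), s * ((r ^+ 2 + 2 * eps ^+ 2) / (2 * r))).

(* The generator of the stabilizer of [geodesic eps lam] is (0, 0, period). *)
Definition period (eps lam : R) : R := pi * (lam^-1 ^+ 2 + 2 * eps ^+ 2).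

Lemma geodesic_period (eps lam s : R) : 0 < lam ->
  hmul (0, 0, period eps lam) (geodesic eps lam s) =
  geodesic eps lam (s + 2 * pi / lam).
Proof.
move=> l0; have ln0 : lam != 0 by rewrite gt_eqF.
rewrite /hmul /geodesic /period !invrK.
have -> : (s + 2 * pi / lam) * lam = s * lam + pi *+ 2.
  by rewrite mulrDl mulfVK// mulr_natl.
rewrite cosD2pi sinD2pi !mul0r subrr mulr0 addr0 !add0r; congr (_, _, _).
by field.
Qed.

(* The space of geodesics of charge lam is modelled on the fundamental domain
   C x [0, period) for the right action of the stabilizer. *)
Definition fund_dom (eps lam : R) : set H :=
  [set p | p.2 \in `[0, period eps lam[].

Lemma measurable_fund_dom (eps lam : R) : measurable (fund_dom eps lam).
Proof.
rewrite (_ : fund_dom eps lam = setT `&` snd @^-1` [set` `[0, period eps lam[]).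
  by apply: measurable_snd => //; exact: measurable_itv.
by rewrite setTI.
Qed.

Definition geod_measure (eps : R) (lam : {posnum R}) :
    {measure set H -> \bar R} :=
  mscale (lam%:num%:nng)%R
    (mrestr haar (measurable_fund_dom eps lam%:num)).

Definition geod_density (eps : R) (q : H * mR) : R :=
  if (0 < q.2) && (q.1.2 \in `[0, period eps q.2[)
  then q.2 * expR (- q.2) else 0.

Lemma geod_density_ge0 (eps : R) q : 0 <= geod_density eps q.
Proof.
by rewrite /geod_density; case: ifPn => // /andP[q0 _];
  rewrite mulr_ge0 ?expR_ge0// ltW.
Qed.

Lemma measurable_geod_density (eps : R) :
  measurable_fun setT (geod_density eps).
Proof.
have mlam : measurable_fun setT (fun q : H * mR => q.2 : mR).
  exact: measurable_snd.
have mt : measurable_fun setT (fun q : H * mR => q.1.2 : mR).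
  exact: (measurableT_comp measurable_snd measurable_fst).
have -> : geod_density eps = (fun q : H * mR =>
    if (0 < q.2) && ((0 <= q.1.2) &&
        (q.1.2 < pi * ((q.2 `^ (-1)) ^+ 2 + 2 * eps ^+ 2)))
    then q.2 * expR (- q.2) else 0).
  apply/funext => q; rewrite /geod_density in_itv /= /period.
  by case: ltP => //= q0; rewrite powR_inv1// ltW.
apply: measurable_fun_ifT => //.
  apply: measurable_and; first exact: measurable_fun_ltr.
  apply: measurable_and; first exact: measurable_fun_ler.
  apply: measurable_fun_ltr => //.
  apply: measurable_funM => //; apply: measurable_funD => //.
  apply: measurable_funX.
  exact: (measurableT_comp (measurable_powR _)).
apply: measurable_funM => //.
by apply: measurableT_comp => //; exact: measurableT_comp.
Qed.

(* The measure lam e^{-lam} dx dy dt dlam on the space of geodesics of all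
   charges lam > 0, the fibre over lam being [fund_dom eps lam]. *)
Definition geod_space_measure (eps : R) : {measure set (H * mR) -> \bar R} :=
  density_measure (haar \x leb)%E
    (measurable_geod_density eps) (geod_density_ge0 eps).

Definition Cc : set (H -> R[i]) :=
  [set f | [/\ continuous (fun p : R * R * R => complex.Re (f p) : R),
               continuous (fun p : R * R * R => complex.Im (f p) : R) &
               compact (closure [set p : R * R * R | f p != 0])]].

Definition xray_lam_fun (eps lam : R) (f : H -> R[i]) (p : H) : R[i] :=
  cintegral leb (fun s : mR => f (hmul p (geodesic eps lam s))).

(* The values at q.2 <= 0 are irrelevant: [geod_density] vanishes there. *)
Definition xray_fun (eps : R) (f : H -> R[i]) (q : H * mR) : R[i] :=
  xray_lam_fun eps q.2 f q.1.

Definition xray_lam (eps : R) (lam : {posnum R}) :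
    L1 haar -> L1 (geod_measure eps lam) :=
  @bounded_ext _ _ _ _ _ _ _ Cc (xray_lam_fun eps lam%:num).

Definition xray (eps : R) : L1 haar -> L1 (geod_space_measure eps) :=
  @bounded_ext _ _ _ _ _ _ _ Cc (xray_fun eps).

End heisenberg.

(* Main.v *)
(* If I_lam u = 0, a Santalo-type formula shows that u annihilates the average of
   h over the geodesics of charge lam, for every bounded h periodic in t with the
   period of the stabilizer.  For tau = 2 k / (R^2 + 2 eps^2) and n = j + k, the
   left translates of h = e^{i tau t} z^n e^{-tau |z|^2 / 4} are admissible, and the
   average of h is a nonzero multiple of L_j^(k)(k - tau eps^2) times
   e^{i tau t} z^j e^{-tau |z|^2 / 4}, where L_j^(k) is a Laguerre polynomial.  Small
   charges correspond to large k; as L_j^(k)(k - c) is a nonzero polynomial in k,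
   every tau > 0 is reached with a nonzero factor, so that u annihilates all the
   translates of e^{i tau t} z^j e^{-tau |z|^2 / 4}.  Summing over j with weights
   c^j / j! gives the Gaussians e^{i (xi . z + tau t)} e^{-tau |z - b|^2 / 4}; averaging
   over b kills the Fourier transform of u at all frequencies with tau > 0.  For
   real u this is everything up to a null set, and u = 0. *)
Require Import Defs.
From HB Require Import structures.
From mathcomp Require Import all_boot all_order all_algebra complex.
From mathcomp Require Import all_classical all_reals all_analysis.
From mathcomp Require Import measurable_realfun.
From mathcomp Require Import ring lra.
Set Implicit Arguments.
Unset Strict Implicit.
Unset Printing Implicit Defensive.
Import Order.TTheory GRing.Theory Num.Theory.
Import numFieldNormedType.Exports.
Local Open Scope classical_set_scope.
Local Open Scope ring_scope.
Arguments hmul : simpl never.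
Arguments geodesic : simpl never.
Local Notation "x %:C" := (real_complex _ x) : ring_scope.

(** * Translation invariance and unfolding *)

Section translation.
Variable R : realType.
Local Notation mR := (measurableTypeR R).
Local Notation leb := (@lebesgue_measure R).
Local Open Scope ereal_scope.

Lemma measurable_addr (a : R) : measurable_fun setT (fun x : mR => (x + a)%R : mR).
Proof. exact: measurable_funD. Qed.

Lemma lebesgue_measure_shift (a : R) (A : set mR) : measurable A ->
  leb A = pushforward leb (fun x : mR => (x + a)%R : mR) A.
Proof.
move=> mA.
pose phi : mR -> mR := fun x : mR => (x + a)%R : mR.
have mphi : measurable_fun setT phi := measurable_addr a.
pose mphi_pack : {mfun mR >-> mR} := HB.pack phi (isMeasurableFun.Build _ _ _ _ phi mphi).
rewrite (@lebesgue_measure_unique R (pushforward leb mphi_pack))// => X /ocitvP[->|[[x y] /= xy ->]].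
  by rewrite !measure0.
rewrite /pushforward /=.
have -> : phi @^-1` `]x, y]%classic = `]x - a, y - a]%classic%R.
  by apply/seteqP; split => z; rewrite /phi /= !in_itv /= ltrBlDr lerBrDr.
rewrite !lebesgue_measure_itv /= !lte_fin ltrD2r; case: ifP => // _.
by rewrite !EFinN -!EFinB; congr (_%:E); lra.
Qed.

Lemma ge0_integral_shift (a : R) (f : mR -> \bar R) : measurable_fun setT f ->
  (forall x, 0 <= f x) -> \int[leb]_x f (x + a)%R = \int[leb]_x f x.
Proof.
move=> mf f0.
pose phi : mR -> mR := fun x : mR => (x + a)%R : mR.
pose mphi : {mfun mR >-> mR} :=
  HB.pack phi (isMeasurableFun.Build _ _ _ _ phi (measurable_addr a)).
rewrite [RHS](eq_measure_integral (pushforward leb mphi)).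
  by rewrite ge0_integral_pushforward//; exact: measurable_addr.
by move=> A mA _; exact: lebesgue_measure_shift.
Qed.

End translation.

Section unfolding.
Variable R : realType.
Local Notation mR := (measurableTypeR R).
Local Notation leb := (@lebesgue_measure R).
Local Open Scope ereal_scope.

Lemma ge0_integral_itv_shift (a b d : R) (f : mR -> \bar R) :
  measurable_fun setT f -> (forall x, 0 <= f x) ->
  \int[leb]_(x in `](a + d)%R, (b + d)%R]) f x = \int[leb]_(x in `]a, b]) f (x + d)%R.
Proof.
move=> mf f0.
rewrite integral_mkcond [RHS]integral_mkcond.
rewrite -[LHS](ge0_integral_shift d); last 2 first.
- by apply/(measurable_restrictT f) => //; exact: measurable_funTS.
- by move=> x; rewrite patchE; case: ifP.
apply: eq_integral => x _; rewrite !patchE !mem_setE !in_itv /=.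
by rewrite ltrD2r lerD2r.
Qed.

Lemma periodicz (L : R) (f : R -> \bar R) : (forall s, f (s + L)%R = f s) ->
  forall (m : int) s, f (s + m%:~R * L)%R = f s.
Proof.
move=> fL.
have H (n : nat) s : f (s + n%:R * L)%R = f s.
  elim: n s => [|n IH] s; first by rewrite mul0r addr0.
  by rewrite -natr1 mulrDl mul1r addrA fL IH.
case=> n s; first exact: H.
by rewrite NegzE mulrNz mulNr -[LHS](H n.+1) subrK.
Qed.

Lemma ge0_integral_period (L a : R) (f : mR -> \bar R) : (0 < L)%R ->
  measurable_fun setT f -> (forall x, 0 <= f x) ->
  (forall s, f (s + L)%R = f s) ->
  \int[leb]_(s in `]a, (a + L)%R]) f s = \int[leb]_(s in `]0%R, L]) f s.
Proof.
move=> L0 mf f0 fL.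
pose m : int := (Num.floor (a / L) + 1)%R.
have amL : (a < m%:~R * L)%R by rewrite -ltr_pdivrMr//; exact: floorD1_gt.
have mLa : (m%:~R * L <= a + L)%R.
  rewrite intrD mulrDl mul1r lerD2r -ler_pdivlMr//; exact: floor_le.
have split (x y z : R) : (x <= y)%R -> (y <= z)%R ->
    \int[leb]_(s in `]x, z]) f s =
    \int[leb]_(s in `]x, y]) f s + \int[leb]_(s in `]y, z]) f s.
  move=> xy yz; rewrite -ge0_integral_setU//=.
  - by rewrite -itv_bndbnd_setU// ?bnd_simp.
  - exact: measurable_funTS.
  - apply/disj_setPRL => s /=; rewrite !in_itv /= => /andP[ys _].
    by move=> /andP[_ /le_lt_trans/(_ ys)]; rewrite ltxx.
have sh (x y : R) (k : int) :
    \int[leb]_(s in `](x + k%:~R * L)%R, (y + k%:~R * L)%R]) f s =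
    \int[leb]_(s in `]x, y]) f s.
  rewrite ge0_integral_itv_shift//; apply: eq_integral => s _.
  exact: (periodicz fL).
rewrite (split a (m%:~R * L)%R)//; last exact: ltW.
pose b : R := (a + L - m%:~R * L)%R.
rewrite (split 0%R b L); last 2 first.
- by rewrite /b subr_ge0.
- by rewrite /b; lra.
rewrite addeC; congr (_ + _).
- by rewrite -(sh 0%R b m) add0r subrK.
- rewrite -(sh b L (m - 1)%R) intrB mulrBl mul1r.
  rewrite (_ : (b + _)%R = a); last by rewrite /b; ring.
  by rewrite addrC subrK.
Qed.

Lemma ge0_integral_unfold (P L c : R) (K : mR * mR -> \bar R) :
  (0 < c)%R -> (0 < L)%R -> P = (c * L)%R ->
  measurable_fun setT K -> (forall p, 0 <= K p) ->
  (forall t s, K (t, s + L)%R = K (t + P, s)%R) ->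
  \int[leb]_(t in `[0%R, P[) \int[leb]_s K (t, s) =
  \int[leb]_t \int[leb]_(s in `]0%R, L]) K (t, s).
Proof.
move=> c0 L0 PcL mK K0 KP.
have mshear : measurable_fun setT (fun p : mR * mR => (p.1 - c * p.2, p.2)%R : mR * mR).
  apply: measurable_fun_pair => //=.
  by apply: measurable_funB => //; exact: measurable_funM.
pose psi (p : mR * mR) := K (p.1 - c * p.2, p.2)%R.
have mpsi : measurable_fun setT psi by exact: measurableT_comp mK mshear.
have psiL u s : psi (u, s + L)%R = psi (u, s).
  by rewrite /psi /= KP PcL; congr K; congr pair; ring.
have mpsi1 u : measurable_fun setT (fun s : mR => psi (u, s)).
  exact: measurableT_comp mpsi (pair1_measurable _).
have mpsi2 s : measurable_fun setT (fun u : mR => psi (u, s)).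
  exact: measurableT_comp mpsi (pair2_measurable _).
pose I : set (mR * mR) := [set p | p.1 \in `[0%R, P[].
have mI : measurable I.
  rewrite (_ : I = setT `&` fst @^-1` [set` `[0%R, P[]).
    by apply: measurable_fst => //; exact: measurable_itv.
  by rewrite setTI.
pose J : set (mR * mR) := [set p | p.2 \in `]0%R, L]].
have mJ : measurable J.
  rewrite (_ : J = setT `&` snd @^-1` [set` `]0%R, L]]).
    by apply: measurable_snd => //; exact: measurable_itv.
  by rewrite setTI.
have inI t s : ((t, s) \in I) = (t \in `[0%R, P[) by apply/idP/idP; rewrite inE.
have inJ t s : ((t, s) \in J) = (s \in `]0%R, L]) by apply/idP/idP; rewrite inE.
have mKI : measurable_fun setT (K \_ I).
  by apply/(measurable_restrictT K) => //; exact: measurable_funTS.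
have mKJ : measurable_fun setT (K \_ J).
  by apply/(measurable_restrictT K) => //; exact: measurable_funTS.
have mpsiJ : measurable_fun setT (psi \_ J).
  by apply/(measurable_restrictT psi) => //; exact: measurable_funTS.
have KI0 p : 0 <= (K \_ I) p by rewrite patchE; case: ifP.
have KJ0 p : 0 <= (K \_ J) p by rewrite patchE; case: ifP.
have psiJ0 p : 0 <= (psi \_ J) p by rewrite patchE; case: ifP => // _; exact: K0.
transitivity (\int[leb]_t \int[leb]_s (K \_ I) (t, s)).
  rewrite integral_mkcond; apply: eq_integral => t _; rewrite patchE mem_setE.
  case: ifPn => tI; first by apply: eq_integral => s _; rewrite patchE inI tI.
  by rewrite integral0_eq// => s _; rewrite patchE inI (negbTE tI).
rewrite (fubini_tonelli (m1 := leb) (m2 := leb))//.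
transitivity (\int[leb]_s \int[leb]_u ((K \_ I) (u - c * s, s)%R)).
  apply: eq_integral => s _; rewrite (ge0_integral_shift (- (c * s))%R (f := fun t => (K \_ I) (t, s)))//.
  exact: measurableT_comp mKI (pair2_measurable _).
rewrite -(fubini_tonelli (m1 := leb) (m2 := leb)
  (fun p => (K \_ I) (p.1 - c * p.2, p.2)%R))//=; last first.
  exact: (measurableT_comp mKI mshear).
transitivity (\int[leb]_u \int[leb]_s (psi \_ J) (u, s)).
  apply: eq_integral => u _.
  transitivity (\int[leb]_(s in `]((u - P) / c)%R, ((u - P) / c + L)%R]) psi (u, s)).
    rewrite [RHS]integral_mkcond; apply: eq_integral => s _; rewrite !patchE inI mem_setE /=.
    rewrite !in_itv /= ltr_pdivrMr// (_ : (_ / c + L = u / c)%R); last first.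
      by rewrite PcL; field; rewrite gt_eqF.
    rewrite ler_pdivlMr// subr_ge0 ltrBlDr ltrBlDl andbC.
    by rewrite /psi /= [(c * s)%R]mulrC.
  rewrite (@ge0_integral_period L _ (fun s => psi (u, s)))//; last by move=> s; exact: K0.
  rewrite integral_mkcond; apply: eq_integral => s _.
  by rewrite !patchE inJ mem_setE.
rewrite (fubini_tonelli (m1 := leb) (m2 := leb))//.
rewrite [RHS](_ : _ = \int[leb]_t \int[leb]_s (K \_ J) (t, s)); last first.
  apply: eq_integral => t _; rewrite integral_mkcond; apply: eq_integral => s _.
  by rewrite !patchE inJ mem_setE.
rewrite [RHS](fubini_tonelli (m1 := leb) (m2 := leb))//.
apply: eq_integral => s _.
rewrite -(ge0_integral_shift (- (c * s))%R (f := fun t => (K \_ J) (t, s)))//.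
exact: measurableT_comp mKJ (pair2_measurable _).
Qed.

End unfolding.

Section heisenberg_group.
Variable R : realType.
Local Notation mR := (measurableTypeR R).
Local Notation H := (mR * mR * mR)%type.

Definition hinv (p : H) : H := (- p.1.1, - p.1.2, - p.2).

Lemma hmulE (p q : H) : hmul p q =
  (p.1.1 + q.1.1, p.1.2 + q.1.2,
   p.2 + q.2 + 2^-1 * (p.1.1 * q.1.2 - p.1.2 * q.1.1)).
Proof. by case: p q => [[x y] t] [[u v] s]. Qed.

Lemma hmulA (p q r : H) : hmul p (hmul q r) = hmul (hmul p q) r.
Proof. by rewrite !hmulE /=; congr (_, _, _); ring. Qed.

Lemma hmulK (p q : H) : hmul (hmul p q) (hinv q) = p.
Proof.
case: p => [[x y] t]; rewrite !hmulE /hinv /=.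
by congr (_, _, _); ring.
Qed.

Lemma measurable_H3 d (T : measurableType d) (f g h : T -> mR) :
  measurable_fun setT f -> measurable_fun setT g -> measurable_fun setT h ->
  measurable_fun setT (fun p => (f p, g p, h p) : H).
Proof.
by move=> mf mg mh; apply: measurable_fun_pair => //; exact: measurable_fun_pair.
Qed.

Lemma measurable_H11 : measurable_fun setT (fun p : H => p.1.1 : mR).
Proof. exact: (measurableT_comp measurable_fst measurable_fst). Qed.

Lemma measurable_H12 : measurable_fun setT (fun p : H => p.1.2 : mR).
Proof. exact: (measurableT_comp measurable_snd measurable_fst). Qed.

Lemma measurable_H2 : measurable_fun setT (fun p : H => p.2 : mR).
Proof. exact: measurable_snd. Qed.

Lemma measurable_hmul d (T : measurableType d) (f g : T -> H) :
  measurable_fun setT f -> measurable_fun setT g ->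
  measurable_fun setT (fun p => hmul (f p) (g p)).
Proof.
move=> mf mg; rewrite (_ : (fun p => _) = fun p =>
  ((f p).1.1 + (g p).1.1, (f p).1.2 + (g p).1.2, (f p).2 + (g p).2 +
  2^-1 * ((f p).1.1 * (g p).1.2 - (f p).1.2 * (g p).1.1)) : H); last first.
  by apply/funext => p; rewrite hmulE.
have f11 := measurableT_comp measurable_H11 mf.
have f12 := measurableT_comp measurable_H12 mf.
have f2 := measurableT_comp measurable_H2 mf.
have g11 := measurableT_comp measurable_H11 mg.
have g12 := measurableT_comp measurable_H12 mg.
have g2 := measurableT_comp measurable_H2 mg.
apply: measurable_H3; [exact: measurable_funD|exact: measurable_funD|].
apply: measurable_funD; first exact: measurable_funD.
by apply: measurable_funM => //; apply: measurable_funB; exact: measurable_funM.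
Qed.

Lemma measurable_hinv : measurable_fun setT hinv.
Proof.
by apply: measurable_H3; apply: measurableT_comp => //;
  [exact: measurable_H11|exact: measurable_H12].
Qed.

Lemma measurable_geodesic eps lam : measurable_fun setT (geodesic eps lam : mR -> H).
Proof.
rewrite /geodesic; apply: measurable_H3.
- apply: measurable_funM => //; apply: measurableT_comp; last exact: measurable_funM.
  exact: (continuous_measurable_fun (@continuous_cos R)).
- apply: measurable_funM => //; apply: measurableT_comp; last exact: measurable_funM.
  exact: (continuous_measurable_fun (@continuous_sin R)).
- exact: measurable_funM.
Qed.

End heisenberg_group.

Section sigma_finite_product.
Context d1 d2 (T1 : measurableType d1) (T2 : measurableType d2) (R : realType).
Variables (m1 : {sigma_finite_measure set T1 -> \bar R})
  (m2 : {sigma_finite_measure set T2 -> \bar R}).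

Lemma sigma_finite_product : sigma_finite setT (m1 \x m2)%E.
Proof.
have /sigma_finiteP[F [TF ndF Foo]] := sigma_finiteT m1.
have /sigma_finiteP[G [TG ndG Goo]] := sigma_finiteT m2.
exists (fun n => F n `*` G n).
  rewrite -setXTT TF TG; apply/seteqP; split => [[x y] [/= [n _ Fnx] [k _ Gky]]|[x y] [n _ [/= Fnx Gny]]].
    exists (maxn n k) => //; split.
    - by have /subsetPset := ndF _ _ (leq_maxl n k); exact.
    - by have /subsetPset := ndG _ _ (leq_maxr n k); exact.
  by split; exists n.
move=> k; have [mF Fk] := Foo k; have [mG Gk] := Goo k.
split; first exact: measurableX.
by rewrite product_measure1E// lte_mul_pinfty// ge0_fin_numE.
Qed.

(* The library's instance is shadowed by the one for products of subprobabilities. *)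
Definition sigma_finite_prod : {sigma_finite_measure set (T1 * T2)%type -> \bar R} :=
  HB.pack (m1 \x m2)%E (Measure_isSigmaFinite.Build _ _ _ (m1 \x m2)%E
    sigma_finite_product).

End sigma_finite_product.
Section haar_integral.
Variable R : realType.
Local Notation mR := (measurableTypeR R).
Local Notation H := (mR * mR * mR)%type.
Local Notation leb := (@lebesgue_measure R).
Local Open Scope ereal_scope.

Definition leb2 := sigma_finite_prod leb leb.

Definition haar_sf := sigma_finite_prod leb2 leb.

Lemma ge0_integral_leb2 (f : mR * mR -> \bar R) : measurable_fun setT f ->
  (forall p, 0 <= f p) ->
  \int[leb2]_p f p = \int[leb]_x \int[leb]_y f (x, y).
Proof. by move=> mf f0; exact: (fubini_tonelli1 (m1 := leb) (m2 := leb)). Qed.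

Lemma ge0_integral_haar (f : H -> \bar R) : measurable_fun setT f ->
  (forall p, 0 <= f p) ->
  \int[haar R]_p f p = \int[leb2]_z \int[leb]_t f (z, t).
Proof. by move=> mf f0; exact: (fubini_tonelli1 (m1 := leb2) (m2 := leb)). Qed.

Lemma haar_tonelli (f : H * mR -> \bar R) : measurable_fun setT f ->
  (forall p, 0 <= f p) ->
  \int[haar R]_p \int[leb]_s f (p, s) = \int[leb]_s \int[haar R]_p f (p, s).
Proof. by move=> mf f0; exact: (fubini_tonelli (m1 := haar_sf) (m2 := leb)). Qed.

Lemma ge0_integral_hmulr (a : H) (f : H -> \bar R) : measurable_fun setT f ->
  (forall p, 0 <= f p) ->
  \int[haar R]_p f (hmul p a) = \int[haar R]_p f p.
Proof.
move=> mf f0.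
have mfa : measurable_fun setT (fun p => f (hmul p a)).
  by apply: (measurableT_comp mf); exact: measurable_hmul.
rewrite (ge0_integral_haar mfa (fun=> f0 _)) (ge0_integral_haar mf f0).
pose F (z : mR * mR) := \int[leb]_t f (z, t).
have mF : measurable_fun setT F by exact: measurable_fun_fubini_tonelli_F.
have F0 z : 0 <= F z by exact: integral_ge0.
transitivity (\int[leb2]_z F (z.1 + a.1.1, z.2 + a.1.2)%R).
  apply: eq_integral => z _.
  pose c := (a.2 + 2^-1 * (z.1 * a.1.2 - z.2 * a.1.1))%R.
  have mz : measurable_fun setT
      (fun t : mR => f (z.1 + a.1.1, z.2 + a.1.2, t)%R).
    exact: (measurableT_comp mf (pair1_measurable _)).
  rewrite /F -(ge0_integral_shift c mz)//.
  by apply: eq_integral => t _; rewrite hmulE /= /c addrA.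
have mFa : measurable_fun setT (fun z : mR * mR => F (z.1 + a.1.1, z.2 + a.1.2)%R).
  apply: (measurableT_comp mF); apply: measurable_fun_pair => /=; exact: measurable_funD.
rewrite (ge0_integral_leb2 mFa (fun=> F0 _)) (ge0_integral_leb2 mF F0).
have mF1 x : measurable_fun setT (fun y => F (x, y)).
  exact: (measurableT_comp mF (pair1_measurable _)).
transitivity (\int[leb]_x (\int[leb]_y F (x + a.1.1, y)%R)).
  apply: eq_integral => x _.
  by rewrite (ge0_integral_shift a.1.2 (f := fun y => F (x + a.1.1, y)%R)).
rewrite (ge0_integral_shift a.1.1 (f := fun x => \int[leb]_y F (x, y)))//.
  exact: measurable_fun_fubini_tonelli_F.
by move=> x; exact: integral_ge0.
Qed.

End haar_integral.

Section santalo.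
Variable R : realType.
Local Notation mR := (measurableTypeR R).
Local Notation H := (mR * mR * mR)%type.
Local Notation leb := (@lebesgue_measure R).
Local Open Scope ereal_scope.

(* The shift [s + 2 pi / lam] along a geodesic is the left translation by the
   generator (0, 0, period) of its stabilizer, so that integrating over the
   fundamental domain and all [s] amounts to integrating over the group and one
   turn of the geodesic. *)
Lemma santalo (eps lam : R) (f h : H -> \bar R) : (0 < lam)%R ->
  measurable_fun setT f -> (forall p, 0 <= f p) ->
  measurable_fun setT h -> (forall p, 0 <= h p) ->
  (forall z t, h (z, t + period eps lam)%R = h (z, t)) ->
  \int[haar R]_(p in fund_dom eps lam)
    (h p * \int[leb]_s f (hmul p (geodesic eps lam s))) =
  \int[haar R]_q (f q *
    \int[leb]_(s in `]0%R, (2 * pi / lam)%R]) h (hmul q (hinv (geodesic eps lam s)))).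
Proof.
move=> l0 mf f0 mh h0 hP.
set P := period eps lam; set L := (2 * pi / lam)%R.
pose c := ((lam^-1 ^+ 2 + 2 * eps ^+ 2) / (2 * lam^-1))%R.
have c0 : (0 < c)%R.
  rewrite /c divr_gt0 ?mulr_gt0 ?invr_gt0//.
  by rewrite ltr_pwDl ?exprn_gt0 ?invr_gt0// mulr_ge0 ?sqr_ge0.
have L0 : (0 < L)%R by rewrite /L divr_gt0 ?mulr_gt0 ?pi_gt0.
have PcL : P = (c * L)%R.
  by rewrite /P /c /L /period; field; rewrite gt_eqF.
have mfd : measurable (fund_dom eps lam) := measurable_fund_dom eps lam.
pose K (q : H * mR) := h q.1 * f (hmul q.1 (geodesic eps lam q.2)).
have mga : measurable_fun setT (fun q : H * mR => geodesic eps lam q.2 : H).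
  exact: (measurableT_comp (measurable_geodesic eps lam) measurable_snd).
have mK : measurable_fun setT K.
  apply: emeasurable_funM; first exact: (measurableT_comp mh measurable_fst).
  by apply: (measurableT_comp mf); exact: measurable_hmul.
have K0 q : 0 <= K q by rewrite mule_ge0.
have mKp p : measurable_fun setT (fun s : mR => K (p, s)).
  exact: (measurableT_comp mK (pair1_measurable _)).
have mfp p : measurable_fun setT (fun s : mR => f (hmul p (geodesic eps lam s))).
  apply: (measurableT_comp mf); apply: measurable_hmul => //.
  exact: measurable_geodesic.
transitivity (\int[haar R]_(p in fund_dom eps lam) \int[leb]_s K (p, s)).
  by apply: eq_integral => p _; rewrite -ge0_integralZl.
have mG : measurable_fun setT (fun p => \int[leb]_s K (p, s)).
  exact: measurable_fun_fubini_tonelli_F.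
have G0 p : 0 <= \int[leb]_s K (p, s) by exact: integral_ge0.
pose J : set (H * mR) := [set q | q.2 \in `]0%R, L]].
have mJ : measurable J.
  rewrite (_ : J = setT `&` snd @^-1` [set` `]0%R, L]]).
    by apply: measurable_snd => //; exact: measurable_itv.
  by rewrite setTI.
have inJ p s : ((p, s) \in J) = (s \in `]0%R, L]) by apply/idP/idP; rewrite inE.
have mKJ : measurable_fun setT (K \_ J).
  by apply/(measurable_restrictT K) => //; exact: measurable_funTS.
have KJ0 q : 0 <= (K \_ J) q by rewrite patchE; case: ifP.
have KJE p : \int[leb]_(s in `]0%R, L]) K (p, s) = \int[leb]_s (K \_ J) (p, s).
  by rewrite integral_mkcond; apply: eq_integral => s _; rewrite !patchE inJ mem_setE.
transitivity (\int[haar R]_p \int[leb]_(s in `]0%R, L]) K (p, s)).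
  pose G1 := (fun p => \int[leb]_s K (p, s)) \_ (fund_dom eps lam).
  have mG1 : measurable_fun setT G1.
    apply/(measurable_restrictT (fun p => \int[leb]_s K (p, s))) => //.
    exact: measurable_funTS.
  have G10 p : 0 <= G1 p by rewrite /G1 patchE; case: ifP.
  pose G2 p := \int[leb]_(s in `]0%R, L]) K (p, s).
  have mG2 : measurable_fun setT G2.
    rewrite /G2; under eq_fun do rewrite KJE.
    exact: measurable_fun_fubini_tonelli_F.
  have G20 p : 0 <= G2 p by exact: integral_ge0.
  rewrite integral_mkcond (ge0_integral_haar mG1 G10) (ge0_integral_haar mG2 G20).
  apply: eq_integral => z _.
  rewrite -(@ge0_integral_unfold R P L c (fun ts => K (z, ts.1, ts.2)))//.
  - rewrite [RHS]integral_mkcond; apply: eq_integral => t _.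
    rewrite /G1 !patchE mem_setE; congr (if _ then _ else _).
    by apply/idP/idP; rewrite inE.
  - apply: (measurableT_comp mK).
    apply: measurable_fun_pair => //=; exact: measurable_fun_pair.
  - move=> t s; rewrite /K /= -[in RHS]/P hP; congr (_ * f _).
    rewrite /L -geodesic_period// hmulA; congr (hmul _ _).
    by rewrite hmulE /= -/P; case: z => x y /=; congr (_, _, _); ring.
under eq_integral do rewrite KJE.
rewrite (haar_tonelli mKJ KJ0).
pose N (q : H * mR) := f q.1 * h (hmul q.1 (hinv (geodesic eps lam q.2))).
have mN : measurable_fun setT N.
  apply: emeasurable_funM; first exact: (measurableT_comp mf measurable_fst).
  apply: (measurableT_comp mh); apply: measurable_hmul => //.
  by apply: (measurableT_comp (@measurable_hinv R)).
have N0 q : 0 <= N q by rewrite mule_ge0.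
have mNJ : measurable_fun setT (N \_ J).
  by apply/(measurable_restrictT N) => //; exact: measurable_funTS.
have NJ0 q : 0 <= (N \_ J) q by rewrite patchE; case: ifP.
transitivity (\int[leb]_s \int[haar R]_q (N \_ J) (q, s)).
  apply: eq_integral => s _.
  have mNs : measurable_fun setT (fun q => (N \_ J) (q, s)).
    exact: (measurableT_comp mNJ (pair2_measurable _)).
  rewrite -(ge0_integral_hmulr (geodesic eps lam s) mNs (fun q => NJ0 _)).
  apply: eq_integral => p _; rewrite !patchE !inJ; case: ifP => // _.
  by rewrite /N /K /= hmulK muleC.
rewrite -(haar_tonelli mNJ NJ0).
apply: eq_integral => q _; rewrite -ge0_integralZl//=; last first.
- apply: measurable_funTS; apply: (measurableT_comp mh); apply: measurable_hmul => //.
  by apply: (measurableT_comp (@measurable_hinv R)); exact: measurable_geodesic.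
- rewrite [RHS]integral_mkcond; apply: eq_integral => s _.
  by rewrite !patchE inJ mem_setE.
Qed.

End santalo.

(** * Complex L1 spaces and bounded extensions *)

Notation normc := ComplexField.Normc.normc.
Notation cRe := (@complex.Re _).
Notation cIm := (@complex.Im _).

Section complex_numbers.
Variable R : rcfType.
Implicit Types z w : R[i].

Lemma normc_ge0 z : 0 <= normc z.
Proof. by case: z => a b; exact: sqrtr_ge0. Qed.

Lemma ler_Re_normc z : `|cRe z| <= normc z.
Proof. by case: z => a b /=; rewrite -sqrtr_sqr; apply: ler_wsqrtr; rewrite lerDl sqr_ge0. Qed.

Lemma ler_Im_normc z : `|cIm z| <= normc z.
Proof. by case: z => a b /=; rewrite -sqrtr_sqr; apply: ler_wsqrtr; rewrite lerDr sqr_ge0. Qed.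

Lemma ler_normc_ReIm z : normc z <= `|cRe z| + `|cIm z|.
Proof.
case: z => a b /=; rewrite -[leRHS]ger0_norm ?addr_ge0//.
rewrite -(sqrtr_sqr (`|a| + `|b|)); apply: ler_wsqrtr; rewrite sqrrD !real_normK ?num_real// lerD2r lerDl.
by rewrite mulrn_wge0 ?mulr_ge0.
Qed.

Lemma complex_eqP z w : cRe z = cRe w -> cIm z = cIm w -> z = w.
Proof. by case: z w => a b [c e] /= -> ->. Qed.

Lemma ReD z w : cRe (z + w) = cRe z + cRe w. Proof. by case: z w => a b []. Qed.
Lemma ImD z w : cIm (z + w) = cIm z + cIm w. Proof. by case: z w => a b []. Qed.
Lemma ReM z w : cRe (z * w) = cRe z * cRe w - cIm z * cIm w.
Proof. by case: z w => a b []. Qed.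
Lemma ImM z w : cIm (z * w) = cRe z * cIm w + cIm z * cRe w.
Proof. by case: z w => a b []. Qed.
Lemma ReN z : cRe (- z) = - cRe z. Proof. by case: z. Qed.
Lemma ImN z : cIm (- z) = - cIm z. Proof. by case: z. Qed.

End complex_numbers.

Section complex_integral.
Context d (T : measurableType d) (R : realType).
Variable mu : {measure set T -> \bar R}.
Implicit Types (f g : T -> R[i]) (a : R[i]).

Lemma cintegrable_lin a f g : cintegrable mu f -> cintegrable mu g ->
  cintegrable mu (fun x => a * f x + g x).
Proof.
move=> fi gi; have [_ /(_ a f g)] := cintegrable_submod_closed mu.
rewrite !inE; exact.
Qed.

Lemma cintegral_lin a f g : cintegrable mu f -> cintegrable mu g ->
  cintegral mu (fun x => a * f x + g x) = a * cintegral mu f + cintegral mu g.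
Proof.
move=> [f1 f2] [g1 g2]; rewrite /cintegral.
have Z (c : R) (u : T -> R) : mu.-integrable setT (EFin \o u) ->
    mu.-integrable setT (EFin \o (fun x => c * u x)).
  by move=> ui; exact: (integrableZl measurableT c ui).
apply: complex_eqP; rewrite ?ReD ?ImD ?ReM ?ImM /=.
- under eq_Rintegral do rewrite ReD ReM.
  rewrite RintegralD ?RintegralB ?RintegralZl//; try exact: Z.
  exact: (integrableB measurableT (Z _ _ f1) (Z _ _ f2)).
- under eq_Rintegral do rewrite ImD ImM.
  rewrite RintegralD ?RintegralD ?RintegralZl//; try exact: Z.
  exact: (integrableD measurableT (Z _ _ f2) (Z _ _ f1)).
Qed.

Lemma cintegrable0 : cintegrable mu (fun=> 0).
Proof. by split; exact: integrable0. Qed.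

Lemma cintegrable_measurable f : cintegrable mu f ->
  measurable_fun setT (fun x => cRe (f x)) /\
  measurable_fun setT (fun x => cIm (f x)).
Proof.
by move=> [/measurable_int/measurable_EFinP f1 /measurable_int/measurable_EFinP f2].
Qed.

Lemma measurable_normc f : measurable_fun setT (fun x => cRe (f x)) ->
  measurable_fun setT (fun x => cIm (f x)) ->
  measurable_fun setT (fun x => normc (f x)).
Proof.
move=> f1 f2.
rewrite (_ : (fun x => _) =
    (fun x => Num.sqrt (cRe (f x) ^+ 2 + cIm (f x) ^+ 2))); last first.
  by apply/funext => x; case: (f x).
apply: measurableT_comp.
  exact: (continuous_measurable_fun (@sqrt_continuous R)).
by apply: measurable_funD; exact: measurable_funX.
Qed.

End complex_integral.

Section L1_representatives.
Context d (T : measurableType d) (R : realType).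
Variable mu : {measure set T -> \bar R}.
Local Open Scope quotient_scope.
Implicit Types (F G : L1 mu) (a : R[i]).

Lemma repr_cintegrable F : cintegrable mu (repr F : T -> R[i]).
Proof. by have := L1fun_valP (repr F); rewrite inE. Qed.

Lemma L1rep_repr F : L1rep F (repr F).
Proof. by split; [exact: repr_cintegrable|exact: aeW]. Qed.

Lemma cintegrable_mem (f : T -> R[i]) : cintegrable mu f ->
  (f : T -> R[i]^o) \in cintegrable_pred mu.
Proof. by rewrite inE. Qed.

Definition L1class (f : T -> R[i]) (fi : cintegrable mu f) : L1 mu :=
  \pi_(L1 mu) (MkL1fun (cintegrable_mem fi)).

Lemma L1rep_class (f : T -> R[i]) (fi : cintegrable mu f) : L1rep (L1class fi) f.
Proof. by split => //; exact: (L1_reprP (MkL1fun (cintegrable_mem fi))). Qed.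

Lemma L1rep_inj F G (f : T -> R[i]) : L1rep F f -> L1rep G f -> F = G.
Proof.
move=> [_ Ff] [_ Gf]; rewrite -(reprK F) -(reprK G); apply: L1_eqP.
by apply: filterS2 Ff Gf => x -> ->.
Qed.

Lemma L1rep_ae F (f g : T -> R[i]) : cintegrable mu g ->
  {ae mu, forall x, f x = g x} -> L1rep F f -> L1rep F g.
Proof. by move=> gi fg [_ Ff]; split => //; apply: filterS2 Ff fg => x -> ->. Qed.

Lemma L1rep_lin a F G (f g : T -> R[i]) : L1rep F f -> L1rep G g ->
  L1rep (a *: F + G) (fun x => a * f x + g x).
Proof.
move=> [fi Ff] [gi Gg]; split; first exact: cintegrable_lin.
have -> : a *: F + G = \pi_(L1 mu) (a *: repr F + repr G).
  rewrite -[LHS]/(L1_add (L1_scale a F) G) -[in LHS](reprK F) -[in LHS](reprK G).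
  by rewrite L1_scaleE L1_addE.
have := L1_reprP (a *: repr F + repr G).
by move=> h; apply: filterS3 h Ff Gg => x -> /= <- <-.
Qed.

Lemma L1rep0 : L1rep (0 : L1 mu) (fun=> 0).
Proof. by split; [exact: cintegrable0|exact: (L1_reprP (0 : L1fun mu))]. Qed.

Lemma L1norm_rep F f : L1rep F f ->
  L1norm F = (\int[mu]_x (normc (f x))%:E)%E.
Proof.
move=> [fi Ff]; have [f1 f2] := cintegrable_measurable fi.
have [F1 F2] := cintegrable_measurable (repr_cintegrable F).
apply: ge0_ae_eq_integral => //.
- by apply/measurable_EFinP; exact: measurable_normc.
- by apply/measurable_EFinP; exact: measurable_normc.
- by move=> x _; rewrite lee_fin; exact: normc_ge0.
- by move=> x _; rewrite lee_fin; exact: normc_ge0.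
- by apply: filterS Ff => x -> _.
Qed.

Lemma L1norm_ge0 F : (0 <= L1norm F)%E.
Proof. by apply: integral_ge0 => x _; rewrite lee_fin; exact: normc_ge0. Qed.

Lemma L1norm_eq0 F : L1norm F = 0%E -> F = 0.
Proof.
have [F1 F2] := cintegrable_measurable (repr_cintegrable F).
move=> F0; have : (\int[mu]_x `|(normc (repr F x))%:E|)%E = 0%E.
  by rewrite -[RHS]F0; apply: eq_integral => x _; rewrite gee0_abs// lee_fin normc_ge0.
move=> /ae_eq_integral_abs -/(_ measurableT) F0'.
apply: (@L1rep_inj _ _ (fun=> 0)) L1rep0; split; first exact: cintegrable0.
apply: filterS (F0' _) => [x /(_ I) [] /ComplexField.Normc.eq0_normc//|].
by apply/measurable_EFinP; exact: measurable_normc.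
Qed.

End L1_representatives.

Section fibre_integral.
Context d1 d2 (T1 : measurableType d1) (T2 : measurableType d2) (R : realType).
Variables (mu : {measure set T1 -> \bar R}) (nu : {measure set T2 -> \bar R}).
Local Notation mR := (measurableTypeR R).
Local Notation leb := (@lebesgue_measure R).
Variables (Gam : T2 * mR -> T1) (C : R).
Hypothesis mGam : measurable_fun setT Gam.
Hypothesis C0 : 0 <= C.
Hypothesis GamC : forall f : T1 -> \bar R, measurable_fun setT f ->
  (forall x, 0 <= f x)%E ->
  (\int[nu]_q \int[leb]_s f (Gam (q, s)) <= C%:E * \int[mu]_x f x)%E.
Implicit Types (u v : T1 -> R) (f g : T1 -> R[i]).

Let B u q := (\int[leb]_s (`|u (Gam (q, s))|)%:E)%E.

Definition fibre_integral f q := cintegral leb (fun s => f (Gam (q, s))).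
Local Notation A := fibre_integral.

Let mcomp u : measurable_fun setT u ->
  measurable_fun setT (fun qs : T2 * mR => u (Gam qs)).
Proof. by move=> mu_; exact: measurableT_comp. Qed.

Let mcomp1 u q : measurable_fun setT u ->
  measurable_fun setT (fun s : mR => u (Gam (q, s))).
Proof.
by move=> mu_; exact: (measurableT_comp (mcomp mu_) (pair1_measurable _)).
Qed.

Let B_ge0 u q : (0 <= B u q)%E.
Proof. by apply: integral_ge0 => s _; rewrite lee_fin. Qed.

Let mB u : measurable_fun setT u -> measurable_fun setT (B u).
Proof.
move=> mu_; apply: (measurable_fun_fubini_tonelli_F
  (fun qs : T2 * mR => (`|u (Gam qs)|)%:E)) => [|qs]; last by rewrite lee_fin.
by apply/measurable_EFinP; apply: measurableT_comp => //; exact: mcomp.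
Qed.

Let B_le u : measurable_fun setT u ->
  (\int[nu]_q B u q <= C%:E * \int[mu]_x (`|u x|)%:E)%E.
Proof.
move=> mu_; apply: (GamC (f := fun x => (`|u x|)%:E)) => [|x]; last by rewrite lee_fin.
by apply/measurable_EFinP; exact: measurableT_comp.
Qed.

Let Bi u : mu.-integrable setT (EFin \o u) -> nu.-integrable setT (B u).
Proof.
move=> /integrableP[/measurable_EFinP mu_ uoo].
apply/integrableP; split; first exact: mB.
under eq_integral do rewrite gee0_abs//.
by rewrite (le_lt_trans (B_le mu_))// lte_mul_pinfty.
Qed.

Let section_integrable u : mu.-integrable setT (EFin \o u) ->
  {ae nu, forall q, leb.-integrable setT (fun s => (u (Gam (q, s)))%:E)}.
Proof.
move=> ui; have /measurable_int/measurable_EFinP mu_ := ui.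
apply: filterS (integrable_ae measurableT (Bi ui)) => q /(_ I) Bq.
apply/integrableP; split; first by apply/measurable_EFinP; exact: mcomp1.
rewrite -[ltLHS]/(B u q).
by rewrite -ge0_fin_numE.
Qed.

Lemma section_cintegrable f : cintegrable mu f ->
  {ae nu, forall q, cintegrable leb (fun s => f (Gam (q, s)))}.
Proof.
by move=> [/section_integrable f1 /section_integrable f2]; exact: filterS2 f1 f2.
Qed.

Let measurable_Rint u : measurable_fun setT u ->
  measurable_fun setT (fun q => (\int[leb]_s u (Gam (q, s)))%R).
Proof.
move=> mu_.
have mE : measurable_fun setT (fun qs : T2 * mR => (u (Gam qs))%:E).
  by apply/measurable_EFinP; exact: mcomp.
have mp : measurable_fun setT (fun q => \int[leb]_s (u (Gam (q, s)))%:E)%E.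
  under eq_fun do rewrite integralE.
  apply: emeasurable_funB.
  - have := @measurable_fun_fubini_tonelli_F _ _ _ _ _ leb _
      (measurable_funepos mE) (fun=> funepos_ge0 _ _).
    by congr measurable_fun; apply/funext => q; apply: eq_integral => s _; rewrite !funeposE.
  - have := @measurable_fun_fubini_tonelli_F _ _ _ _ _ leb _
      (measurable_funeneg mE) (fun=> funeneg_ge0 _ _).
    by congr measurable_fun; apply/funext => q; apply: eq_integral => s _; rewrite !funenegE.
exact: (measurableT_comp (fine_measurable measurableT) mp).
Qed.

Let Rint_le u q : measurable_fun setT u ->
  ((`|\int[leb]_s u (Gam (q, s))|)%:E <= B u q)%E.
Proof.
move=> mu_; rewrite /Rintegral.
have : (`|\int[leb]_s (u (Gam (q, s)))%:E| <= B u q)%E.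
  apply: (le_abse_integral leb measurableT).
  by apply/measurable_EFinP; exact: mcomp1.
by case: (integral _ _ _) => [r|_|_] //=; rewrite normr0.
Qed.

Lemma fibre_integral_cintegrable f : cintegrable mu f -> cintegrable nu (A f).
Proof.
move=> fi; have [m1 m2] := cintegrable_measurable fi; case: fi => f1 f2.
split.
- apply: le_integrable (Bi f1) => //.
  + by apply/measurable_EFinP; exact: (measurable_Rint m1).
  + by move=> q _; rewrite [leRHS]gee0_abs ?B_ge0//; exact: (Rint_le q m1).
- apply: le_integrable (Bi f2) => //.
  + by apply/measurable_EFinP; exact: (measurable_Rint m2).
  + by move=> q _; rewrite [leRHS]gee0_abs ?B_ge0//; exact: (Rint_le q m2).
Qed.

Lemma fibre_integral_lin (a : R[i]) f g : cintegrable mu f -> cintegrable mu g ->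
  {ae nu, forall q, A (fun x => a * f x + g x) q = a * A f q + A g q}.
Proof.
move=> /section_cintegrable fi /section_cintegrable gi.
by apply: filterS2 fi gi => q fq gq; exact: cintegral_lin.
Qed.

Let Rint0 u : measurable_fun setT u -> {ae mu, forall x, u x = 0} ->
  {ae nu, forall q, (\int[leb]_s u (Gam (q, s)) = 0)%R}.
Proof.
move=> mu_ u0.
have : (\int[mu]_x (`|u x|)%:E)%E = 0%E.
  apply/(ae_eq_integral_abs mu measurableT (f := EFin \o u)).
    exact/measurable_EFinP.
  by apply: filterS u0 => x /= -> _.
move: (B_le mu_) => /[swap] ->; rewrite mule0 => Ble.
have B0 : (\int[nu]_q `|B u q|)%E = 0%E.
  under eq_integral do rewrite gee0_abs//.
  by apply/eqP; rewrite eq_le Ble/= integral_ge0.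
move/(ae_eq_integral_abs nu measurableT (mB mu_)) : B0.
apply: filterS => q /(_ I) Bq; apply/eqP; rewrite -normr_le0 -lee_fin.
by rewrite (le_trans (Rint_le q mu_))// Bq.
Qed.

Lemma fibre_integral_ae f g : cintegrable mu f -> cintegrable mu g ->
  {ae mu, forall x, f x = g x} -> {ae nu, forall q, A f q = A g q}.
Proof.
move=> fi gi fg.
have hi := cintegrable_lin (-1) fi gi.
have [m1 m2] := cintegrable_measurable hi.
have h1 := Rint0 m1; have h2 := Rint0 m2.
apply: filterS3 (fibre_integral_lin (-1) fi gi) (h1 _) (h2 _) => [q H1 H2 H3||].
- apply/esym/eqP; rewrite -subr_eq0 addrC -mulN1r -H1.
  by apply/eqP; apply: complex_eqP => /=.
- by apply: filterS fg => x ->; rewrite mulN1r addNr.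
- by apply: filterS fg => x ->; rewrite mulN1r addNr.
Qed.

Lemma fibre_integral_norm f : cintegrable mu f ->
  (\int[nu]_q (normc (A f q))%:E <= (C *+ 2)%:E * \int[mu]_x (normc (f x))%:E)%E.
Proof.
move=> fi; have [m1 m2] := cintegrable_measurable fi.
have [M1 M2] := cintegrable_measurable (fibre_integral_cintegrable fi).
have mn : measurable_fun setT (fun x => (normc (f x))%:E).
  by apply/measurable_EFinP; exact: measurable_normc.
have n0 x : (0 <= (normc (f x))%:E)%E by rewrite lee_fin normc_ge0.
apply: (@le_trans _ _ (\int[nu]_q (B (cRe \o f) q + B (cIm \o f) q)%E)%E).
  apply: ge0_le_integral => //.
  - by move=> q _; rewrite lee_fin normc_ge0.
  - by apply/measurable_EFinP; exact: measurable_normc.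
  - by apply: emeasurable_funD; exact: mB.
  - move=> q _; apply: le_trans (leeD (Rint_le q m1) (Rint_le q m2)).
    by rewrite -EFinD lee_fin; exact: ler_normc_ReIm.
rewrite (ge0_integralD nu measurableT (fun _ _ => B_ge0 _ _) (mB m1) (fun _ _ => B_ge0 _ _) (mB m2)).
have le1 u : measurable_fun setT u -> (forall x, `|u x| <= normc (f x)) ->
    (\int[nu]_q B u q <= C%:E * \int[mu]_x (normc (f x))%:E)%E.
  move=> mu_ uf; apply: le_trans (B_le mu_) _.
  rewrite lee_wpmul2l ?lee_fin//; apply: ge0_le_integral => //.
  - by apply/measurable_EFinP; exact: measurableT_comp.
  - by move=> x _; rewrite lee_fin.
rewrite mulr2n EFinD ge0_muleDl ?lee_fin//; apply: leeD; apply: le1 => // x.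
- exact: ler_Re_normc.
- exact: ler_Im_normc.
Qed.

Definition fibre_ext (F : L1 mu) : L1 nu :=
  L1class (fibre_integral_cintegrable (repr_cintegrable F)).

Lemma fibre_extP F f : L1rep F f -> L1rep (fibre_ext F) (A f).
Proof.
move=> [fi Ff]; apply: L1rep_ae (L1rep_class _).
  exact: fibre_integral_cintegrable.
by apply: fibre_integral_ae => //; exact: repr_cintegrable.
Qed.

Lemma is_bounded_ext_fibre_ext D : is_bounded_ext D A fibre_ext.
Proof.
split.
- move=> a F G.
  have H1 := fibre_extP (L1rep_lin a (L1rep_repr F) (L1rep_repr G)).
  have H2 := L1rep_lin a (fibre_extP (L1rep_repr F)) (fibre_extP (L1rep_repr G)).
  apply: L1rep_inj (H2); apply: L1rep_ae H1; first by case: H2.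
  by apply: fibre_integral_lin; exact: repr_cintegrable.
- exists (C *+ 2) => F.
  rewrite (L1norm_rep (fibre_extP (L1rep_repr F))).
  exact: (fibre_integral_norm (repr_cintegrable F)).
- by move=> F f _; exact: fibre_extP.
Qed.

End fibre_integral.

Section nondecreasing_sets.
Context (T1 T2 : Type).

Lemma nondecreasing_setX (F : (set T1)^nat) (G : (set T2)^nat) :
  nondecreasing_seq F -> nondecreasing_seq G ->
  nondecreasing_seq (fun n => F n `*` G n).
Proof.
move=> ndF ndG m n mn; apply/subsetPset.
have /subsetPset Fmn := ndF _ _ mn; have /subsetPset Gmn := ndG _ _ mn.
by move=> [x y] /= [Fx Gy]; split; [exact: Fmn|exact: Gmn].
Qed.

Lemma nondecreasing_cst_set (A : set T1) : nondecreasing_seq (fun=> A).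
Proof. by move=> m n _; apply/subsetPset. Qed.

End nondecreasing_sets.

Section product_lambda_system.
Context d1 d2 (T1 : measurableType d1) (T2 : measurableType d2).
Variables (G1 : set (set T1)) (G2 : set (set T2)).
Variables (E1 : (set T1)^nat) (E2 : (set T2)^nat).
Hypotheses (G1I : setI_closed G1) (G2I : setI_closed G2).
Hypotheses (sG1 : measurable `<=` <<s G1 >>) (sG2 : measurable `<=` <<s G2 >>).
Hypotheses (GE1 : forall n, G1 (E1 n)) (GE2 : forall n, G2 (E2 n)).
Hypotheses (ndE1 : nondecreasing_seq E1) (ndE2 : nondecreasing_seq E2).
Hypotheses (UE1 : \bigcup_n E1 n = setT) (UE2 : \bigcup_n E2 n = setT).

Lemma product_lambda_system (P : set (set (T1 * T2))) : lambda_system setT P ->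
  (forall A B, G1 A -> G2 B -> P (A `*` B)) ->
  forall X, measurable X -> P X.
Proof.
move=> PL; have [_ PT PD Pnd] := PL; move=> PG.
have P1 A B : measurable A -> G2 B -> P (A `*` B).
  move=> mA GB; pose L : set (set T1) := [set A | P (A `*` B)].
  suff : <<s G1 >> `<=` L by apply; exact: sG1.
  apply: lambda_system_subset => //; last by move=> A' GA'; exact: PG.
  split=> //.
  - rewrite /L /= -UE1 (_ : _ `*` B = \bigcup_n (E1 n `*` B)).
      by apply: Pnd => [|n]; [apply: nondecreasing_setX => //; exact: nondecreasing_cst_set|exact: PG].
    by apply/seteqP; split => [[x y] /= [[n _ Ex] By]|[x y] /= [n _ [Ex By]]];
      [exists n|split => //; exists n].
  - move=> A1 A2 A21 LA1 LA2; rewrite /L /=.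
    rewrite (_ : _ `*` B = (A1 `*` B) `\` (A2 `*` B)).
      by apply: PD => // -[x y] /= [Ax By]; split => //; exact: A21.
    apply/seteqP; split => -[x y] /=; first by move=> [[Ax nAx] By]; split => // -[].
    by move=> [[Ax By] nAB]; split => //; split => // A2x; exact: nAB.
  - move=> F ndF LF; rewrite /L /= (_ : _ `*` B = \bigcup_n (F n `*` B)).
      by apply: Pnd => [|n]; [apply: nondecreasing_setX => //; exact: nondecreasing_cst_set|exact: LF].
    by apply/seteqP; split => [[x y] /= [[n _ Ex] By]|[x y] /= [n _ [Ex By]]];
      [exists n|split => //; exists n].
have P2 A B : measurable A -> measurable B -> P (A `*` B).
  move=> mA mB; pose L : set (set T2) := [set B | P (A `*` B)].
  suff : <<s G2 >> `<=` L by apply; exact: sG2.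
  apply: lambda_system_subset => //; last by move=> B' GB'; exact: P1.
  split=> //.
  - rewrite /L /= -UE2 (_ : A `*` _ = \bigcup_n (A `*` E2 n)).
      by apply: Pnd => [|n]; [apply: nondecreasing_setX => //; exact: nondecreasing_cst_set|exact: P1].
    by apply/seteqP; split => [[x y] /= [Ax [n _ Ex]]|[x y] /= [n _ [Ex By]]];
      [exists n|split => //; exists n].
  - move=> A1 A2 A21 LA1 LA2; rewrite /L /=.
    rewrite (_ : A `*` _ = (A `*` A1) `\` (A `*` A2)).
      by apply: PD => // -[x y] /= [Ax By]; split => //; exact: A21.
    apply/seteqP; split => -[x y] /=; first by move=> [Ax [By nBy]]; split => // -[].
    by move=> [[Ax By] nAB]; split => //; split => // A2x; exact: nAB.
  - move=> F ndF LF; rewrite /L /= (_ : A `*` _ = \bigcup_n (A `*` F n)).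
      by apply: Pnd => [|n]; [apply: nondecreasing_setX => //; exact: nondecreasing_cst_set|exact: LF].
    by apply/seteqP; split => [[x y] /= [Ax [n _ Ex]]|[x y] /= [n _ [Ex By]]];
      [exists n|split => //; exists n].
move=> X mX.
pose M := [set A `*` B | A in (@measurable _ T1) & B in (@measurable _ T2)].
suff : <<s M >> `<=` P by apply; rewrite -measurable_prod_measurableType.
apply: lambda_system_subset => //.
- move=> _ _ [A mA [B mB <-]] [A' mA' [B' mB' <-]]; exists (A `&` A').
    exact: measurableI.
  by exists (B `&` B'); [exact: measurableI|rewrite setXI].
- by move=> _ [A mA [B mB <-]]; exact: P2.
Qed.

End product_lambda_system.

Section boxes.
Variable R : realType.
Local Notation mR := (measurableTypeR R).
Local Notation H := (mR * mR * mR)%type.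

Let E (n : nat) : set mR := `](- n%:R), n%:R]%classic.

Let ndE : nondecreasing_seq E.
Proof.
move=> m n mn; apply/subsetPset => x; rewrite /E /= !in_itv /= => /andP[mx xm].
have mn' : m%:R <= n%:R :> R by rewrite ler_nat.
by apply/andP; split; lra.
Qed.

Let UE : \bigcup_n E n = setT.
Proof.
apply/seteqP; split => // x _; exists (Num.truncn `|x|).+1 => //=.
have /ltr_normlP[] := truncnS_gt `|x|.
by rewrite /E /= in_itv /= => h1 h2; apply/andP; split; [rewrite ltrNl|exact: ltW].
Qed.

Let oI : setI_closed (@ocitv R).
Proof. exact: ocitvI. Qed.

Lemma boxes_lambda_system (P : set (set H)) : lambda_system setT P ->
  (forall a1 b1 a2 b2 a3 b3 : R,
    P (`]a1, b1]%classic `*` `]a2, b2]%classic `*` `]a3, b3]%classic)) ->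
  forall X, measurable X -> P X.
Proof.
move=> PL; have [_ PT PD Pnd] := PL; move=> PG.
have PI A C : @measurable _ (mR * mR)%type A -> ocitv C -> P (A `*` C).
  move=> mA [c _ <-]; pose L : set (set (mR * mR)) := [set A | P (A `*` `]c.1, c.2]%classic)].
  have LG A' B' : ocitv A' -> ocitv B' -> L (A' `*` B').
    by move=> [a _ <-] [b _ <-]; exact: PG.
  suff : lambda_system setT L.
    move=> LL; rewrite -[P _]/(L A).
    refine (@product_lambda_system _ _ mR mR (@ocitv R) (@ocitv R) E E
      _ _ _ _ _ _ _ _ _ _ L LL LG A mA) => //.
    - by move=> n; exact: is_ocitv.
    - by move=> n; exact: is_ocitv.
  set D := `]c.1, c.2]%classic in L LG *.
  split=> //.
  - rewrite /L /= (_ : setT `*` D = \bigcup_n (E n `*` E n `*` D)).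
      apply: Pnd => [|n]; last by apply: PG.
      by apply: nondecreasing_setX; [exact: nondecreasing_setX|exact: nondecreasing_cst_set].
    apply/seteqP; split => [[[x y] z] /= [_ Cz]|[[x y] z] /= [n _ []]//].
    have : [set: mR] x by []. have : [set: mR] y by [].
    rewrite -UE => -[n _ Ey] [m _ Ex]; exists (maxn m n) => //; split => //; split.
    + by have /subsetPset := @ndE _ _ (leq_maxl m n); exact.
    + by have /subsetPset := @ndE _ _ (leq_maxr m n); exact.
  - move=> A1 A2 A21 LA1 LA2; rewrite /L /=.
    rewrite (_ : _ `*` D = (A1 `*` D) `\` (A2 `*` D)).
      by apply: PD => // -[x y] /= [Ax By]; split => //; exact: A21.
    apply/seteqP; split => -[x y] /=; first by move=> [[Ax nAx] By]; split => // -[].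
    by move=> [[Ax By] nAB]; split => //; split => // A2x; exact: nAB.
  - move=> F ndF LF; rewrite /L /= (_ : _ `*` D = \bigcup_n (F n `*` D)).
      by apply: Pnd => [|n]; [apply: nondecreasing_setX => //; exact: nondecreasing_cst_set|exact: LF].
    by apply/seteqP; split => [[x y] /= [[n _ Ex] By]|[x y] /= [n _ [Ex By]]];
      [exists n|split => //; exists n].
refine (@product_lambda_system _ _ (mR * mR)%type mR measurable (@ocitv R) (fun=> setT) E
  _ _ _ _ _ _ _ _ _ _ P PL PI) => //.
- by move=> A B mA mB; exact: measurableI.
- by move=> n; exact: is_ocitv.
- by apply/seteqP; split => // x _; exists 0%N.
Qed.

End boxes.

Section dominated_L1.
Context d (T : measurableType d) (R : realType).
Variable mu : {measure set T -> \bar R}.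
Implicit Types u v g : T -> R.

Lemma cintegrable_real u : mu.-integrable setT (EFin \o u) ->
  cintegrable mu (fun x => (u x)%:C).
Proof. by move=> ui; split => //=; exact: integrable0. Qed.

Lemma normc_real (a : R) : normc a%:C = `|a|.
Proof. by rewrite /= expr0n addr0 sqrtr_sqr. Qed.

Lemma L1rep_dominated (u_ : (T -> R)^nat) u g (F_ : (L1 mu)^nat) F :
  (forall n, L1rep (F_ n) (fun x => (u_ n x)%:C)) -> L1rep F (fun x => (u x)%:C) ->
  mu.-integrable setT (EFin \o g) -> (forall n x, `|u_ n x| <= g x) ->
  (forall x, u_ ^~ x @ \oo --> u x) ->
  (fun n => L1norm (F_ n - F)) @ \oo --> 0%E.
Proof.
move=> u_F uF gi ug uu.
have mu_ n : measurable_fun setT (u_ n).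
  by have [/cintegrable_measurable[]] := u_F n.
have mu0 : measurable_fun setT u.
  by have [/cintegrable_measurable[]] := uF.
have [|||||_ + _] := @dominated_convergence _ _ _ mu setT measurableT
  (fun n => EFin \o u_ n) (EFin \o u) (EFin \o g).
- by move=> n; exact/measurable_EFinP.
- exact/measurable_EFinP.
- by apply: aeW => x _; apply: cvg_EFin; [exact: nearW|exact: uu].
- exact: gi.
- by apply: aeW => x n _; rewrite lee_fin.
apply: cvg_trans; apply: near_eq_cvg; apply: nearW => n /=.
have h := L1rep_lin (-1) uF (u_F n).
rewrite addrC -scaleN1r (L1norm_rep h); apply: eq_integral => x _.
rewrite (_ : -1 * _ + _ = (u_ n x - u x)%:C) ?normc_real//.
by rewrite mulN1r addrC rmorphB.
Qed.

End dominated_L1.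

Section indicators.
Context d (T : measurableType d) (R : realType).
Variable mu : {measure set T -> \bar R}.

Lemma integrable_indic_lty (A : set T) : measurable A -> (mu A < +oo)%E ->
  mu.-integrable setT (EFin \o (\1_A : T -> R)).
Proof.
move=> mA Aoo; apply/integrableP; split; first exact/measurable_EFinP.
under eq_integral do rewrite gee0_abs ?lee_fin//.
by rewrite integral_indic// setIT.
Qed.

Lemma cvg_indic_bigcup (F : (set T)^nat) (x : T) : nondecreasing_seq F ->
  (fun n => \1_(F n) x : R) @ \oo --> (\1_(\bigcup_n F n) x : R).
Proof.
move=> ndF; rewrite indicE; case: (asboolP ((\bigcup_n F n) x)) => [[k _ Fkx]|nF].
  rewrite mem_set; last by exists k.
  apply: cvg_near_cst; exists k => // n /= kn; rewrite indicE mem_set//.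
  by have /subsetPset := ndF _ _ kn; exact.
rewrite memNset//; apply: cvg_near_cst; apply: nearW => n.
by rewrite indicE memNset// => Fn; apply: nF; exists n.
Qed.

End indicators.

Section density.
Variable R : realType.
Local Notation mR := (measurableTypeR R).
Local Notation H := (mR * mR * mR)%type.
Local Notation leb := (@lebesgue_measure R).
Local Notation mu := (haar R).
Variable P : L1 mu -> Prop.
Hypothesis Plin : forall (a : R[i]) F G, P F -> P G -> P (a *: F + G).
Hypothesis Pclosed : forall F (F_ : (L1 mu)^nat), (forall n, P (F_ n)) ->
  (fun n => L1norm (F_ n - F)) @ \oo --> 0%E -> P F.
Hypothesis PCc : forall F f, Cc f -> L1rep F f -> P F.

Let W (u : H -> R) := exists2 F : L1 mu, L1rep F (fun p => (u p)%:C) & P F.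

Let W_dominated (u_ : (H -> R)^nat) u g : (forall n, W (u_ n)) ->
  mu.-integrable setT (EFin \o g) -> (forall n x, `|u_ n x| <= g x) ->
  (forall x, u_ ^~ x @ \oo --> u x) -> W u.
Proof.
move=> Wu gi ug uu; pose F_ n := sval (cid2 (Wu n)).
have HF n : L1rep (F_ n) (fun p => (u_ n p)%:C) /\ P (F_ n).
  by rewrite /F_; case: cid2.
have mu_ n : measurable_fun setT (u_ n).
  by have [[/cintegrable_measurable[]]] := HF n.
have [|||||ui _ _] := @dominated_convergence _ _ _ mu setT measurableT
  (fun n => EFin \o u_ n) (EFin \o u) (EFin \o g).
- by move=> n; exact/measurable_EFinP.
- apply: (emeasurable_fun_cvg (fun n => EFin \o u_ n)) => [n|x _].
    exact/measurable_EFinP.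
  by apply: cvg_EFin; [exact: nearW|exact: uu].
- by apply: aeW => x _; apply: cvg_EFin; [exact: nearW|exact: uu].
- exact: gi.
- by apply: aeW => x n _; rewrite lee_fin.
exists (L1class (cintegrable_real ui)); first exact: L1rep_class.
apply: (Pclosed (F_ := F_)) => [n|]; first by have [] := HF n.
apply: (L1rep_dominated (u_ := u_) _ (L1rep_class _)) gi ug uu => n.
by have [] := HF n.
Qed.

Let W_lin a u v : W u -> W v -> W (fun p => a * u p + v p).
Proof.
move=> [F Fu PF] [G Gv PG]; exists (a%:C *: F + G); last exact: Plin.
have := L1rep_lin a%:C Fu Gv.
by under eq_fun do rewrite -rmorphM -rmorphD.
Qed.

Let clamp (y : R) := (1 + `|y| - `|1 - y|) / 2.

Let clamp_cases y : clamp y = if y <= 0 then 0 else if y <= 1 then y else 1.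
Proof.
rewrite /clamp; have [y0|y0] := leP y 0.
  by rewrite ler0_norm// ger0_norm; lra.
have [y1|y1] := leP y 1; rewrite (gtr0_norm y0).
  rewrite ger0_norm ?subr_ge0//; lra.
rewrite ltr0_norm ?subr_lt0//; lra.
Qed.

Let clamp01 y : 0 <= clamp y <= 1.
Proof.
rewrite clamp_cases; have [y0|y0] := leP y 0; first by rewrite lexx ler01.
have [y1|y1] := leP y 1; last by rewrite ler01 lexx.
by rewrite (ltW y0) y1.
Qed.

Let trap (a b : R) n (x : R) := clamp (n%:R * (x - a)) * clamp (1 - n%:R * (x - b)).

Let trap01 a b n x : 0 <= trap a b n x <= 1.
Proof.
rewrite /trap; set y := clamp _; set z := clamp _.
have /andP[y0 y1] : 0 <= y <= 1 by exact: clamp01.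
have /andP[z0 z1] : 0 <= z <= 1 by exact: clamp01.
by rewrite mulr_ge0// mulr_ile1.
Qed.

Let trap_supp a b n x : trap a b n.+1 x != 0 -> a <= x <= b + 1.
Proof.
rewrite mulf_eq0 negb_or => /andP[]; rewrite !clamp_cases.
have n0 : 0 < n.+1%:R :> R by [].
have n1 : 1 <= n.+1%:R :> R by rewrite ler1n.
case: leP => [|+ _]; first by rewrite eqxx.
rewrite pmulr_rgt0// subr_gt0 => ax.
case: leP => [|+ _]; first by rewrite eqxx.
rewrite subr_gt0 => h; rewrite (ltW ax)/= leNgt; apply/negP => bx.
have : 1 <= n.+1%:R * (x - b) by apply: mulr_ege1 => //; lra.
by rewrite leNgt h.
Qed.

Let trap_cvg a b x : (fun n => trap a b n x) @ \oo --> (\1_(`]a, b]%classic) x : R).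
Proof.
rewrite indicE; have [ax|ax] := leP x a.
  rewrite memNset /=; last by rewrite in_itv /= ltNge ax.
  apply: cvg_near_cst; apply: nearW => n; rewrite /trap clamp_cases.
  by rewrite mulr_ge0_le0 ?subr_le0// mul0r.
have [xb|xb] := leP x b.
  rewrite mem_set /=; last by rewrite in_itv /= ax xb.
  apply: cvg_near_cst; near=> n.
  have xa : 0 < x - a by rewrite subr_gt0.
  have h : 1 < n%:R * (x - a).
    rewrite -ltr_pdivrMr// mul1r; near: n; exact: nbhs_infty_gtr.
  have h' : 1 <= 1 - n%:R * (x - b).
    by rewrite lerDl oppr_ge0 mulr_ge0_le0 ?subr_le0.
  rewrite /trap !clamp_cases; case: leP => [|_]; first lra.
  case: leP => [|_]; first lra.
  case: leP => [|_]; first lra.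
  by case: leP => [?|_]; lra.
rewrite memNset /=; last by rewrite in_itv /= ax leNgt xb.
apply: cvg_near_cst; near=> n.
have xa : 0 < x - b by rewrite subr_gt0.
have h : 1 < n%:R * (x - b).
  rewrite -ltr_pdivrMr// mul1r; near: n; exact: nbhs_infty_gtr.
rewrite /trap [X in _ * X]clamp_cases; case: leP => [_|]; first by rewrite mulr0.
by lra.
Unshelve. all: by end_near. Qed.

Let cube (N : nat) : set H := `](- N%:R), N%:R]%classic `*` `](- N%:R), N%:R]%classic
  `*` `](- N%:R), N%:R]%classic.

Let haar_box (A B C : set mR) : measurable A -> measurable B -> measurable C ->
  mu (A `*` B `*` C) = (leb A * leb B * leb C)%E.
Proof.
move=> mA mB mC; have AB := product_measure1E leb leb mA mB.
by rewrite -AB; exact: (product_measure1E (leb2 R) leb (measurableX mA mB) mC).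
Qed.

Let W_ptrap a1 b1 a2 b2 a3 b3 : exists2 g : H -> R, mu.-integrable setT (EFin \o g) &
  forall n, let u := fun p : H =>
    trap a1 b1 n.+1 p.1.1 * trap a2 b2 n.+1 p.1.2 * trap a3 b3 n.+1 p.2 in
  W u /\ forall p, `|u p| <= g p.
Proof.
pose K1 : set mR := `[a1, b1 + 1]%classic.
pose K2 : set mR := `[a2, b2 + 1]%classic.
pose K3 : set mR := `[a3, b3 + 1]%classic.
pose K : set H := K1 `*` K2 `*` K3.
have cclamp : continuous clamp.
  move=> y; apply: cvgM; last exact: cvg_cst.
  apply: cvgB.
    by apply: cvgD; [exact: cvg_cst|exact: (cvg_norm (@cvg_id _ _))].
  by apply: cvg_norm; apply: cvgB; [exact: cvg_cst|exact: cvg_id].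
have caff (a c e : R) : continuous (fun x : R => e + c * (x - a)).
  move=> x; apply: cvgD; first exact: cvg_cst.
  by apply: cvgM; [exact: cvg_cst|apply: cvgB; [exact: cvg_id|exact: cvg_cst]].
have ctrap a b m : continuous (trap a b m).
  move=> x; rewrite (_ : trap a b m = fun x =>
      clamp (0 + m%:R * (x - a)) * clamp (1 + (- m%:R) * (x - b))).
    by apply: cvgM; [exact: (continuous_comp (caff a m%:R 0 x) (cclamp _))|
      exact: (continuous_comp (caff b (- m%:R) 1 x) (cclamp _))].
  by apply/funext => z; rewrite /trap add0r mulNr.
have c11 : continuous (fun p : R * R * R => p.1.1).
  by move=> p; exact: (cvg_comp _ _ cvg_fst cvg_fst).
have c12 : continuous (fun p : R * R * R => p.1.2).
  by move=> p; exact: (cvg_comp _ _ cvg_fst cvg_snd).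
have c2 : continuous (fun p : R * R * R => p.2).
  by move=> p; exact: cvg_snd.
have cK : @closed (R * R * R)%type K.
  have -> : K = ((fun p : R * R * R => p.1.1) @^-1` K1) `&`
    ((fun p : R * R * R => p.1.2) @^-1` K2) `&` ((fun p : R * R * R => p.2) @^-1` K3).
    by [].
  have cl (a b : R) : closed (`[a, b]%classic : set R) by exact: interval_closed.
  apply: closedI; first apply: closedI.
  - exact: ((continuous_closedP _).1 c11 _ (cl _ _)).
  - exact: ((continuous_closedP _).1 c12 _ (cl _ _)).
  - exact: ((continuous_closedP _).1 c2 _ (cl _ _)).
have kK : @compact (R * R * R)%type K.
  apply: compact_setX; last exact: segment_compact.
  by apply: compact_setX; exact: segment_compact.
have mK1 (a b : R) : measurable (`[a, b]%classic : set mR) by exact: measurable_itv.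
have mK : measurable K.
  by apply: measurableX; [apply: measurableX|]; exact: mK1.
have muK : (mu K < +oo)%E.
  have K0 (a b : R) : leb `[a, b]%classic \is a fin_num.
    by rewrite lebesgue_measure_itv; case: ifP.
  rewrite (haar_box (mK1 _ _) (mK1 _ _) (mK1 _ _)) ltey_eq fin_numM//.
  by rewrite fin_numM// K0.
exists (\1_K) => [|n u]; first exact: integrable_indic_lty.
have cu : continuous (u : R * R * R -> R).
  move=> p; apply: cvgM; first apply: cvgM.
  - exact: (continuous_comp (c11 p) (ctrap a1 b1 n.+1 _)).
  - exact: (continuous_comp (c12 p) (ctrap a2 b2 n.+1 _)).
  - exact: (continuous_comp (c2 p) (ctrap a3 b3 n.+1 _)).
have suppK p : u p != 0 -> K p.
  rewrite mulf_eq0 negb_or => /andP[+ /trap_supp h3].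
  rewrite mulf_eq0 negb_or => /andP[/trap_supp h1 /trap_supp h2].
  by split; [split|]; rewrite /K1 /K2 /K3 /= in_itv.
have mu_ : measurable_fun setT u.
  apply: measurable_funM; first apply: measurable_funM.
  - exact: (measurableT_comp (continuous_measurable_fun (ctrap _ _ _)) (@measurable_H11 R)).
  - exact: (measurableT_comp (continuous_measurable_fun (ctrap _ _ _)) (@measurable_H12 R)).
  - exact: (measurableT_comp (continuous_measurable_fun (ctrap _ _ _)) (@measurable_H2 R)).
have uK p : `|u p| <= \1_K p.
  rewrite indicE; have [->|/suppK Kp] := eqVneq (u p) 0; first by rewrite normr0.
  rewrite mem_set//=.
  have m01 (x y : R) : 0 <= x <= 1 -> 0 <= y <= 1 -> 0 <= x * y <= 1.
    by move=> /andP[x0 x1] /andP[y0 y1]; rewrite mulr_ge0// mulr_ile1.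
  have /andP[u0 u1] : 0 <= u p <= 1.
    exact: (m01 _ _ (m01 _ _ (trap01 _ _ _ _) (trap01 _ _ _ _)) (trap01 _ _ _ _)).
  by rewrite ger0_norm.
have ui : mu.-integrable setT (EFin \o u).
  apply: le_integrable (integrable_indic_lty mK muK) => //; first exact/measurable_EFinP.
  by move=> p _; rewrite /= lee_fin [leRHS]ger0_norm.
split => //; exists (L1class (cintegrable_real ui)); first exact: L1rep_class.
apply: (PCc _ (L1rep_class _)); split => //=; first exact: cst_continuous.
apply: (subclosed_compact _ kK); first exact: closed_closure.
have : [set p : R * R * R | (u p)%:C != 0] `<=` K.
  by move=> p /= up; apply: suppK; apply: contraNneq up => ->.
by move=> /(@closureS (R * R * R)%type); rewrite -((closure_id (K : set (R * R * R))).1 cK).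
Qed.

Let W_box a1 b1 a2 b2 a3 b3 :
  W (\1_(`]a1, b1]%classic `*` `]a2, b2]%classic `*` `]a3, b3]%classic)).
Proof.
have [g gi Wg] := W_ptrap a1 b1 a2 b2 a3 b3.
apply: (W_dominated (fun n => (Wg n).1) gi (fun n => (Wg n).2)) => p.
rewrite (_ : \1_(_) p = \1_(`]a1, b1]%classic) p.1.1 * \1_(`]a2, b2]%classic) p.1.2 *
  \1_(`]a3, b3]%classic) p.2); last first.
  rewrite !indicE -!natrM !mulnb; congr (_ (nat_of_bool _)).
  apply/idP/idP => [/set_mem[[h1 h2] h3]|]; first by rewrite !mem_set.
  by move=> /andP[/andP[/set_mem h1 /set_mem h2] /set_mem h3]; apply: mem_set.
have tc a b x : (fun n => trap a b n.+1 x) @ \oo --> (\1_(`]a, b]%classic) x : R).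
  by have := @trap_cvg a b x; rewrite -(cvg_shiftS (fun n => trap a b n x)).
by apply: cvgM; [apply: cvgM|]; exact: tc.
Qed.

Let cube_fin N : (mu (cube N) < +oo)%E.
Proof.
have fin (a b : R) : leb `]a, b]%classic \is a fin_num.
  by rewrite lebesgue_measure_itv; case: ifP.
rewrite haar_box; [|exact: measurable_itv..].
by rewrite ltey_eq !fin_numM.
Qed.

Let cubeM N : measurable (cube N).
Proof. by apply: measurableX; [apply: measurableX|]; exact: measurable_itv. Qed.

Let W_cube N (A : set H) : measurable A -> W (\1_(A `&` cube N)).
Proof.
pose Q : set (set H) := [set A | W (\1_(A `&` cube N))].
apply: (@boxes_lambda_system R Q) => [|a1 b1 a2 b2 a3 b3]; last first.
  rewrite /Q /= /cube -!setXI.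
  have iI (a b c e : R) : `]a, b]%classic `&` `]c, e]%classic = `](Num.max a c), (Num.min b e)]%classic.
    by apply/seteqP; split => x; rewrite /= !in_itv /= gt_max le_min; [
      move=> [/andP[-> ->] /andP[-> ->]]|move=> /andP[/andP[-> ->] /andP[-> ->]]].
  by rewrite !iI; exact: W_box.
split=> //.
- by rewrite /Q /= setTI; exact: W_box.
- move=> A1 A2 A21 W1 W2; rewrite /Q /=.
  have := W_lin (-1) W2 W1; congr W; apply/funext => p.
  rewrite !indicE; case: (boolP (p \in A2 `&` cube N)) => [/set_mem[A2p Np]|nA2].
    rewrite (@mem_set _ (A1 `&` cube N) p (conj (A21 _ A2p) Np)) memNset; first by rewrite mulr1 addNr.
    by move=> [[]].
  rewrite mulr0 add0r; congr (_ (nat_of_bool _)).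
  apply/idP/idP => [/set_mem[A1p Np]|/set_mem[[A1p _] Np]]; last by apply: mem_set.
  apply: mem_set; split => //; split => // A2p.
  by move/negP: nA2; apply; apply: mem_set.
- move=> F ndF WF; rewrite /Q /=.
  apply: (W_dominated (g := \1_(cube N)) WF (integrable_indic_lty (cubeM N) (cube_fin N))).
  + move=> n p; rewrite !indicE ger0_norm// ler_nat.
    by case: (boolP (p \in F n `&` _)) => // /set_mem[_ Np]; rewrite mem_set.
  + move=> p; rewrite setI_bigcupl; apply: cvg_indic_bigcup => m n mn.
    by apply/subsetPset; apply: setSI; apply/subsetPset; exact: ndF.
Qed.

Import HBNNSimple.

Let W_nnsfun (g : {nnsfun H >-> R}) N : W (fun p => g p * \1_(cube N) p).
Proof.
have -> : (fun p => g p * \1_(cube N) p) = (fun p =>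
    \sum_(y <- finmap.enum_fset (fset_set (range g))) y * \1_(g @^-1` [set y] `&` cube N) p).
  apply/funext => p; rewrite fimfunE fsbig_finite//= mulr_suml.
  by apply: eq_bigr => y _; rewrite -mulrA indicI.
suff H s : W (fun p => \sum_(y <- s) y * \1_(g @^-1` [set y] `&` cube N) p) by exact: H.
elim: s => [|y s IH].
  have := W_cube N (@measurable0 _ H); congr W; apply/funext => p.
  by rewrite big_nil set0I indicE in_set0.
have := W_lin y (W_cube N (measurable_funPTI g (measurable_set1 y))) IH.
by congr W; apply/funext => p; rewrite big_cons.
Qed.

Let W_ge0 (u : H -> R) : mu.-integrable setT (EFin \o u) ->
  (forall p, 0 <= u p) -> W u.
Proof.
move=> ui u0; have /measurable_int mu_ := ui.
pose g_ := nnsfun_approx measurableT mu_.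
have u0E p : setT p -> (0 <= (EFin \o u) p)%E by rewrite lee_fin.
have g_u p : (fun n => g_ n p) @ \oo --> u p.
  exact: (fine_cvg (cvg_nnsfun_approx measurableT mu_ u0E (x := p) I)).
have gu n p : g_ n p <= u p.
  by rewrite -lee_fin /g_ nnsfun_approxE; exact: le_approx.
have W_ n : W (fun p => g_ n p * \1_(cube n) p) by exact: W_nnsfun.
apply: (W_dominated W_ ui) => [n p|p].
  rewrite ger0_norm ?mulr_ge0// (le_trans _ (gu n p))// indicE.
  by case: (_ \in _); rewrite ?mulr1 ?mulr0.
rewrite -[u p]mulr1; apply: cvgM; first exact: g_u.
have ndc : nondecreasing_seq cube.
  have nde : nondecreasing_seq (fun n : nat => `](- n%:R), n%:R]%classic : set mR).
    move=> m n mn; apply/subsetPset => x; rewrite /= !in_itv /= => /andP[mx xm].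
    have mn' : m%:R <= n%:R :> R by rewrite ler_nat.
    by apply/andP; split; lra.
  by apply: nondecreasing_setX => //; exact: nondecreasing_setX.
have := cvg_indic_bigcup (R := R) (x := p) ndc; rewrite [X in _ --> X](_ : _ = 1)//.
rewrite indicE mem_set//.
pose M := `|p.1.1| + `|p.1.2| + `|p.2|; exists (Num.truncn M).+1 => //.
have hM := truncnS_gt M.
have hx (x : R) : `|x| <= M -> x \in `](- (Num.truncn M).+1%:R), (Num.truncn M).+1%:R].
  by move=> /ler_normlP[h1 h2]; rewrite in_itv /=; apply/andP; split; lra.
by split; [split|]; apply: hx; rewrite /M ?lerDr ?addr_ge0// -addrA ?lerDl ?addr_ge0//
  addrCA lerDl addr_ge0.
Qed.

Let W_int (u : H -> R) : mu.-integrable setT (EFin \o u) -> W u.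
Proof.
move=> ui.
have /measurable_int/measurable_EFinP mu_ := ui.
have pi : mu.-integrable setT (EFin \o (fun p => Num.max (u p) 0)).
  apply: le_integrable ui => //.
    by apply/measurable_EFinP; apply: measurable_maxr.
  by move=> p _; rewrite /= lee_fin; case: (leP (u p) 0) => _; rewrite ?normr0.
have ni : mu.-integrable setT (EFin \o (fun p => Num.max (- u p) 0)).
  apply: le_integrable ui => //.
    by apply/measurable_EFinP; apply: measurable_maxr => //; exact: measurableT_comp.
  by move=> p _; rewrite /= lee_fin; case: (leP (- u p) 0) => _; rewrite ?normr0 ?normrN.
have n0 p : 0 <= Num.max (- u p) 0 by rewrite le_max lexx orbT.
have p0 p : 0 <= Num.max (u p) 0 by rewrite le_max lexx orbT.
have := W_lin (-1) (W_ge0 ni n0) (W_ge0 pi p0); congr W; apply/funext => p.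
by case: (leP (u p) 0) => ?; case: (leP (- u p) 0) => ?; lra.
Qed.

Theorem L1_density F : P F.
Proof.
have [i1 i2] := repr_cintegrable F.
have [F1 rF1 PF1] := W_int i1; have [F2 rF2 PF2] := W_int i2.
suff -> : F = Complex 0 1 *: F2 + F1 by exact: Plin.
apply: L1rep_inj (L1rep_repr F) _.
have := L1rep_lin (Complex 0 1) rF2 rF1; congr L1rep; apply/funext => p.
by apply: complex_eqP; rewrite ?ReD ?ImD ?ReM ?ImM /=; lra.
Qed.

End density.

Section integral_density.
Local Open Scope ereal_scope.
Context d (T : measurableType d) (R : realType).
Variables (mu nu : {measure set T -> \bar R}) (w : T -> R).
Hypotheses (mw : measurable_fun setT w) (w0 : forall x, (0 <= w x)%R).
Hypothesis nuE : forall A, measurable A -> nu A = \int[mu]_(x in A) (w x)%:E.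

Import HBNNSimple.

Lemma ge0_integral_density (f : T -> \bar R) : measurable_fun setT f ->
  (forall x, 0 <= f x) -> \int[nu]_x f x = \int[mu]_x (f x * (w x)%:E).
Proof.
move=> mf f0; pose g := nnsfun_approx measurableT mf.
have gf x : (fun n => (g n x)%:E) @ \oo --> f x.
  exact: cvg_nnsfun_approx.
have g0 n x : (0 <= g n x)%R by [].
have mg n : measurable_fun setT (fun x => (g n x)%:E) by exact/measurable_EFinP.
have ndg x : {homo (fun n => (g n x)%:E) : m n / (m <= n)%N >-> m <= n}.
  by move=> m n mn; rewrite lee_fin; exact/lefP/nd_nnsfun_approx.
transitivity (limn (fun n => \int[nu]_x (g n x)%:E)).
  have g0E n x : [set: T] x -> 0 <= (g n x)%:E by rewrite lee_fin.
  rewrite -(monotone_convergence nu measurableT mg g0E (fun x _ => ndg x)).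
  by apply: eq_integral => x _; apply/esym/cvg_lim.
transitivity (limn (fun n => \int[mu]_x ((g n x)%:E * (w x)%:E))); last first.
  have mgw n : measurable_fun setT (fun x => (g n x)%:E * (w x)%:E).
    by apply: emeasurable_funM => //; exact/measurable_EFinP.
  have gw0 n x : [set: T] x -> 0 <= (g n x)%:E * (w x)%:E by rewrite mule_ge0 ?lee_fin.
  have ndgw x : [set: T] x -> {homo (fun n => (g n x)%:E * (w x)%:E) : m n / (m <= n)%N >-> m <= n}.
    by move=> _ m n mn; rewrite lee_wpmul2r ?lee_fin//; exact: ndg.
  rewrite -(monotone_convergence mu measurableT mgw gw0 ndgw).
  by apply: eq_integral => x _; apply/cvg_lim => //; exact: cvgeZr.
congr (limn _); apply/funext => n.
transitivity (\sum_(k \in range (g n)) k%:E * nu (g n @^-1` [set k])).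
  under eq_integral do rewrite fimfunE -fsumEFin//.
  rewrite ge0_integral_fsum//; last 2 first.
  - by move=> y; exact/measurable_EFinP/measurable_funM.
  - by move=> y x _; rewrite EFinM nnfun_muleindic_ge0.
  by apply: eq_fsbigr => r _; rewrite integralZl_indic_nnsfun// integral_indic// setIT.
under [RHS]eq_integral do rewrite fimfunE -fsumEFin//.
have ik0 k x : 0 <= (k * \1_(g n @^-1` [set k]) x)%:E by rewrite EFinM nnfun_muleindic_ge0.
transitivity (\int[mu]_x \sum_(k \in range (g n))
    ((k * \1_(g n @^-1` [set k]) x)%:E * (w x)%:E)); last first.
  apply: eq_integral => x _; rewrite ge0_mule_fsuml//.
rewrite ge0_integral_fsum//; last 2 first.
- by move=> y; apply: emeasurable_funM; apply/measurable_EFinP => //; exact: measurable_funM.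
- by move=> y x _; apply: mule_ge0; [exact: ik0|rewrite lee_fin].
apply: eq_fsbigr => k _.
rewrite nuE//.
have [k0|k0] := leP 0%R k; last first.
  rewrite preimage_nnfun0// integral_set0 mule0.
  by rewrite integral0_eq// => x _; rewrite indic0 mulr0 mul0e.
rewrite -ge0_integralZl//; last 2 first.
- exact/measurable_EFinP/measurable_funTS.
- by move=> x _; rewrite lee_fin.
rewrite integral_mkcond; apply: eq_integral => x _.
rewrite patchE indicE; case: ifPn => _; first by rewrite mulr1.
by rewrite mulr0 mul0e.
Qed.

End integral_density.

Section bounded_ext_unique.
Context d2 (T2 : measurableType d2) (R : realType).
Variables (nu : {measure set T2 -> \bar R}).
Local Notation mR := (measurableTypeR R).

Lemma le_L1normB (F G : L1 nu) : (L1norm (F - G)%R <= L1norm F + L1norm G)%E.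
Proof.
have rF := L1rep_repr F; have rG := L1rep_repr G.
have := L1rep_lin (-1) rG rF; rewrite scaleN1r addrC => h.
have [f1 f2] := cintegrable_measurable rF.1.
have [g1 g2] := cintegrable_measurable rG.1.
have [h1 h2] := cintegrable_measurable h.1.
rewrite (L1norm_rep h) (L1norm_rep rF) (L1norm_rep rG).
have n0 (f : T2 -> R[i]) x : [set: T2] x -> (0 <= (normc (f x))%:E)%E.
  by rewrite lee_fin normc_ge0.
have mn (f : T2 -> R[i]) : measurable_fun setT (fun x => cRe (f x)) ->
    measurable_fun setT (fun x => cIm (f x)) ->
    measurable_fun setT (fun x => (normc (f x))%:E).
  by move=> m1 m2; apply/measurable_EFinP; exact: measurable_normc.
rewrite -(ge0_integralD nu measurableT (n0 _) (mn _ f1 f2) (n0 _) (mn _ g1 g2)).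
apply: ge0_le_integral => //.
- exact: n0.
- exact: mn.
- by apply: emeasurable_funD; exact: mn.
- by move=> x _; rewrite -EFinD lee_fin mulN1r addrC (le_trans (le_normcD _ _))// normcN.
Qed.

Lemma bounded_ext_unique (A : (mR * mR * mR -> R[i]) -> (T2 -> R[i]))
    (S S' : L1 (haar R) -> L1 nu) :
  is_bounded_ext (@Cc R) A S -> is_bounded_ext (@Cc R) A S' -> S =1 S'.
Proof.
move=> [Sl [M SM] SA] [Sl' [M' SM'] SA'].
apply: L1_density.
- by move=> a F G FE GE; rewrite Sl Sl' FE GE.
- move=> F F_ F_E Fcv.
  have SB (S0 : L1 (haar R) -> L1 nu) : linear S0 -> forall G G', S0 (G - G') = S0 G - S0 G'.
    move=> S0l G G'; rewrite (_ : G - G' = -1 *: G' + G); last by rewrite scaleN1r addrC.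
    by rewrite S0l scaleN1r addrC.
  have normM (S0 : L1 (haar R) -> L1 nu) m : (forall G, (L1norm (S0 G) <= m%:E * L1norm G)%E) ->
      forall G, (L1norm (S0 G) <= `|m|%:E * L1norm G)%E.
    move=> S0m G; apply: le_trans (S0m _) _.
    by rewrite lee_wpmul2r ?L1norm_ge0// lee_fin ler_norm.
  have D0 : (L1norm (S F - S' F)%R <= 0)%E.
    have := cvgeZl (y := (`|M| + `|M'|)%:E) isT Fcv; rewrite mule0.
    move=> h; apply: (cvge_ge _ h); apply: nearW => n.
    have -> : S F - S' F = S' (F_ n - F) - S (F_ n - F).
      by rewrite (SB _ Sl) (SB _ Sl') F_E opprB [RHS]addrC addrA subrK.
    apply: le_trans (le_L1normB _ _) _.
    apply: le_trans (leeD (normM _ _ SM' _) (normM _ _ SM _)) _.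
    by rewrite EFinD ge0_muleDl ?lee_fin// addeC.
  apply/eqP; rewrite -subr_eq0; apply/eqP; apply: L1norm_eq0.
  by apply/eqP; rewrite eq_le D0 L1norm_ge0.
- by move=> F f Df rF; apply: (L1rep_inj (SA _ _ Df rF)) (SA' _ _ Df rF).
Qed.

Lemma bounded_extP (A : (mR * mR * mR -> R[i]) -> (T2 -> R[i]))
    (S : L1 (haar R) -> L1 nu) :
  is_bounded_ext (@Cc R) A S ->
  is_bounded_ext (@Cc R) A (@bounded_ext _ _ _ _ _ (haar R) nu (@Cc R) A) /\
  @bounded_ext _ _ _ _ _ (haar R) nu (@Cc R) A =1 S.
Proof.
move=> AS; have h : is_bounded_ext (@Cc R) A (@bounded_ext _ _ _ _ _ (haar R) nu (@Cc R) A).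
  by apply: (xgetPex (fun=> 0)); exists S.
by split => //; exact: (bounded_ext_unique h AS).
Qed.

End bounded_ext_unique.

Section xray_formula.
Variable R : realType.
Variables (eps : R).
Local Notation mR := (measurableTypeR R).
Local Notation H := (mR * mR * mR)%type.
Local Notation leb := (@lebesgue_measure R).
Local Notation mu := (haar R).

Lemma measurable_invr : measurable_fun setT (fun x : mR => x^-1 : mR).
Proof.
rewrite (_ : (fun _ => _) = fun x : mR => if 0 < x then x `^ (-1) else
   if x < 0 then - ((- x) `^ (-1)) else 0); last first.
  apply/funext => x; have [x0|x0|->] := ltgtP x 0; last by rewrite invr0.
  - by rewrite powR_inv1 ?oppr_ge0 ?ltW// invrN opprK.
  - by rewrite powR_inv1// ltW.
apply: measurable_fun_ifT; [exact: measurable_fun_ltr|exact: measurable_powR|].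
apply: measurable_fun_ifT; [exact: measurable_fun_ltr| |exact: measurable_cst].
apply: measurableT_comp => //.
exact: (measurableT_comp (measurable_powR _)).
Qed.

Let mhinv (d : measure_display) (T : measurableType d) (f : T -> mR) :
  measurable_fun setT f -> measurable_fun setT (fun x => (f x)^-1 : mR).
Proof. exact: (measurableT_comp measurable_invr). Qed.

Lemma measurable_geodesic2 :
  measurable_fun setT (fun ls : mR * mR => geodesic eps ls.1 ls.2 : H).
Proof.
rewrite /geodesic; apply: measurable_H3.
- apply: measurable_funM; first exact: mhinv.
  apply: (measurableT_comp (continuous_measurable_fun (@continuous_cos R))).
  by apply: measurable_funM => //; do 2 apply: mhinv.
- apply: measurable_funM; first exact: mhinv.
  apply: (measurableT_comp (continuous_measurable_fun (@continuous_sin R))).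
  by apply: measurable_funM => //; do 2 apply: mhinv.
- apply: measurable_funM => //; apply: measurable_funM.
    apply: measurable_funD => //; apply: measurable_funX; exact: mhinv.
  by apply: mhinv; apply: measurable_funM => //; exact: mhinv.
Qed.

Lemma ge0_integral_geod_measure (lam : {posnum R}) (f : H -> \bar R) :
  measurable_fun setT f -> (forall p, 0 <= f p)%E ->
  (\int[geod_measure eps lam]_p f p =
   lam%:num%:E * \int[mu]_(p in fund_dom eps lam%:num) f p)%E.
Proof.
move=> mf f0; have mfd := measurable_fund_dom eps lam%:num.
pose w (p : H) : R := lam%:num * \1_(fund_dom eps lam%:num) p.
have mw : measurable_fun setT w by exact: measurable_funM.
have w0 p : 0 <= w p by rewrite mulr_ge0.
have nuE A : measurable A -> geod_measure eps lam A = (\int[mu]_(p in A) (w p)%:E)%E.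
  move=> mA; rewrite /w; under eq_integral do rewrite EFinM.
  rewrite ge0_integralZl//; last by apply/measurable_EFinP; exact: measurable_funTS.
  by rewrite integral_indic// setIC.
rewrite (ge0_integral_density mw w0 nuE)// -ge0_integralZl//; last first.
  exact: measurable_funTS.
rewrite [RHS]integral_mkcond; apply: eq_integral => p _.
rewrite patchE /w indicE; case: ifPn => _; first by rewrite mulr1 muleC.
by rewrite mulr0 mule0.
Qed.

Lemma santalo1 (lam : R) (f : H -> \bar R) : 0 < lam ->
  measurable_fun setT f -> (forall p, 0 <= f p)%E ->
  (\int[mu]_(p in fund_dom eps lam) \int[leb]_s f (hmul p (geodesic eps lam s)) =
   (2 * pi / lam)%:E * \int[mu]_p f p)%E.
Proof.
move=> l0 mf f0.
have := @santalo R eps lam f (cst 1%E) l0 mf f0 (measurable_cst _) (fun=> lee01) (fun _ _ => erefl).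
under eq_integral do rewrite mul1e; move=> ->.
have L0 : 0 < 2 * pi / lam by rewrite divr_gt0 ?mulr_gt0 ?pi_gt0.
transitivity (\int[mu]_q ((2 * pi / lam)%:E * f q))%E.
  apply: eq_integral => q _; rewrite muleC; congr (_ * _)%E.
  rewrite -[LHS]/(\int[leb]_(s in `]0%R, (2 * pi / lam)%R]) cst 1 s)%E.
  by rewrite integral_cst//= lebesgue_measure_itv /= lte_fin L0 mul1e oppr0 adde0.
by rewrite ge0_integralZl// lee_fin ltW.
Qed.

Lemma geod_measure_fibre (lam : {posnum R}) (f : H -> \bar R) :
  measurable_fun setT f -> (forall p, 0 <= f p)%E ->
  (\int[geod_measure eps lam]_p \int[leb]_s f (hmul p (geodesic eps lam%:num s)) <=
   (2 * pi)%:E * \int[mu]_p f p)%E.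
Proof.
move=> mf f0; rewrite ge0_integral_geod_measure; last 2 first.
- apply: (measurable_fun_fubini_tonelli_F
    (fun ps : H * mR => f (hmul ps.1 (geodesic eps lam%:num ps.2)))) => //.
  apply: (measurableT_comp mf); apply: measurable_hmul => //.
  exact: (measurableT_comp (measurable_geodesic eps lam%:num) measurable_snd).
- by move=> p; exact: integral_ge0.
rewrite santalo1// muleA -EFinM mulrCA divff ?mulr1//.
Qed.

Lemma xray_lamP (lam : {posnum R}) (F : L1 mu) :
  L1rep (xray_lam eps lam F) (xray_lam_fun eps lam%:num (repr F)).
Proof.
pose Gam (ps : H * mR) := hmul ps.1 (geodesic eps lam%:num ps.2).
have mGam : measurable_fun setT Gam.
  apply: measurable_hmul => //.
  exact: (measurableT_comp (measurable_geodesic eps lam%:num) measurable_snd).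
have C0 : 0 <= 2 * pi :> R by rewrite mulr_ge0 ?pi_ge0.
have [_ E] := bounded_extP (is_bounded_ext_fibre_ext mGam C0 (geod_measure_fibre lam) (@Cc R)).
rewrite /xray_lam E.
exact: (fibre_extP mGam C0 (geod_measure_fibre lam) (L1rep_repr F)).
Qed.

End xray_formula.

Section xray_all_charges.
Variable R : realType.
Variables (eps : R).
Local Notation mR := (measurableTypeR R).
Local Notation H := (mR * mR * mR)%type.
Local Notation leb := (@lebesgue_measure R).
Local Notation mu := (haar R).

Lemma ge0_integral_geod_space (f : H * mR -> \bar R) :
  measurable_fun setT f -> (forall q, 0 <= f q)%E ->
  (\int[geod_space_measure eps]_q f q =
   \int[leb]_lam \int[mu]_p (f (p, lam) * (geod_density eps (p, lam))%:E))%E.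
Proof.
move=> mf f0.
have mw := @measurable_geod_density R eps; have w0 := @geod_density_ge0 R eps.
rewrite (@ge0_integral_density _ _ _ (haar_sf R \x leb)%E (geod_space_measure eps)
  (geod_density eps) mw w0 (fun _ _ => erefl) _ mf f0).
apply: (fubini_tonelli2 (m1 := haar_sf R) (m2 := leb)
  (fun q => f q * (geod_density eps q)%:E)%E).
  by apply: emeasurable_funM => //; exact/measurable_EFinP.
by move=> q; rewrite mule_ge0 ?lee_fin.
Qed.

Lemma integral_geod_density (lam : R) (f : H -> \bar R) : 0 < lam ->
  measurable_fun setT f -> (forall p, 0 <= f p)%E ->
  (\int[mu]_p (f p * (geod_density eps (p, lam))%:E) =
   (lam * expR (- lam))%:E * \int[mu]_(p in fund_dom eps lam) f p)%E.
Proof.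
move=> l0 mf f0; have mfd := measurable_fund_dom eps lam.
have k0 : (0 <= (lam * expR (- lam))%:E)%E by rewrite lee_fin mulr_ge0 ?expR_ge0 ?ltW.
rewrite -(ge0_integralZl mu mfd (measurable_funTS mf) (fun p _ => f0 p) k0).
rewrite [RHS]integral_mkcond; apply: eq_integral => p _.
rewrite patchE /geod_density /= l0 /=.
rewrite (_ : (p \in fund_dom eps lam) = (p.2 \in `[0, period eps lam[)); last first.
  by apply/idP/idP => [/set_mem|h]; [|exact: mem_set].
by case: ifP => _; rewrite ?mule0// muleC.
Qed.

Lemma geod_density_npos (lam : R) (p : H) : lam <= 0 -> geod_density eps (p, lam) = 0.
Proof. by move=> l0; rewrite /geod_density /= ltNge l0. Qed.

Let Gam (qs : H * mR * mR) := hmul qs.1.1 (geodesic eps qs.1.2 qs.2).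

Let mGam : measurable_fun setT Gam.
Proof.
apply: measurable_hmul; first exact: (measurableT_comp measurable_fst measurable_fst).
apply: (measurableT_comp (measurable_geodesic2 eps)
  (g := fun qs : H * mR * mR => (qs.1.2, qs.2) : mR * mR)).
by apply: measurable_fun_pair => //; exact: (measurableT_comp measurable_snd measurable_fst).
Qed.

Lemma geod_space_fibre (f : H -> \bar R) :
  measurable_fun setT f -> (forall p, 0 <= f p)%E ->
  (\int[geod_space_measure eps]_q \int[leb]_s f (Gam (q, s)) <=
   (2 * pi)%:E * \int[mu]_p f p)%E.
Proof.
move=> mf f0.
have mG : measurable_fun setT (fun q => \int[leb]_s f (Gam (q, s)))%E.
  apply: (measurable_fun_fubini_tonelli_F (fun qs => f (Gam qs))) => //.
  exact: (measurableT_comp mf).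
rewrite ge0_integral_geod_space//; last by move=> q; exact: integral_ge0.
pose c := ((2 * pi)%:E * \int[mu]_p f p)%E.
have c0 : (0 <= c)%E by rewrite mule_ge0 ?integral_ge0// lee_fin mulr_ge0 ?pi_ge0.
have mE : measurable_fun setT (fun lam => (exponential_pdf 1 lam)%:E : \bar R).
  by apply/measurable_EFinP; exact: measurable_exponential_pdf.
rewrite -/c; have -> : c = (\int[leb]_lam ((exponential_pdf 1 lam)%:E * c))%E.
  rewrite ge0_integralZr//.
    by rewrite integral_exponential_pdf// mul1e.
  by move=> lam _; rewrite lee_fin exponential_pdf_ge0.
have mF : measurable_fun setT (fun q => \int[leb]_s f (Gam (q, s)) *
    (geod_density eps q)%:E)%E.
  apply: emeasurable_funM => //; apply/measurable_EFinP.
  exact: measurable_geod_density.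
have F0 q : (0 <= \int[leb]_s f (Gam (q, s)) * (geod_density eps q)%:E)%E.
  by rewrite mule_ge0 ?integral_ge0// lee_fin geod_density_ge0.
apply: ge0_le_integral => //.
- by move=> lam _; exact: integral_ge0.
- exact: (measurable_fun_fubini_tonelli_G (m1 := haar_sf R) _ mF F0).
- exact: emeasurable_funM.
move=> lam _.
have [l0|l0] := ltP 0 lam; last first.
  rewrite integral0_eq; last by move=> p _; rewrite (geod_density_npos _ l0) mule0.
  by apply: mule_ge0 => //; rewrite lee_fin exponential_pdf_ge0.
rewrite (integral_geod_density l0 (f := fun p => \int[leb]_s f (Gam (p, lam, s)))%E).
- rewrite santalo1// /exponential_pdf patchE mem_setE in_itv /= (ltW l0).
  rewrite muleA -EFinM /c muleA -EFinM.
  rewrite (_ : _ * (2 * pi / lam) = 1 * expR (- 1 * lam) * (2 * pi))//.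
  by rewrite mul1r mulN1r; field; rewrite gt_eqF.
- exact: (measurableT_comp mG (pair2_measurable _)).
- by move=> p; exact: integral_ge0.
Qed.

Lemma xrayP (F : L1 mu) : L1rep (xray eps F) (xray_fun eps (repr F)) /\
  linear (xray eps : L1 mu -> _).
Proof.
have C0 : 0 <= 2 * pi :> R by rewrite mulr_ge0 ?pi_ge0.
have [[xl _ _] E] := bounded_extP (is_bounded_ext_fibre_ext mGam C0 geod_space_fibre (@Cc R)).
split; last exact: xl.
rewrite /xray E.
exact: (fibre_extP mGam C0 geod_space_fibre (L1rep_repr F)).
Qed.

End xray_all_charges.

(** * Functions annihilated by a null transform *)

Section null_transform.
Variable R : realType.
Variables (eps : R).
Local Notation mR := (measurableTypeR R).
Local Notation H := (mR * mR * mR)%type.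
Local Notation leb := (@lebesgue_measure R).
Local Notation mu := (haar R).

Definition xray_null (lam : {posnum R}) (u : H -> R) : Prop :=
  {ae geod_measure eps lam, forall p,
    (\int[leb]_s u (hmul p (geodesic eps lam%:num s)))%R = 0}.

Lemma xray_lam_eq0 (lam : {posnum R}) (F : L1 mu) : xray_lam eps lam F = 0 ->
  xray_null lam (fun p => cRe (repr F p)) /\ xray_null lam (fun p => cIm (repr F p)).
Proof.
move=> F0; have := xray_lamP eps lam F; rewrite F0 => -[_ h].
have [_ z] := L1rep0 (geod_measure eps lam).
have {}h : {ae geod_measure eps lam, forall p, xray_lam_fun eps lam%:num (repr F) p = 0}.
  by apply: filterS2 h z => p <- <-.
by split; apply: filterS h => p [].
Qed.

Lemma xray_eq0 (F : L1 mu) : xray eps F = 0 ->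
  {ae leb, forall l : mR, forall lam : {posnum R}, lam%:num = l ->
    xray_null lam (fun p => cRe (repr F p)) /\
    xray_null lam (fun p => cIm (repr F p))}.
Proof.
move=> F0; have := (xrayP eps F).1; rewrite F0 => -[xi h].
have [_ z] := L1rep0 (geod_space_measure eps).
have {z}h : {ae geod_space_measure eps, forall q, xray_fun eps (repr F) q = 0}.
  by apply: filterS2 h z => q <- <-.
have [m1 m2] := cintegrable_measurable xi.
have key (v : H * mR -> R) : measurable_fun setT v ->
    {ae geod_space_measure eps, forall q, v q = 0} ->
    {ae leb, forall l : mR, forall lam : {posnum R}, lam%:num = l ->
      {ae geod_measure eps lam, forall p, v (p, lam%:num) = 0}}.
  move=> mv v0.
  have mv' : measurable_fun setT (fun q => (`|v q|)%:E).
    by apply/measurable_EFinP; exact: measurableT_comp.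
  have v0' q : (0 <= (`|v q|)%:E)%E by rewrite lee_fin.
  have : (\int[geod_space_measure eps]_q (`|v q|)%:E)%E = 0%E.
    apply/(ae_eq_integral_abs _ measurableT (f := EFin \o v)); first exact/measurable_EFinP.
    by apply: filterS v0 => q /= -> _.
  rewrite ge0_integral_geod_space//.
  move=> G0; pose G (l : mR) :=
    (\int[mu]_p ((`|v (p, l)|)%:E * (geod_density eps (p, l))%:E))%E.
  have mF : measurable_fun setT (fun q => (`|v q|)%:E * (geod_density eps q)%:E)%E.
    apply: emeasurable_funM => //; apply/measurable_EFinP.
    exact: measurable_geod_density.
  have F0' q : (0 <= (`|v q|)%:E * (geod_density eps q)%:E)%E.
    by rewrite mule_ge0// lee_fin geod_density_ge0.
  have mG : measurable_fun setT G.
    exact: (measurable_fun_fubini_tonelli_G (m1 := haar_sf R) _ mF F0').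
  have : (\int[leb]_l `|G l|)%E = 0%E.
    rewrite -[RHS]G0; apply: eq_integral => l _; rewrite gee0_abs//.
    by apply: integral_ge0 => p _; exact: F0'.
  move/(ae_eq_integral_abs leb measurableT mG).
  apply: filterS => l /(_ I) /= Gl lam El; subst l; have l0 : 0 < lam%:num by [].
  have mvl : measurable_fun setT (fun p => v (p, lam%:num)).
    exact: (measurableT_comp mv (pair2_measurable _)).
  have mvl' : measurable_fun setT (fun p => (`|v (p, lam%:num)|)%:E).
    exact: (measurableT_comp mv' (pair2_measurable _)).
  have : (\int[geod_measure eps lam]_p (`|v (p, lam%:num)|)%:E)%E = 0%E.
    rewrite ge0_integral_geod_measure//=.
    have := Gl; rewrite /G (integral_geod_density eps l0 mvl' (fun=> v0' _)).
    move/eqP; rewrite mule_eq0 => /orP[/eqP[] /eqP|/eqP ->]; last by rewrite mule0.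
    by rewrite mulf_eq0 !gt_eqF ?expR_gt0.
  move/(ae_eq_integral_abs _ measurableT (f := fun p => (v (p, lam%:num))%:E)).
  move=> /(_ _) H0; have {}H0 := H0 ((measurable_EFinP _ _).2 mvl).
  by apply: filterS H0 => p /(_ I) [].
have h1 : {ae geod_space_measure eps, forall q, cRe (xray_fun eps (repr F) q) = 0}.
  by apply: filterS h => q ->.
have h2 : {ae geod_space_measure eps, forall q, cIm (xray_fun eps (repr F) q) = 0}.
  by apply: filterS h => q ->.
have := key _ m2 h2; have := key _ m1 h1; apply: filterS2 => l H1 H2 lam El.
by split; [apply: filterS (H1 lam El)|apply: filterS (H2 lam El)].
Qed.

End null_transform.

Lemma integrableM_bounded d (T : measurableType d) (R : realType)
    (mu : {measure set T -> \bar R}) (u k : T -> R) (M : R) :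
  mu.-integrable setT (EFin \o u) -> measurable_fun setT k ->
  (forall x, `|k x| <= M) -> mu.-integrable setT (fun x => (u x * k x)%:E).
Proof.
move=> ui mk kM; have /measurable_int/measurable_EFinP mu_ := ui.
apply: (le_integrable measurableT _ _ (integrableZl measurableT `|M| ui)).
  by apply/measurable_EFinP; exact: measurable_funM.
move=> x _; rewrite /= lee_fin normrM [leRHS]normrM normr_id mulrC ler_wpM2r//.
by rewrite (le_trans (kM x))// ler_norm.
Qed.

Section annihilation.
Variable R : realType.
Variables (eps : R) (lam : {posnum R}).
Local Notation mR := (measurableTypeR R).
Local Notation H := (mR * mR * mR)%type.
Local Notation leb := (@lebesgue_measure R).
Local Notation mu := (haar R).
Local Notation I := (`]0%R, (2 * pi / lam%:num)%R]%classic : set mR).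

Definition adjoint_average (h : H -> R) (q : H) : R :=
  \int[leb]_(s in I) h (hmul q (hinv (geodesic eps lam%:num s))).
Local Notation A := adjoint_average.

Let L0 : 0 < 2 * pi / lam%:num.
Proof. by rewrite divr_gt0 ?mulr_gt0 ?pi_gt0. Qed.

Let lebI : leb I = (2 * pi / lam%:num)%:E.
Proof. by rewrite lebesgue_measure_itv /= lte_fin L0 oppr0 adde0. Qed.

Let mI : measurable I.
Proof. exact: measurable_itv. Qed.

Let Ioo : (leb I < +oo)%E.
Proof. by rewrite lebI ltry. Qed.

Let Icst (M : R) : leb.-integrable I (EFin \o (fun=> M)).
Proof.
apply: (measurable_bounded_integrable mI Ioo); first exact: measurable_cst.
by exists `|M|; split; [exact: num_real|move=> y My s _; exact: ltW].
Qed.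

Let mgam : measurable_fun setT (fun qs : H * mR => hmul qs.1 (hinv (geodesic eps lam%:num qs.2))).
Proof.
apply: measurable_hmul => //; apply: (measurableT_comp (@measurable_hinv R)).
exact: (measurableT_comp (measurable_geodesic eps lam%:num) measurable_snd).
Qed.

Let mhs (h : H -> R) q : measurable_fun setT h ->
  measurable_fun setT (fun s : mR => h (hmul q (hinv (geodesic eps lam%:num s)))).
Proof. by move=> mh; exact: (measurableT_comp (measurableT_comp mh mgam) (pair1_measurable _)). Qed.

Let hint (h : H -> R) M q : measurable_fun setT h -> (forall p, `|h p| <= M) ->
  leb.-integrable I (fun s => (h (hmul q (hinv (geodesic eps lam%:num s))))%:E).
Proof.
move=> mh hM; apply: (measurable_bounded_integrable mI Ioo).
  by apply: measurable_funTS; exact: mhs.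
exists M; split; first exact: num_real.
by move=> y My s _ /=; rewrite (le_trans (hM _))// ltW.
Qed.

Let AE (h : H -> R) M q : measurable_fun setT h -> (forall p, `|h p| <= M) ->
  (\int[leb]_(s in I) (h (hmul q (hinv (geodesic eps lam%:num s))))%:E = (A h q)%:E)%E.
Proof.
move=> mh hM; rewrite /A /Rintegral fineK//.
by apply: integrable_fin_num => //; exact: (hint q mh hM).
Qed.

Lemma adjoint_average_le (h : H -> R) M q : measurable_fun setT h ->
  (forall p, `|h p| <= M) -> `|A h q| <= M * (2 * pi / lam%:num).
Proof.
move=> mh hM; have hi := hint q mh hM.
have -> : M * (2 * pi / lam%:num) = \int[leb]_(s in I) M.
  by rewrite Rintegral_cst//= lebI.
apply: (le_trans (le_normr_Rintegral _ hi)) => //.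
apply: le_Rintegral => //; exact: (integrable_norm hi).
Qed.

Lemma measurable_adjoint_average (h : H -> R) M : measurable_fun setT h ->
  (forall p, `|h p| <= M) -> measurable_fun setT (A h).
Proof.
move=> mh hM.
have M0 : 0 <= M by rewrite (le_trans _ (hM (0, 0, 0))).
have hM0 p : 0 <= h p + M by rewrite -lerBlDr sub0r; have /ler_normlP[] := hM p; rewrite lerNl.
pose hI (qs : H * mR) := (((h (hmul qs.1 (hinv (geodesic eps lam%:num qs.2))) + M) * \1_I qs.2)%:E).
have mhI : measurable_fun setT hI.
  apply/measurable_EFinP; apply: measurable_funM.
    by apply: measurable_funD => //; exact: (measurableT_comp mh mgam).
  by apply: (measurableT_comp (f := \1_I : mR -> R)) => //; exact: measurable_indic.
have hI0 qs : (0 <= hI qs)%E by rewrite lee_fin mulr_ge0.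
have mF : measurable_fun setT (fun q => \int[leb]_s hI (q, s))%E.
  exact: measurable_fun_fubini_tonelli_F.
have -> : A h = fun q => fine (\int[leb]_s hI (q, s)) - M * (2 * pi / lam%:num).
  apply/funext => q; apply/eqP; rewrite eq_sym subr_eq; apply/eqP.
  have -> : M * (2 * pi / lam%:num) = \int[leb]_(s in I) M.
    by rewrite Rintegral_cst//= lebI.
  rewrite /A -(RintegralD mI (hint q mh hM) (Icst M)).
  rewrite /Rintegral; congr fine; rewrite [RHS]integral_mkcond.
  apply: eq_integral => s _; rewrite patchE /hI indicE /=.
  by case: ifPn => _; rewrite ?mulr1 ?mulr0.
by apply: measurable_funB => //; exact: (measurableT_comp (fine_measurable measurableT) mF).
Qed.

Let annihilate_ge0 (u h : H -> R) M : mu.-integrable setT (EFin \o u) ->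
  xray_null eps lam u -> measurable_fun setT h -> (forall p, 0 <= h p) ->
  (forall p, `|h p| <= M) ->
  (forall z t, h (z, t + period eps lam%:num) = h (z, t)) ->
  \int[mu]_q (u q * A h q) = 0.
Proof.
move=> ui u0 mh h0 hM hP.
have /measurable_int/measurable_EFinP mu_ := ui.
pose up p := Num.max (u p) 0; pose un p := Num.max (- u p) 0.
have uE p : u p = up p - un p.
  by rewrite /up /un; case: (leP (u p) 0) => ?; case: (leP (- u p) 0) => ?; lra.
have up0 p : 0 <= up p by rewrite le_max lexx orbT.
have un0 p : 0 <= un p by rewrite le_max lexx orbT.
have upu p : `|up p| <= `|u p|.
  by rewrite /up; case: (leP (u p) 0) => _; rewrite ?normr0.
have unu p : `|un p| <= `|u p|.
  by rewrite /un; case: (leP (- u p) 0) => _; rewrite ?normr0 ?normrN.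
have mup : measurable_fun setT up by exact: measurable_maxr.
have mun : measurable_fun setT un.
  by apply: measurable_maxr => //; exact: measurableT_comp.
have dom d (T : measurableType d) (m : {measure set T -> \bar R}) (v w : T -> R) :
    m.-integrable setT (EFin \o v) -> measurable_fun setT w ->
    (forall x, `|w x| <= `|v x|) -> m.-integrable setT (EFin \o w).
  move=> vi mw wv; apply: (le_integrable measurableT _ _ vi); first exact/measurable_EFinP.
  by move=> x _; rewrite /= lee_fin.
have upi := dom _ _ _ _ _ ui mup upu; have uni := dom _ _ _ _ _ ui mun unu.
pose Gam (ps : H * mR) := hmul ps.1 (geodesic eps lam%:num ps.2).
have mGam : measurable_fun setT Gam.
  apply: measurable_hmul => //.
  exact: (measurableT_comp (measurable_geodesic eps lam%:num) measurable_snd).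
have C0 : 0 <= 2 * pi :> R by rewrite mulr_ge0 ?pi_ge0.
have mfE (w : H -> R) : measurable_fun setT w -> (forall p, 0 <= w p) ->
    measurable_fun setT (fun p => (h p)%:E * \int[leb]_s (w (Gam (p, s)))%:E)%E.
  move=> mw w0; apply: emeasurable_funM; first exact/measurable_EFinP.
  apply: (measurable_fun_fubini_tonelli_F (fun qs => (w (Gam qs))%:E)) => [|qs].
    by apply/measurable_EFinP; exact: measurableT_comp.
  by rewrite lee_fin.
have f0E (w : H -> R) : (forall p, 0 <= w p) -> forall p,
    (0 <= (h p)%:E * \int[leb]_s (w (Gam (p, s)))%:E)%E.
  move=> w0 p; rewrite mule_ge0 ?lee_fin//.
  by apply: integral_ge0 => s _; rewrite lee_fin.
have key (w : H -> R) : measurable_fun setT w -> (forall p, 0 <= w p) ->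
    (\int[geod_measure eps lam]_p ((h p)%:E * \int[leb]_s (w (Gam (p, s)))%:E) =
     lam%:num%:E * \int[mu]_q (w q * A h q)%:E)%E.
  move=> mw w0.
  rewrite (ge0_integral_geod_measure eps lam (mfE w mw w0) (f0E w w0)).
  congr (_ * _)%E.
  have mwE : measurable_fun setT (fun p => (w p)%:E) by exact/measurable_EFinP.
  have mhE : measurable_fun setT (fun p => (h p)%:E) by exact/measurable_EFinP.
  have w0E p : (0 <= (w p)%:E)%E by rewrite lee_fin.
  have h0E p : (0 <= (h p)%:E)%E by rewrite lee_fin.
  have hPE z t : ((h (z, t + period eps lam%:num))%:E = (h (z, t))%:E)%E by rewrite hP.
  rewrite (@santalo R eps lam%:num _ _ _ mwE w0E mhE h0E hPE)//.
  by apply: eq_integral => q _; rewrite (AE q mh hM).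
have E : (\int[mu]_q (up q * A h q)%:E = \int[mu]_q (un q * A h q)%:E)%E.
  have : (lam%:num%:E * \int[mu]_q (up q * A h q)%:E =
          lam%:num%:E * \int[mu]_q (un q * A h q)%:E)%E.
    rewrite -(key _ mup up0) -(key _ mun un0).
    apply: (ge0_ae_eq_integral measurableT (mfE _ mup up0) (mfE _ mun un0)
      (fun p _ => f0E _ up0 p) (fun p _ => f0E _ un0 p)).
    have := section_cintegrable mGam C0 (geod_measure_fibre eps lam) (cintegrable_real ui).
    move: u0; apply: filterS2 => p Jp [si _] _; congr (_ * _)%E.
    have msp (w : H -> R) : measurable_fun setT w -> measurable_fun setT (fun s : mR => w (Gam (p, s))).
      by move=> mw; exact: (measurableT_comp (measurableT_comp mw mGam) (pair1_measurable _)).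
    have spi := dom _ _ _ _ _ si (msp _ mup) (fun s => upu _).
    have sni := dom _ _ _ _ _ si (msp _ mun) (fun s => unu _).
    rewrite -(fineK (integrable_fin_num measurableT spi)) -(fineK (integrable_fin_num measurableT sni)).
    congr (_%:E); apply/eqP; rewrite -subr_eq0; apply/eqP; rewrite -[RHS]Jp.
    rewrite -[LHS]/(\int[leb]_s up (Gam (p, s)) - \int[leb]_s un (Gam (p, s))).
    by rewrite -(RintegralB measurableT spi sni); apply: eq_Rintegral => s _; rewrite uE.
  have l0 : (lam%:num%:E : \bar R) != 0%E by rewrite eqe gt_eqF.
  move/(congr1 (fun x => (lam%:num^-1)%:E * x)%E).
  by rewrite !muleA -!EFinM mulVf// !mul1e.
under eq_Rintegral do rewrite uE mulrBl.
have mA := measurable_adjoint_average mh hM.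
have i1 := integrableM_bounded upi mA (fun q => adjoint_average_le q mh hM).
have i2 := integrableM_bounded uni mA (fun q => adjoint_average_le q mh hM).
by rewrite (RintegralB measurableT i1 i2) /Rintegral E subrr.
Qed.

Lemma annihilate (u h : H -> R) M : mu.-integrable setT (EFin \o u) ->
  xray_null eps lam u -> measurable_fun setT h -> (forall p, `|h p| <= M) ->
  (forall z t, h (z, t + period eps lam%:num) = h (z, t)) ->
  \int[mu]_q (u q * A h q) = 0.
Proof.
move=> ui u0 mh hM hP.
have hM0 p : 0 <= h p + M by rewrite -lerBlDr sub0r; have /ler_normlP[] := hM p; rewrite lerNl.
have M0 : 0 <= M by rewrite (le_trans _ (hM (0, 0, 0))).
have mhM : measurable_fun setT (fun p => h p + M) by exact: measurable_funD.
have bhM p : `|h p + M| <= M + M.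
  by rewrite (le_trans (ler_normD _ _))// (ger0_norm M0) lerD2r.
have bM (p : H) : `|M| <= M by rewrite ger0_norm.
have mM : measurable_fun setT (fun p : H => M) by exact: measurable_cst.
have h1 := annihilate_ge0 ui u0 mhM hM0 bhM (fun z t => congr1 (+%R^~ M) (hP z t)).
have h2 := annihilate_ge0 ui u0 mM (fun=> M0) bM (fun z t => erefl).
have AD q : A h q = A (fun p => h p + M) q - A (fun=> M) q.
  rewrite /A -(RintegralB mI (hint q mhM bhM) (hint q mM bM)).
  by apply: eq_Rintegral => s _; rewrite addrK.
under eq_Rintegral do rewrite AD mulrBr.
have i1 := integrableM_bounded ui (measurable_adjoint_average mhM bhM)
  (fun q => adjoint_average_le q mhM bhM).
have i2 := integrableM_bounded ui (measurable_adjoint_average mM bM)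
  (fun q => adjoint_average_le q mM bM).
by rewrite (RintegralB measurableT i1 i2) h1 h2 subrr.
Qed.

End annihilation.

(** * Fourier uniqueness *)

Section annihilated_averages.
Context d (T : measurableType d) (R : realType).
Variable mu : {sigma_finite_measure set T -> \bar R}.
Local Notation mR := (measurableTypeR R).
Local Notation leb := (@lebesgue_measure R).
Variables (v : T -> R) (K : T * mR -> R) (D : set mR) (M : R).
Hypotheses (vi : mu.-integrable setT (EFin \o v)) (mK : measurable_fun setT K).
Hypotheses (mD : measurable D) (KM : forall q, `|K q| <= M).
Hypothesis KD : forall x, (\int[leb]_(s in D) (`|K (x, s)|)%:E <= M%:E)%E.
Hypothesis vK0 : forall s, D s -> \int[mu]_x (v x * K (x, s)) = 0.

Lemma annihilated_average : \int[mu]_x (v x * \int[leb]_(s in D) K (x, s)) = 0.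
Proof.
have /measurable_int/measurable_EFinP mv := vi.
pose F (q : T * mR) : \bar R := (v q.1 * (K q * \1_D q.2))%:E.
have mF : measurable_fun setT F.
  apply/measurable_EFinP; apply: measurable_funM.
    exact: (measurableT_comp mv measurable_fst).
  apply: measurable_funM => //.
  by apply: (measurableT_comp (f := \1_D : mR -> R)) => //; exact: measurable_indic.
have mK1 x : measurable_fun setT (fun s => K (x, s)).
  exact: (measurableT_comp mK (pair1_measurable _)).
have mK2 s : measurable_fun setT (fun x => K (x, s)).
  exact: (measurableT_comp mK (pair2_measurable _)).
have Ki x : leb.-integrable D (EFin \o (fun s => K (x, s))).
  apply/integrableP; split; first by apply/measurable_EFinP; exact: measurable_funTS.
  by apply: le_lt_trans (KD x) _; rewrite ltry.
have IF x : (\int[leb]_s `|F (x, s)| = (`|v x|)%:E * \int[leb]_(s in D) (`|K (x, s)|)%:E)%E.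
  rewrite -ge0_integralZl//.
  - rewrite [RHS]integral_mkcond; apply: eq_integral => s _.
    rewrite patchE /F indicE /=; case: ifPn => _; first by rewrite mulr1 normrM EFinM.
    by rewrite !mulr0 normr0.
  - by apply/measurable_EFinP/measurable_funTS; exact: measurableT_comp.
have Fi : (mu \x leb)%E.-integrable setT F.
  apply/integrable12ltyP => //.
  apply: (@le_lt_trans _ _ (\int[mu]_x ((`|v x|)%:E * M%:E))%E).
    apply: ge0_le_integral => //.
    - by move=> x _; exact: integral_ge0.
    - apply: (measurable_fun_fubini_tonelli_F (fun q => `|F q|)%E) => //.
      exact: measurableT_comp.
    - apply: emeasurable_funM => //; apply/measurable_EFinP; exact: measurableT_comp.
    - by move=> x _; rewrite IF lee_wpmul2l ?lee_fin.
  have [/integrableP[_ voo] M0] := (vi, le_trans (normr_ge0 _) (KM (point, 0))).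
  rewrite ge0_integralZr//.
  - apply: lte_mul_pinfty; [exact: integral_ge0| |exact: ltry].
    by rewrite ge0_fin_numE//; exact: integral_ge0.
  - by apply/measurable_EFinP; exact: measurableT_comp.
have := Fubini Fi.
rewrite [RHS]integral0_eq; last first.
  move=> s _; have [sD|sD] := boolP (s \in D); last first.
    by rewrite integral0_eq// => x _; rewrite /F indicE (negbTE sD) !mulr0.
  rewrite (eq_integral (fun x => (v x * K (x, s))%:E)); last first.
    by move=> x _; rewrite /F indicE sD mulr1.
  have := vK0 (set_mem sD); rewrite /Rintegral => h.
  rewrite -[RHS]/(0%R%:E) -h fineK//.
  apply: integrable_fin_num => //.
  by apply: (integrableM_bounded vi (mK2 s)) => x; exact: KM.
move=> E; rewrite /Rintegral -[RHS]/(fine 0%E) -[in RHS]E; congr fine.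
apply: eq_integral => x _.
rewrite EFinM fineK; last exact: (integrable_fin_num mD (Ki x)).
rewrite -(integralZl mD (Ki x)).
rewrite integral_mkcond; apply: eq_integral => s _; rewrite patchE /F indicE.
by case: ifPn => _; rewrite ?mulr1 ?mulr0.
Qed.

End annihilated_averages.

Section real_derivatives.
Variable R : realType.
Implicit Types (f g : R -> R) (x a b c : R).

Lemma is_deriveM_fun f g x a b : is_derive x (1 : R) f a -> is_derive x (1 : R) g b ->
  is_derive x (1 : R) (fun y => f y * g y) (f x * b + g x * a).
Proof. exact: is_deriveM. Qed.

Lemma is_deriveD_fun f g x a b : is_derive x (1 : R) f a -> is_derive x (1 : R) g b ->
  is_derive x (1 : R) (fun y => f y + g y) (a + b).
Proof. exact: is_deriveD. Qed.

Lemma is_derive_comp_fun f g x a b : is_derive (g x) (1 : R) f a ->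
  is_derive x (1 : R) g b -> is_derive x (1 : R) (fun y => f (g y)) (a * b).
Proof. exact: is_derive1_comp. Qed.

Lemma is_deriveZ_fun c f x a : is_derive x (1 : R) f a ->
  is_derive x (1 : R) (fun y => c * f y) (c * a).
Proof. exact: is_deriveZ. Qed.

Lemma is_derive_mulc c x : is_derive x (1 : R) (fun y => c * y) c.
Proof. by rewrite -[X in is_derive _ _ _ X]mulr1; apply: is_deriveZ_fun; exact: is_derive_id. Qed.

End real_derivatives.

Section fourier_1d.
Context d (T : measurableType d) (R : realType).
Variable mu : {sigma_finite_measure set T -> \bar R}.
Local Notation mR := (measurableTypeR R).
Local Notation leb := (@lebesgue_measure R).

Lemma le_integral_bounded (D : set mR) (k : mR -> R) (M : R) (L : R) :
  measurable D -> leb D = L%:E -> measurable_fun setT k -> (forall s, `|k s| <= M) ->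
  (\int[leb]_(s in D) (`|k s|)%:E <= (M * L)%:E)%E.
Proof.
move=> mD DL mk kM; rewrite EFinM -DL -integral_cst//.
apply: ge0_le_integral => //.
- by apply/measurable_EFinP/measurable_funTS; exact: measurableT_comp.
- by move=> s _; rewrite lee_fin.
Qed.

Lemma Rintegral_FTC2 (f F : R -> R) (a b : R) : a < b -> continuous f ->
  (forall x : R, is_derive x (1 : R) F (f x)) -> \int[leb]_(x in `]a, b]) f x = F b - F a.
Proof.
move=> ab cf dF.
have cF x : {for x, continuous F}.
  by apply: differentiable_continuous; apply/derivable1_diffP; case: (dF x).
rewrite Rintegral_itv_obnd_cbnd; last first.
  apply: (@integrableS _ _ _ leb `[a, b]%classic) => //.
    by apply: subset_itvr; rewrite bnd_simp.
  apply: continuous_compact_integrable; first exact: segment_compact.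
  exact: continuous_subspaceT.
rewrite /Rintegral (@continuous_FTC2 _ f F a b ab).
- by rewrite -EFinB.
- by apply: continuous_subspaceT => x; exact: cf.
- split; first by move=> x _; case: (dF x).
    by apply: cvg_at_right_filter; exact: cF.
  by apply: cvg_at_left_filter; exact: cF.
- by move=> x _; rewrite derive1E; case: (dF x) => _ ->.
Qed.

Lemma Rintegral_bounded_cvg (v : T -> R) (k_ : (T -> R)^nat) (k : T -> R) (M c : R) :
  mu.-integrable setT (EFin \o v) -> (forall n, measurable_fun setT (k_ n)) ->
  (forall n q, `|k_ n q| <= M) -> (forall q, k_ ^~ q @ \oo --> k q) ->
  (forall n, \int[mu]_q (v q * k_ n q) = c) -> \int[mu]_q (v q * k q) = c.
Proof.
move=> vi mk kM kk v0; have /measurable_int/measurable_EFinP mv := vi.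
have M0 : 0 <= M by rewrite (le_trans _ (kM 0%N point)).
have vM : mu.-integrable setT (fun q => (M%:E * `|(v q)%:E|)%E).
  exact: (integrableZl measurableT M (integrable_abse vi)).
have cv q : (fun n => (v q * k_ n q)%:E) @ \oo --> (v q * k q)%:E.
  by apply: cvg_EFin; [exact: nearW|apply: cvgM; [exact: cvg_cst|exact: kk]].
have mvk n : measurable_fun setT (fun q => (v q * k_ n q)%:E).
  by apply/measurable_EFinP; exact: measurable_funM.
have mvk0 : measurable_fun setT (fun q => (v q * k q)%:E).
  by apply: (emeasurable_fun_cvg _ _ mvk) => q _; exact: cv.
have [||ki _] := dominated_convergence measurableT mvk mvk0 _ vM.
- by apply: aeW => q _; exact: cv.
- apply: aeW => q n _; rewrite /= -EFinM lee_fin normrM mulrC.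
  by rewrite ler_wpM2r.
rewrite -(fineK (integrable_fin_num measurableT ki)) => /fine_cvg h.
have h0 : (fun n => \int[mu]_q (v q * k_ n q)) @ \oo --> c.
  by under eq_fun do rewrite v0; exact: cvg_cst.
exact: (cvg_unique _ h h0).
Qed.

(* Integrating [cos (x (X - y))] against [expR (- dlt x)] gives the Poisson kernel;
   integrating it over [y] in ]a, b] gives a difference of arctangents, which
   tends to a multiple of the indicator of ]a, b] at [X]. *)
Section one_variable.
Variables (v : T -> R) (X : T -> mR).
Hypotheses (vi : mu.-integrable setT (EFin \o v)) (mX : measurable_fun setT X).
Hypothesis vcos : forall x : R, 0 < x -> \int[mu]_q (v q * cos (x * X q)) = 0.
Hypothesis vsin : forall x : R, 0 < x -> \int[mu]_q (v q * sin (x * X q)) = 0.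

Let bounded_int (k : T -> R) : measurable_fun setT k -> (forall q, `|k q| <= 1) ->
  mu.-integrable setT (fun q => (v q * k q)%:E).
Proof. by move=> mk k1; exact: (integrableM_bounded vi mk k1). Qed.

Let abs_cos (x : R) : `|cos x| <= 1. Proof. by rewrite ler_norml cos_geN1 cos_le1. Qed.
Let abs_sin (x : R) : `|sin x| <= 1. Proof. by rewrite ler_norml sin_geN1 sin_le1. Qed.
Let mcos : measurable_fun setT (@cos R : mR -> mR).
Proof. exact: (continuous_measurable_fun (@continuous_cos R)). Qed.
Let msin : measurable_fun setT (@sin R : mR -> mR).
Proof. exact: (continuous_measurable_fun (@continuous_sin R)). Qed.

Let mexp : measurable_fun setT (@expR R : mR -> mR).
Proof. exact: (continuous_measurable_fun (@continuous_expR R)). Qed.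

Let vcosB (x y : R) : 0 < x -> \int[mu]_q (v q * cos (x * (X q - y))) = 0.
Proof.
move=> x0.
have mxX : measurable_fun setT (fun q => x * X q) by exact: measurable_funM.
have i1 := bounded_int (measurableT_comp mcos mxX) (fun=> abs_cos _).
have i2 := bounded_int (measurableT_comp msin mxX) (fun=> abs_sin _).
under eq_Rintegral do rewrite mulrBr cosB mulrDr !mulrA mulrC
  [X in _ + X]mulrC.
rewrite RintegralD//; last 2 first.
- exact: (integrableZl measurableT (cos (x * y)) i1).
- exact: (integrableZl measurableT (sin (x * y)) i2).
by rewrite !RintegralZl// vcos// vsin// !mulr0 addr0.
Qed.

Let poisson_N (dlt y : R) n : 0 < dlt -> \int[mu]_q (v q *
  ((dlt + expR (- dlt * n.+1%:R) * ((X q - y) * sin ((X q - y) * n.+1%:R) -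
   dlt * cos ((X q - y) * n.+1%:R))) / (dlt ^+ 2 + (X q - y) ^+ 2))) = 0.
Proof.
move=> d0; set N : R := n.+1%:R.
have N0 : 0 < N by rewrite /N ltr0n.
pose f (z x : R) : R := expR (- dlt * x) * cos (z * x).
pose F (z x : R) : R := (dlt ^+ 2 + z ^+ 2)^-1 *
  (expR (- dlt * x) * (z * sin (z * x) - dlt * cos (z * x))).
have FE z : \int[leb]_(x in `]0, N]) f z x = F z N - F z 0.
  have cf : continuous (f z).
    move=> x; apply: differentiable_continuous; apply/derivable1_diffP.
    have := is_deriveM_fun (is_derive_comp_fun (is_derive_expR _) (is_derive_mulc (- dlt) x))
      (is_derive_comp_fun (is_derive_cos _) (is_derive_mulc z x)).
    by case.
  have dF x : is_derive x (1 : R) (F z) (f z x).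
    have d2 := is_deriveD_fun
      (is_deriveZ_fun z (is_derive_comp_fun (is_derive_sin _) (is_derive_mulc z x)))
      (is_deriveZ_fun (- dlt) (is_derive_comp_fun (is_derive_cos _) (is_derive_mulc z x))).
    have d3 := is_deriveZ_fun ((dlt ^+ 2 + z ^+ 2)^-1) (is_deriveM_fun
      (is_derive_comp_fun (is_derive_expR _) (is_derive_mulc (- dlt) x)) d2).
    have -> : F z = fun y => (dlt ^+ 2 + z ^+ 2)^-1 * (expR (- dlt * y) *
        (z * sin (z * y) + - dlt * cos (z * y))).
      by apply/funext => y'; rewrite /F !mulNr.
    apply: is_derive_eq d3 _; rewrite /f; field.
    by rewrite gt_eqF// ltr_pwDl ?exprn_gt0 ?sqr_ge0.
  exact: (Rintegral_FTC2 N0 cf dF).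
pose K (qx : T * mR) : R :=
  expR (- dlt * qx.2) * cos (qx.2 * (X qx.1 - y)) * \1_(`]0, N]%classic : set mR) qx.2.
have mXy : measurable_fun setT (fun q => X q - y) by exact: measurable_funB.
have mK : measurable_fun setT K.
  apply: measurable_funM; first apply: measurable_funM.
  - by apply: (measurableT_comp mexp); exact: measurable_funM.
  - apply: (measurableT_comp mcos); apply: measurable_funM => //.
    exact: (measurableT_comp mXy measurable_fst).
  - by apply: (measurableT_comp (f := \1_(`]0, N]%classic) : mR -> R)) => //; exact: measurable_indic.
have K1 q : `|K q| <= 1.
  rewrite /K indicE; case: (boolP (q.2 \in _)) => [/set_mem|_]; last by rewrite mulr0 normr0.
  rewrite /= in_itv /= mulr1 normrM => /andP[q0 _]; apply: mulr_ile1 => //.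
  by rewrite ger0_norm ?expR_ge0// -expR0 ler_expR mulNr oppr_le0 mulr_ge0// ltW.
have lebN : leb (`]0, N]%classic : set mR) = N%:E.
  by rewrite lebesgue_measure_itv /= lte_fin N0 oppr0 adde0.
have mN : measurable (`]0, N]%classic : set mR) by exact: measurable_itv.
have mK1 q : measurable_fun setT (fun s => K (q, s)).
  exact: (measurableT_comp mK (pair1_measurable _)).
have A1 q : `|K q| <= Num.max 1 (1 * N) by rewrite (le_trans (K1 q))// le_max lexx.
have A2 q : (\int[leb]_(s in `]0%R, N]) (`|K (q, s)|)%:E <= (Num.max 1 (1 * N))%:E)%E.
  apply: le_trans (le_integral_bounded mN lebN (mK1 q) (fun=> K1 _)) _.
  by rewrite lee_fin le_max lexx orbT.
have A3 s : (`]0, N]%classic : set mR) s -> \int[mu]_q (v q * K (q, s)) = 0.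
  move=> sN; have s0 : 0 < s by move: sN; rewrite /= in_itv => /andP[].
  rewrite -[RHS](mulr0 (expR (- dlt * s))) -[in RHS](vcosB y s0).
  have mc : measurable_fun setT (fun q => cos (s * (X q - y))).
    by apply: (measurableT_comp mcos); exact: measurable_funM.
  rewrite -(RintegralZl (expR (- dlt * s)) measurableT (bounded_int mc (fun=> abs_cos _))).
  by apply: eq_Rintegral => q _; rewrite /K indicE mem_set//= mulr1 mulrCA.
rewrite -[RHS](annihilated_average vi mK mN A1 A2 A3).
apply: eq_Rintegral => q _; congr (_ * _).
transitivity (\int[leb]_(s in `]0, N]) f (X q - y) s); last first.
  apply: eq_Rintegral => s /set_mem sN; rewrite /K indicE mem_set//= mulr1 /f.
  by rewrite [s * (X q - y)]mulrC.
by rewrite FE /F !mulr0 expR0 sin0 cos0 mulr0 mulr1 mul1r sub0r; field;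
  rewrite gt_eqF// ltr_pwDl ?exprn_gt0 ?sqr_ge0.
Qed.

Let poisson (dlt y : R) : 0 < dlt ->
  \int[mu]_q (v q * (dlt / (dlt ^+ 2 + (X q - y) ^+ 2))) = 0.
Proof.
move=> d0.
have mXy : measurable_fun setT (fun q => X q - y) by exact: measurable_funB.
have den0 z : 0 < dlt ^+ 2 + z ^+ 2 by rewrite ltr_pwDl ?exprn_gt0 ?sqr_ge0.
apply: (Rintegral_bounded_cvg (M := 3 / dlt) vi _ _ _ (fun n => poisson_N y n d0)).
- move=> n; apply: measurable_funM.
    apply: measurable_funD => //; apply: measurable_funM => //.
    apply: measurable_funB; apply: measurable_funM => //.
    - apply: (measurableT_comp msin); exact: measurable_funM.
    - apply: (measurableT_comp mcos); exact: measurable_funM.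
  have mden : measurable_fun setT (fun q => dlt ^+ 2 + (X q - y) ^+ 2).
    by apply: measurable_funD => //; exact: measurable_funX.
  exact: (measurableT_comp (@measurable_invr R) mden).
- move=> n q; set z := X q - y; set e := expR _.
  have /andP[e0 e1] : 0 <= e <= 1.
    by rewrite /e expR_ge0/= -expR0 ler_expR mulNr oppr_le0 mulr_ge0// ltW.
  rewrite normrM normfV (gtr0_norm (den0 z)) ler_pdivrMr//.
  have h : `|dlt + e * (z * sin (z * n.+1%:R) - dlt * cos (z * n.+1%:R))| <= 2 * dlt + `|z|.
    apply: le_trans (ler_normD _ _) _; rewrite (gtr0_norm d0) mulr_natl mulr2n -addrA lerD2l.
    rewrite normrM (ger0_norm e0) (le_trans (ler_piMl _ e1))// addrC.
    apply: le_trans (ler_normB _ _) _; apply: lerD; rewrite normrM.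
      by rewrite ler_piMr.
    by rewrite (gtr0_norm d0) ler_piMr// ltW.
  apply: le_trans h _.
  rewrite mulrAC ler_pdivlMr// -[z ^+ 2]real_normK ?num_real//.
  have := normr_ge0 z; set w := `|z| => w0.
  have := sqr_ge0 (w - dlt); nra.
- move=> q; set z := X q - y.
  apply: cvgM; last exact: cvg_cst.
  rewrite -[X in _ --> X]addr0; apply: cvgD; first exact: cvg_cst.
  pose c := `|z| + dlt.
  have ecvg : (fun n : nat => expR (- dlt * n.+1%:R) * c) @ \oo --> (0 : R).
    rewrite -[X in _ --> X](mul0r c); apply: cvgM; last exact: cvg_cst.
    have dy : (fun n : nat => dlt * n.+1%:R) @ \oo --> +oo.
      apply/cvgryPgt => B; near=> n; rewrite -ltr_pdivrMl//.
      rewrite (@lt_le_trans _ _ n%:R) ?ler_nat//.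
      by near: n; exact: nbhs_infty_gtr.
    have := cvg_comp _ _ dy (@cvgr_expR R); apply: cvg_trans.
    by apply: near_eq_cvg; apply: nearW => n; rewrite /= mulNr.
  have mecvg : (fun n : nat => - (expR (- dlt * n.+1%:R) * c)) @ \oo --> (0 : R).
    by rewrite -[X in _ --> X]oppr0; exact: cvgN.
  apply: (squeeze_cvgr _ mecvg ecvg); apply: nearW => n.
  rewrite -ler_norml normrM ger0_norm ?expR_ge0// ler_wpM2l ?expR_ge0//.
  apply: le_trans (ler_normB _ _) _; apply: lerD; rewrite normrM.
    by rewrite ler_piMr.
  by rewrite (gtr0_norm d0) ler_piMr// ltW.
Unshelve. all: by end_near. Qed.

Let atan_average (dlt a b : R) : 0 < dlt -> a < b ->
  \int[mu]_q (v q * (atan ((X q - a) / dlt) - atan ((X q - b) / dlt))) = 0.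
Proof.
move=> d0 ab.
have den0 z : 0 < dlt ^+ 2 + z ^+ 2 by rewrite ltr_pwDl ?exprn_gt0 ?sqr_ge0.
pose f (x y : R) : R := dlt / (dlt ^+ 2 + (x - y) ^+ 2).
pose F (x y : R) : R := - atan ((x - y) / dlt).
have f1 x y : `|f x y| <= dlt^-1.
  rewrite /f normrM normfV (gtr0_norm (den0 _)) gtr0_norm// ler_pdivrMr//.
  by rewrite mulrDr expr2 mulrA mulVf ?gt_eqF// mul1r lerDl mulr_ge0 ?invr_ge0 ?(ltW d0) ?sqr_ge0.
have dsub x y : is_derive y (1 : R) (fun y => (x - y) / dlt) (- dlt^-1).
  have -> : (fun y => (x - y) / dlt) = (fun y => x / dlt + (- dlt^-1) * y).
    by apply/funext => z; rewrite mulrBl mulNr [dlt^-1 * z]mulrC.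
  rewrite -[X in is_derive _ _ _ X]add0r.
  exact: (is_deriveD_fun (is_derive_cst _ _ _) (is_derive_mulc _ _)).
have dF x y : is_derive y (1 : R) (F x) (f x y).
  have d2 := is_deriveZ_fun (-1) (is_derive_comp_fun (is_derive1_atan _) (dsub x y)).
  have -> : F x = fun y => -1 * atan ((x - y) / dlt) by apply/funext => z; rewrite mulN1r.
  apply: is_derive_eq d2 _; rewrite /f.
  by field; rewrite ?gt_eqF ?den0//= gt_eqF// ltr_pwDl ?exprn_gt0 ?sqr_ge0.
have cf x : continuous (f x).
  move=> y; apply: cvgM; first exact: cvg_cst.
  apply: cvgV; first by rewrite gt_eqF.
  apply: cvgD; first exact: cvg_cst.
  rewrite expr2; under eq_fun do rewrite expr2.
  by apply: cvgM; apply: cvgB; (exact: cvg_cst || exact: cvg_id).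
have FE x : \int[leb]_(y in `]a, b]) f x y = F x b - F x a.
  exact: (Rintegral_FTC2 ab (cf x) (dF x)).
pose K (qy : T * mR) : R := f (X qy.1) qy.2.
have mK : measurable_fun setT K.
  have mden : measurable_fun setT (fun qy : T * mR => dlt ^+ 2 + (X qy.1 - qy.2) ^+ 2).
    apply: measurable_funD => //; apply: measurable_funX; apply: measurable_funB => //.
    exact: (measurableT_comp mX measurable_fst).
  by apply: measurable_funM => //; exact: (measurableT_comp (@measurable_invr R) mden).
have lebab : leb (`]a, b]%classic : set mR) = (b - a)%:E.
  by rewrite lebesgue_measure_itv /= lte_fin ab -EFinB.
have mab : measurable (`]a, b]%classic : set mR) by exact: measurable_itv.
pose M := Num.max dlt^-1 (dlt^-1 * (b - a)).
have A1 q : `|K q| <= M by rewrite (le_trans (f1 _ _))// le_max lexx.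
have A2 q : (\int[leb]_(s in `]a, b]) (`|K (q, s)|)%:E <= M%:E)%E.
  have mK1 : measurable_fun setT (fun s => K (q, s)).
    exact: (measurableT_comp mK (pair1_measurable _)).
  apply: le_trans (le_integral_bounded mab lebab mK1 (fun=> f1 _ _)) _.
  by rewrite lee_fin le_max lexx orbT.
have A3 s : (`]a, b]%classic : set mR) s -> \int[mu]_q (v q * K (q, s)) = 0.
  by move=> _; exact: poisson.
rewrite -[RHS](annihilated_average vi mK mab A1 A2 A3).
apply: eq_Rintegral => q _; congr (_ * _).
by rewrite -[RHS]/(\int[leb]_(y in `]a, b]) f (X q) y) FE /F opprK addrC.
Qed.

Let atan_step (x : R) :
  (fun n : nat => atan (x * n.+1%:R ^+ 2 - n.+1%:R)) @ \oo -->
  (if 0 < x then pi / 2 else - (pi / 2) : R).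
Proof.
have key (u : nat -> R) : (forall n, n.+1%:R <= u n) \/ (\forall n \near \oo, n.+1%:R <= u n) ->
    (fun n => atan (u n)) @ \oo --> (pi / 2 : R).
  move=> h; have {}h : \forall n \near \oo, n.+1%:R <= u n.
    by case: h => // h; exact: nearW.
  have uy : u @ \oo --> +oo.
    apply/cvgryPgt => B; near=> n.
    rewrite (@lt_le_trans _ _ n%:R)//; first by near: n; exact: nbhs_infty_gtr.
    rewrite (@le_trans _ _ n.+1%:R) ?ler_nat//.
    by near: n.
  exact: (cvg_comp _ _ uy (@cvgy_atan R)).
have [x0|x0] := ltP 0 x.
  apply: key; right; near=> n.
  have h : 2 <= x * n.+1%:R.
    rewrite -ler_pdivrMl// (@le_trans _ _ n%:R) ?ler_nat//.
    by near: n; exact: nbhs_infty_ger.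
  by have n0 : 0 <= n.+1%:R :> R by []; nra.
have -> : (fun n : nat => atan (x * n.+1%:R ^+ 2 - n.+1%:R)) =
    (fun n => - atan (n.+1%:R - x * n.+1%:R ^+ 2)).
  by apply/funext => n; rewrite -atanN opprB.
apply: cvgN; apply: key; left => n.
by rewrite lerDl oppr_ge0 mulr_le0_ge0// sqr_ge0.
Unshelve. all: by end_near. Qed.

Lemma fourier_1d (a b : R) : a < b ->
  \int[mu]_q (v q * \1_(`]a, b]%classic) (X q)) = 0.
Proof.
move=> ab.
pose k_ n q := atan ((X q - a) * n.+1%:R ^+ 2 - n.+1%:R) - atan ((X q - b) * n.+1%:R ^+ 2 - n.+1%:R).
have matan : measurable_fun setT (@atan R : mR -> mR).
  exact: (continuous_measurable_fun (@continuous_atan R)).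
have mk n : measurable_fun setT (k_ n).
  apply: measurable_funB; apply: (measurableT_comp matan); apply: measurable_funB => //;
  by apply: measurable_funM => //; exact: measurable_funB.
have k1 n q : `|k_ n q| <= pi.
  apply: le_trans (ler_normB _ _) _.
  have h (x : R) : `|atan x| <= pi / 2.
    by rewrite ler_norml ltW ?atan_gtNpi2//= ltW ?atan_ltpi2.
  by rewrite [leRHS](splitr pi) lerD.
pose k (q : T) : R := (if 0 < X q - a then pi / 2 else - (pi / 2)) -
            (if 0 < X q - b then pi / 2 else - (pi / 2)).
have kk q : k_ ^~ q @ \oo --> (k q : R).
  by apply: cvgB; exact: atan_step.
have v0 n : \int[mu]_q (v q * k_ n q) = 0.
  have N0 : 0 < n.+1%:R :> R by [].
  have ab' : a + n.+1%:R^-1 < b + n.+1%:R^-1 by rewrite ltrD2r.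
  have N2 : 0 < (n.+1%:R ^+ 2)^-1 :> R by rewrite invr_gt0 exprn_gt0.
  rewrite -[RHS](atan_average N2 ab'); apply: eq_Rintegral => q _.
  congr (_ * (atan _ - atan _)); rewrite invrK; field; rewrite gt_eqF//.
have := Rintegral_bounded_cvg vi mk k1 kk v0.
have -> : k = fun q => pi * \1_(`]a, b]%classic) (X q).
  apply/funext => q; rewrite /k indicE !subr_gt0.
  have [Xa|Xa] := ltP a (X q); have [Xb|Xb] := ltP b (X q).
  - by rewrite memNset ?subrr ?mulr0//= in_itv /= Xa leNgt Xb.
  - by rewrite mem_set /= ?in_itv /= ?Xa ?Xb// mulr1; lra.
  - by move: (lt_trans ab Xb); rewrite ltNge Xa.
  - by rewrite memNset ?subrr ?mulr0//= in_itv /= ltNge Xa.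
have mi : measurable_fun setT (fun q => \1_(`]a, b]%classic) (X q) : R).
  by apply: (measurableT_comp (f := \1_(`]a, b]%classic) : mR -> R)) => //; exact: measurable_indic.
have i1 q : `|\1_(`]a, b]%classic) (X q) : R| <= 1.
  by rewrite indicE; case: (_ \in _); rewrite ?normr1 ?normr0.
under eq_Rintegral do rewrite mulrCA.
rewrite (RintegralZl pi measurableT (bounded_int mi i1)) => /eqP.
by rewrite mulf_eq0 gt_eqF ?pi_gt0//= => /eqP.
Qed.

End one_variable.

End fourier_1d.

Section fourier_step.
Context d (T : measurableType d) (R : realType).
Variable mu : {sigma_finite_measure set T -> \bar R}.
Local Notation mR := (measurableTypeR R).

Lemma measurable_cos : measurable_fun setT (@cos R : mR -> mR).
Proof. exact: (continuous_measurable_fun (@continuous_cos R)). Qed.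

Lemma measurable_sin : measurable_fun setT (@sin R : mR -> mR).
Proof. exact: (continuous_measurable_fun (@continuous_sin R)). Qed.

Lemma ler_norm_cos (x : R) : `|cos x| <= 1.
Proof. by rewrite ler_norml cos_geN1 cos_le1. Qed.

Lemma ler_norm_sin (x : R) : `|sin x| <= 1.
Proof. by rewrite ler_norml sin_geN1 sin_le1. Qed.

Lemma fourier_step (v : T -> R) (X A : T -> mR) (a b : R) :
  mu.-integrable setT (EFin \o v) -> measurable_fun setT X -> measurable_fun setT A ->
  (forall x : R, 0 < x -> \int[mu]_q (v q * cos (A q + x * X q)) = 0) ->
  (forall x : R, 0 < x -> \int[mu]_q (v q * cos (A q - x * X q)) = 0) ->
  (forall x : R, 0 < x -> \int[mu]_q (v q * sin (A q + x * X q)) = 0) ->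
  (forall x : R, 0 < x -> \int[mu]_q (v q * sin (A q - x * X q)) = 0) -> a < b ->
  \int[mu]_q (v q * \1_(`]a, b]%classic) (X q) * cos (A q)) = 0 /\
  \int[mu]_q (v q * \1_(`]a, b]%classic) (X q) * sin (A q)) = 0.
Proof.
move=> vi mX mA cp cm sp sm ab.
have mXx (x : R) : measurable_fun setT (fun q => x * X q) by exact: measurable_funM.
have ic (B : T -> mR) : measurable_fun setT B ->
    mu.-integrable setT (fun q => (v q * cos (B q))%:E).
  move=> mB; apply: (integrableM_bounded vi (measurableT_comp measurable_cos mB)).
  by move=> q; exact: ler_norm_cos.
have is_ (B : T -> mR) : measurable_fun setT B ->
    mu.-integrable setT (fun q => (v q * sin (B q))%:E).
  move=> mB; apply: (integrableM_bounded vi (measurableT_comp measurable_sin mB)).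
  by move=> q; exact: ler_norm_sin.
have mp x : measurable_fun setT (fun q => A q + x * X q) by exact: measurable_funD.
have mm x : measurable_fun setT (fun q => A q - x * X q) by exact: measurable_funB.
have half (f g : T -> R) : mu.-integrable setT (EFin \o f) -> mu.-integrable setT (EFin \o g) ->
    \int[mu]_q f q = 0 -> \int[mu]_q g q = 0 -> \int[mu]_q (2^-1 * (f q + g q)) = 0.
  move=> fi gi f0 g0; rewrite RintegralZl//; last exact: (integrableD measurableT fi gi).
  by rewrite (RintegralD measurableT fi gi) f0 g0 addr0 mulr0.
have halfB (f g : T -> R) : mu.-integrable setT (EFin \o f) -> mu.-integrable setT (EFin \o g) ->
    \int[mu]_q f q = 0 -> \int[mu]_q g q = 0 -> \int[mu]_q (2^-1 * (f q - g q)) = 0.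
  move=> fi gi f0 g0; rewrite RintegralZl//; last exact: (integrableB measurableT fi gi).
  by rewrite (RintegralB measurableT fi gi) f0 g0 subr0 mulr0.
split; under eq_Rintegral do rewrite mulrAC.
- apply: (fourier_1d (ic _ mA) mX _ _ ab) => x x0.
  + rewrite -[RHS](half _ _ (ic _ (mp x)) (ic _ (mm x)) (cp x x0) (cm x x0)).
    by apply: eq_Rintegral => q _; rewrite cosB cosD; field.
  + rewrite -[RHS](halfB _ _ (is_ _ (mp x)) (is_ _ (mm x)) (sp x x0) (sm x x0)).
    by apply: eq_Rintegral => q _; rewrite sinB sinD; field.
- apply: (fourier_1d (is_ _ mA) mX _ _ ab) => x x0.
  + rewrite -[RHS](half _ _ (is_ _ (mp x)) (is_ _ (mm x)) (sp x x0) (sm x x0)).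
    by apply: eq_Rintegral => q _; rewrite sinB sinD; field.
  + rewrite -[RHS](halfB _ _ (ic _ (mm x)) (ic _ (mp x)) (cm x x0) (cp x x0)).
    by apply: eq_Rintegral => q _; rewrite cosB cosD; field.
Qed.

End fourier_step.

Section fourier_uniqueness.
Variable R : realType.
Local Notation mR := (measurableTypeR R).
Local Notation H := (mR * mR * mR)%type.
Local Notation mu := (haar_sf R).
Variable u : H -> R.
Hypothesis ui : mu.-integrable setT (EFin \o u).
Hypothesis ucos : forall x y t : R, 0 < t ->
  \int[mu]_q (u q * cos (x * q.1.1 + y * q.1.2 + t * q.2)) = 0.
Hypothesis usin : forall x y t : R, 0 < t ->
  \int[mu]_q (u q * sin (x * q.1.1 + y * q.1.2 + t * q.2)) = 0.

Let mind (X : H -> mR) (a b : R) : measurable_fun setT X ->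
  measurable_fun setT (fun q => \1_(`]a, b]%classic) (X q) : R).
Proof.
by move=> mX; apply: (measurableT_comp (f := \1_(`]a, b]%classic) : mR -> R)).
Qed.

Let bind (X : H -> mR) (a b : R) q : `|\1_(`]a, b]%classic) (X q) : R| <= 1.
Proof. by rewrite indicE; case: (_ \in _); rewrite ?normr1 ?normr0. Qed.

Let m11 := @measurable_H11 R.
Let m12 := @measurable_H12 R.
Let m2 := @measurable_H2 R.

Let box0 (a1 b1 a2 b2 a3 b3 : R) : a1 < b1 -> a2 < b2 -> a3 < b3 ->
  \int[mu]_q (u q * \1_(`]a3, b3]%classic) q.2 * \1_(`]a2, b2]%classic) q.1.2 *
    \1_(`]a1, b1]%classic) q.1.1) = 0.
Proof.
move=> ab1 ab2 ab3.
pose u1 (q : H) := u q * \1_(`]a3, b3]%classic) q.2.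
have u1i : mu.-integrable setT (EFin \o u1).
  exact: (integrableM_bounded ui (mind _ _ m2) (fun q => bind _ _ _ q)).
pose u2 (q : H) := u1 q * \1_(`]a2, b2]%classic) q.1.2.
have u2i : mu.-integrable setT (EFin \o u2).
  exact: (integrableM_bounded u1i (mind _ _ m12) (fun q => bind _ _ _ q)).
have h1 (x y : R) : \int[mu]_q (u1 q * cos (x * q.1.1 + y * q.1.2)) = 0 /\
    \int[mu]_q (u1 q * sin (x * q.1.1 + y * q.1.2)) = 0.
  have mA : measurable_fun setT (fun q : H => x * q.1.1 + y * q.1.2).
    by apply: measurable_funD; exact: measurable_funM.
  have cm (t : R) : 0 < t ->
      \int[mu]_q (u q * cos (x * q.1.1 + y * q.1.2 - t * q.2)) = 0.
    move=> t0; rewrite -[RHS](ucos (- x) (- y) t0); apply: eq_Rintegral => q _.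
    by rewrite -cosN; congr (_ * cos _); ring.
  have sm (t : R) : 0 < t ->
      \int[mu]_q (u q * sin (x * q.1.1 + y * q.1.2 - t * q.2)) = 0.
    move=> t0; rewrite -[RHS](mulr0 (-1)) -[in RHS](usin (- x) (- y) t0).
    have mB : measurable_fun setT (fun q : H => - x * q.1.1 + - y * q.1.2 + t * q.2).
      by apply: measurable_funD; [apply: measurable_funD|]; exact: measurable_funM.
    have Bi := integrableM_bounded ui (measurableT_comp (@measurable_sin R) mB)
      (fun=> ler_norm_sin _).
    rewrite -(RintegralZl (-1) measurableT Bi); apply: eq_Rintegral => q _.
    by rewrite -[LHS]opprK -mulrN -sinN mulN1r; congr (- (_ * sin _)); ring.
  exact: (fourier_step ui m2 mA (ucos x y) cm (usin x y) sm ab3).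
have h2 (x : R) : \int[mu]_q (u2 q * cos (x * q.1.1)) = 0 /\
    \int[mu]_q (u2 q * sin (x * q.1.1)) = 0.
  have mA : measurable_fun setT (fun q : H => x * q.1.1) by exact: measurable_funM.
  apply: (fourier_step u1i m12 mA _ _ _ _ ab2) => y y0; first exact: (h1 x y).1.
  - by have := (h1 x (- y)).1; under eq_Rintegral do rewrite mulNr.
  - exact: (h1 x y).2.
  - by have := (h1 x (- y)).2; under eq_Rintegral do rewrite mulNr.
exact: (fourier_1d u2i m11 (fun x _ => (h2 x).1) (fun x _ => (h2 x).2) ab1).
Qed.

Let mI (A : set H) : measurable A -> measurable_fun setT (\1_A : H -> R).
Proof. exact: measurable_indic. Qed.

Let I1 (A : set H) q : `|\1_A q : R| <= 1.
Proof. by rewrite indicE; case: (_ \in _); rewrite ?normr1 ?normr0. Qed.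

Let P (A : set H) := measurable A /\ \int[mu]_q (u q * \1_A q) = 0.

Let ui1 (A : set H) : measurable A -> mu.-integrable setT (fun q => (u q * \1_A q)%:E).
Proof. by move=> mA; exact: (integrableM_bounded ui (mI mA) (I1 A)). Qed.

Let P_nondecreasing (F : (set H)^nat) : nondecreasing_seq F -> (forall n, P (F n)) ->
  P (\bigcup_n F n).
Proof.
move=> ndF PF; split; first by apply: bigcup_measurable => n _; exact: (PF n).1.
have mF n : measurable_fun setT (\1_(F n) : H -> R) by have [/mI] := PF n.
apply: (Rintegral_bounded_cvg ui mF (fun n => I1 (F n)) (fun q => _) (fun n => (PF n).2)) => q.
exact: cvg_indic_bigcup.
Qed.

Let box (a b : R) : set H := `]a, b]%classic `*` `]a, b]%classic `*` `]a, b]%classic.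

Let P_box (a1 b1 a2 b2 a3 b3 : R) :
  P (`]a1, b1]%classic `*` `]a2, b2]%classic `*` `]a3, b3]%classic).
Proof.
split; first by apply: measurableX; [apply: measurableX|]; exact: measurable_itv.
have E (q : H) : \1_(`]a1, b1]%classic `*` `]a2, b2]%classic `*` `]a3, b3]%classic) q =
    \1_(`]a3, b3]%classic) q.2 * \1_(`]a2, b2]%classic) q.1.2 * \1_(`]a1, b1]%classic) q.1.1 :> R.
  rewrite !indicE -!natrM !mulnb; congr (_ (nat_of_bool _)).
  apply/idP/idP => [/set_mem[[h1 h2] h3]|]; first by rewrite !mem_set.
  by move=> /andP[/andP[/set_mem h1 /set_mem h2] /set_mem h3]; apply: mem_set.
have I0 (a b x : R) : b <= a -> \1_(`]a, b]%classic) x = 0 :> R.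
  by move=> ba; rewrite set_itv_ge ?indic0// -leNgt bnd_simp.
have z : \int[mu]_q (0 : R) = 0 by rewrite /Rintegral integral0.
under eq_Rintegral do rewrite E !mulrA.
have [ab1|ab1] := ltP a1 b1; last first.
  by under eq_Rintegral do rewrite (I0 a1 b1) ?mulr0//.
have [ab2|ab2] := ltP a2 b2; last first.
  by under eq_Rintegral do rewrite (I0 a2 b2) ?mulr0 ?mul0r//.
have [ab3|ab3] := ltP a3 b3; last first.
  by under eq_Rintegral do rewrite (I0 a3 b3) ?mulr0 ?mul0r//.
exact: box0.
Qed.

Let PL : lambda_system setT P.
Proof.
split => //.
- have -> : setT = \bigcup_n box (- n%:R) n%:R.
    apply/seteqP; split => // q _.
    pose m := Num.max `|q.1.1| (Num.max `|q.1.2| `|q.2|).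
    have mn := truncnS_gt m; exists (Num.truncn m).+1 => //.
    have h (x : R) : `|x| <= m -> `]- (Num.truncn m).+1%:R, (Num.truncn m).+1%:R]%classic x.
      move=> xm; rewrite /= in_itv /=.
      by have /ltr_normlP[? ?] := le_lt_trans xm mn; rewrite ltrNl ltW// andbT.
    by split; [split|]; apply: h; rewrite /m !le_max lexx ?orbT.
  apply: P_nondecreasing => [m n mn|n]; last exact: P_box.
  apply/subsetPset.
  have h (x : R) : `]- m%:R, m%:R]%classic x -> `]- n%:R, n%:R]%classic x.
    rewrite /= !in_itv /= => /andP[h1 h2].
    have mnR : m%:R <= n%:R :> R by rewrite ler_nat.
    by rewrite (le_lt_trans _ h1) ?lerN2// (le_trans h2).
  by move=> q [[h1 h2] h3]; split; [split|]; exact: h.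
- move=> A B BA [mA A0] [mB B0]; split; first exact: measurableD.
  have E q : u q * \1_(A `\` B) q = u q * \1_A q - u q * \1_B q.
    rewrite -mulrBr; congr (_ * _); rewrite !indicE.
    have [qB|qB] := boolP (q \in B).
      rewrite (mem_set (BA _ (set_mem qB))) subrr.
      by rewrite memNset// => -[_]; apply; exact: set_mem.
    rewrite subr0; congr (_ (nat_of_bool _)); apply/idP/idP => [/set_mem[h _]|/set_mem h].
      exact: mem_set.
    by apply: mem_set; split => // /mem_set; exact/negP.
  under eq_Rintegral do rewrite E.
  by rewrite (RintegralB measurableT (ui1 mA) (ui1 mB)) A0 B0 subrr.
Qed.

Lemma fourier_uniqueness : {ae mu, forall q, u q = 0}.
Proof.
have PA A : measurable A -> \int[mu]_q (u q * \1_A q) = 0.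
  by move=> mA; suff : P A by [case]; exact: (boxes_lambda_system PL).
have c0 : measurable_fun setT (fun _ : H => 0%E : \bar R) by exact: measurable_cst.
have := integral_ae_eq measurableT ui c0.
move=> h; have {}h : ae_eq mu setT (EFin \o u) (fun=> 0%E); last first.
  by apply: filterS h => q /(_ I) /= [].
apply: h => E _ mE; rewrite integral0 integral_mkcond.
have iE := integrable_fin_num measurableT (ui1 mE).
rewrite -[RHS]/(0%R%:E) -(PA E mE) /Rintegral fineK//.
apply: eq_integral => q _; rewrite patchE indicE.
by case: ifPn => _ /=; rewrite ?mulr1 ?mulr0.
Qed.

End fourier_uniqueness.

(** * Gaussian test functions *)

Section complex_exponential.
Variable R : realType.
Implicit Types (z w : R[i]) (r : R).

Definition cexp z : R[i] :=
  Complex (expR (cRe z) * cos (cIm z)) (expR (cRe z) * sin (cIm z)).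

Lemma cexpD z w : cexp (z + w) = cexp z * cexp w.
Proof.
by apply: complex_eqP; rewrite ?ReM ?ImM /= ReD ImD expRD ?cosD ?sinD; ring.
Qed.

Lemma cexp0 : cexp 0 = 1.
Proof. by apply: complex_eqP; rewrite /= expR0 mul1r ?cos0 ?sin0. Qed.

Lemma cexp_real r : cexp r%:C = (expR r)%:C.
Proof. by apply: complex_eqP; rewrite /= ?cos0 ?sin0 ?mulr1 ?mulr0. Qed.

Lemma normc_cexp z : normc (cexp z) = expR (cRe z).
Proof.
rewrite /= !exprMn -mulrDr cos2Dsin2 mulr1 sqrtr_sqr.
by rewrite ger0_norm// expR_ge0.
Qed.

Definition cexp_sum (N : nat) z : R[i] := \sum_(m < N) ((m`!%:R)^-1)%:C * z ^+ m.

Lemma cexp_sumS N z : cexp_sum N.+1 z = cexp_sum N z + ((N`!%:R)^-1)%:C * z ^+ N.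
Proof. exact: big_ord_recr. Qed.

Lemma normc_sum I (s : seq I) (P : pred I) (F : I -> R[i]) :
  normc (\sum_(i <- s | P i) F i) <= \sum_(i <- s | P i) normc (F i).
Proof.
elim/big_ind2 : _ => [|x1 x2 y1 y2 h1 h2|//]; first by rewrite ComplexField.Normc.normc0.
exact: le_trans (le_normcD _ _) (lerD h1 h2).
Qed.

Lemma normcX z n : normc (z ^+ n) = normc z ^+ n.
Proof.
by elim: n => [|n IH]; rewrite ?ComplexField.Normc.normc1// !exprS ComplexField.Normc.normcM IH.
Qed.

Lemma normc_cexp_sum N z : normc (cexp_sum N z) <= expR (normc z).
Proof.
apply: le_trans (normc_sum _ _ _) _.
have x0 := normc_ge0 z.
have -> : \sum_(m < N) normc (((m`!%:R)^-1)%:C * z ^+ m) = series (exp_coeff (normc z)) N.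
  rewrite /series /= big_mkord; apply: eq_bigr => m _.
  rewrite ComplexField.Normc.normcM normc_real normcX exp_coeffE ger0_norm//.
apply: nondecreasing_cvgn_le; last exact: is_cvg_series_exp_coeff.
by apply: nondecreasing_series => m _ _; exact: exp_coeff_ge0.
Qed.

Lemma le_of_derive (g G g' G' : R -> R) : (forall x : R, is_derive x (1 : R) g (g' x)) ->
  (forall x : R, is_derive x (1 : R) G (G' x)) ->
  g 0 <= G 0 -> (forall x, 0 <= x <= 1 -> g' x <= G' x) ->
  forall x, 0 <= x <= 1 -> g x <= G x.
Proof.
move=> dg dG g0 gG x /andP[x0 x1].
have dGg (y : R) : is_derive y (1 : R) (G - g) (G' y - g' y) by exact: is_deriveB.
have : (G - g) 0 <= (G - g) x.
  apply: (@ger0_derive1_le_cc _ _ 0 1) => //; rewrite ?in_itv /= ?lexx ?x0 ?x1 ?ler01//.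
  - move=> y; rewrite in_itv /= => /andP[y0 y1]; rewrite derive1E.
    by have [_ ->] := dGg y; rewrite subr_ge0 gG// !ltW.
  - apply: derivable_within_continuous => y _; by case: (dGg y).
by rewrite /= => h; move: g0; rewrite -subr_ge0 => g0; rewrite -subr_ge0 (le_trans g0).
Qed.

Lemma is_derive_expn N (r : R) :
  is_derive r (1 : R) (fun t => t ^+ N.+1) (N.+1%:R * r ^+ N).
Proof.
elim: N => [|N IH]; first by rewrite expr0 mulr1; exact: is_derive_id.
under eq_fun do rewrite exprS.
apply: (is_derive_eq (is_deriveM_fun (is_derive_id _ _) IH)).
by rewrite /= exprS -[N.+2]addn1 natrD; ring.
Qed.

(* The remainder [E N] of the exponential series satisfies [(E N.+1)' = z * E N],
   which bounds it by induction. *)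
Section remainder.
Variable z : R[i].
Let x := cRe z.
Let y := cIm z.
Let E N r := cexp (r%:C * z) - cexp_sum N (r%:C * z).
Let K := 2 * normc z.
Let M := expR (normc z).

Let ReZ (r : R) (w : R[i]) : cRe (r%:C * w) = r * cRe w.
Proof. by rewrite ReM /= mul0r subr0. Qed.
Let ImZ (r : R) (w : R[i]) : cIm (r%:C * w) = r * cIm w.
Proof. by rewrite ImM /= mul0r addr0. Qed.

Let dcexp (r : R) : is_derive r (1 : R) (fun r => cRe (cexp (r%:C * z))) (cRe (z * cexp (r%:C * z))) /\
  is_derive r (1 : R) (fun r => cIm (cexp (r%:C * z))) (cIm (z * cexp (r%:C * z))).
Proof.
have d1 (c : R) : is_derive r (1 : R) (fun r => r * c) c.
  by under eq_fun do rewrite mulrC; exact: is_derive_mulc.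
have de : is_derive r (1 : R) (fun r => expR (r * x)) (expR (r * x) * x).
  exact: is_derive_comp_fun.
have dc : is_derive r (1 : R) (fun r => cos (r * y)) (- sin (r * y) * y).
  exact: is_derive_comp_fun.
have ds : is_derive r (1 : R) (fun r => sin (r * y)) (cos (r * y) * y).
  exact: is_derive_comp_fun.
split.
- have -> : (fun r : R => cRe (cexp (r%:C * z))) = (fun r => expR (r * x) * cos (r * y)).
    by apply/funext => t; rewrite [LHS]/(expR _ * _) ReZ ImZ.
  apply: (is_derive_eq (is_deriveM_fun de dc)).
  by rewrite ReM /cexp ReZ ImZ /= -/x -/y; ring.
- have -> : (fun r : R => cIm (cexp (r%:C * z))) = (fun r => expR (r * x) * sin (r * y)).
    by apply/funext => t; rewrite [LHS]/(expR _ * _) ReZ ImZ.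
  apply: (is_derive_eq (is_deriveM_fun de ds)).
  by rewrite ImM /cexp ReZ ImZ /= -/x -/y; ring.
Qed.

Let csumS N (r : R) :
  cexp_sum N.+1 (r%:C * z) = cexp_sum N (r%:C * z) + (r ^+ N / N`!%:R)%:C * z ^+ N.
Proof.
rewrite cexp_sumS; congr (_ + _).
by rewrite exprMn mulrA -rmorphXn /= -rmorphM /= [_^-1 * _]mulrC.
Qed.

Let dcsum N (r : R) :
  is_derive r (1 : R) (fun r => cRe (cexp_sum N.+1 (r%:C * z))) (cRe (z * cexp_sum N (r%:C * z))) /\
  is_derive r (1 : R) (fun r => cIm (cexp_sum N.+1 (r%:C * z))) (cIm (z * cexp_sum N (r%:C * z))).
Proof.
elim: N => [|N [IH1 IH2]].
  have E1 (t : R) : cexp_sum 1 (t%:C * z) = 1.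
    by rewrite /cexp_sum big_ord1 expr0 mulr1 invr1.
  have E0 : cexp_sum 0 (r%:C * z) = 0 by rewrite /cexp_sum big_ord0.
  split; under eq_fun do rewrite E1; rewrite E0 mulr0; exact: is_derive_cst.
have dm c : is_derive r (1 : R) (fun r => r ^+ N.+1 / N.+1`!%:R * c) (r ^+ N / N`!%:R * c).
  have -> : (fun t : R => t ^+ N.+1 / N.+1`!%:R * c) = (fun t => (c / N.+1`!%:R) * t ^+ N.+1).
    by apply/funext => t; ring.
  apply: (is_derive_eq (is_deriveZ_fun _ (is_derive_expn N _))).
  rewrite factS natrM; field.
  by rewrite addrC natr1 !pnatr_eq0 -lt0n fact_gt0.
split.
- under eq_fun do rewrite csumS ReD ReZ.
  apply: (is_derive_eq (is_deriveD_fun IH1 (dm _))).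
  by rewrite (csumS N) mulrDr ReD mulrCA -exprS ReZ.
- under eq_fun do rewrite csumS ImD ImZ.
  apply: (is_derive_eq (is_deriveD_fun IH2 (dm _))).
  by rewrite (csumS N) mulrDr ImD mulrCA -exprS ImZ.
Qed.

Let dE N (r : R) : is_derive r (1 : R) (fun r => cRe (E N.+1 r)) (cRe (z * E N r)) /\
  is_derive r (1 : R) (fun r => cIm (E N.+1 r)) (cIm (z * E N r)).
Proof.
have [a1 a2] := dcexp r; have [b1 b2] := dcsum N r.
split.
- under eq_fun do rewrite ReD ReN.
  by rewrite mulrBr ReD ReN; exact: is_deriveB.
- under eq_fun do rewrite ImD ImN.
  by rewrite mulrBr ImD ImN; exact: is_deriveB.
Qed.

Let bE N (r : R) : 0 <= r <= 1 ->
  `|cRe (E N r)| <= M * (K * r) ^+ N / N`!%:R /\ `|cIm (E N r)| <= M * (K * r) ^+ N / N`!%:R.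
Proof.
have x0 := normc_ge0 z.
elim: N r => [|N IH] r r01.
  have : normc (E 0 r) <= M.
    rewrite /E /cexp_sum big_ord0 subr0 normc_cexp ler_expR.
    apply: le_trans (ler_norm _) _; apply: le_trans (ler_Re_normc _) _.
    case/andP: r01 => r0 r1.
    by rewrite ComplexField.Normc.normcM normc_real ger0_norm// ler_piMl.
  rewrite expr0 mulr1 divr1.
  by split; [exact: le_trans (ler_Re_normc _) _|exact: le_trans (ler_Im_normc _) _].
have dG (t : R) : is_derive t (1 : R) (fun t => M * (K * t) ^+ N.+1 / N.+1`!%:R)
    (K * (M * (K * t) ^+ N / N`!%:R)).
  have -> : (fun t : R => M * (K * t) ^+ N.+1 / N.+1`!%:R) =
      (fun t => (M * K ^+ N.+1 / N.+1`!%:R) * t ^+ N.+1).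
    by apply/funext => u; rewrite exprMn; ring.
  apply: (is_derive_eq (is_deriveZ_fun _ (is_derive_expn N _))).
  rewrite factS natrM [(K * t) ^+ N]exprMn [K ^+ N.+1]exprS; field.
  by rewrite addrC natr1 !pnatr_eq0 -lt0n fact_gt0.
have bz (t : R) : 0 <= t <= 1 -> normc (z * E N t) <= K * (M * (K * t) ^+ N / N`!%:R).
  move=> t01; have [h1 h2] := IH _ t01.
  set B := M * _ / _; have -> : K * B = normc z * (B + B) by rewrite /K; ring.
  rewrite ComplexField.Normc.normcM ler_wpM2l//.
  exact: le_trans (ler_normc_ReIm _) (lerD h1 h2).
have E0 : E N.+1 0 = 0.
  rewrite /E mul0r cexp0 /cexp_sum big_ord_recl big1 ?expr0 ?mulr1 ?invr1 ?addr0 ?subrr//.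
  by move=> i _; rewrite exprS mul0r mulr0.
have z0 : 0 <= M * (K * 0) ^+ N.+1 / N.+1`!%:R by rewrite mulr0 exprS mul0r mulr0 mul0r.
have key (g g' : R -> R) : (forall t : R, is_derive t (1 : R) g (g' t)) -> g 0 = 0 ->
    (forall t, `|g' t| <= normc (z * E N t)) ->
    `|g r| <= M * (K * r) ^+ N.+1 / N.+1`!%:R.
  move=> dg g0 gb; rewrite ler_norml; apply/andP; split.
    rewrite lerNl; apply: (le_of_derive (g := fun t => - g t) (g' := fun t => - g' t) _ dG) => //.
    - by rewrite g0 oppr0.
    - move=> t t01; apply: le_trans (bz _ t01).
      by rewrite (le_trans _ (gb t))// -normrN ler_norm.
  apply: (le_of_derive dg dG) => //; first by rewrite g0.
  move=> t t01; apply: le_trans (bz _ t01).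
  by rewrite (le_trans _ (gb t))// ler_norm.
split.
- apply: (key (fun t => cRe (E N.+1 t)) (fun t => cRe (z * E N t))) => [t||t]; first by have [] := dE N t.
  + by rewrite E0.
  + exact: ler_Re_normc.
- apply: (key (fun t => cIm (E N.+1 t)) (fun t => cIm (z * E N t))) => [t||t]; first by have [] := dE N t.
  + by rewrite E0.
  + exact: ler_Im_normc.
Qed.

Lemma cexp_sum_cvg : (fun N => cRe (cexp_sum N z)) @ \oo --> cRe (cexp z) /\
  (fun N => cIm (cexp_sum N z)) @ \oo --> cIm (cexp z).
Proof.
have c0 : (fun N => M * exp_coeff K N) @ \oo --> (0 : R).
  rewrite -(mulr0 M); apply: cvgM; first exact: cvg_cst.
  exact: cvg_exp_coeff.
have EE N : E N 1 = cexp z - cexp_sum N z by rewrite /E mul1r.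
have b N : M * (K * 1) ^+ N / N`!%:R = M * exp_coeff K N.
  by rewrite exp_coeffE mulr1; ring.
have key (f : nat -> R) (l : R) : (forall N, `|l - f N| <= M * exp_coeff K N) -> f @ \oo --> l.
  move=> fl; apply/cvgrPdist_le => e e0; have /cvgrPdist_le /(_ _ e0) := c0.
  apply: filterS => N; rewrite sub0r normrN => h.
  exact: le_trans (fl N) (le_trans (ler_norm _) h).
have i01 : 0 <= (1 : R) <= 1 by rewrite ler01 lexx.
split; apply: key => N; have [h1 h2] := bE N i01; move: h1 h2; rewrite EE b.
- by rewrite ReD ReN.
- by rewrite ImD ImN.
Qed.

End remainder.
End complex_exponential.

Section bounded_measurable.
Context d (T : measurableType d) (R : realType).
Implicit Types (f g : T -> R[i]).

Definition cmeasurable f : Prop :=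
  measurable_fun setT (fun x => cRe (f x)) /\ measurable_fun setT (fun x => cIm (f x)).

Lemma cmeasurable_cst (a : R[i]) : cmeasurable (fun=> a).
Proof. by split; exact: measurable_cst. Qed.

Lemma cmeasurable_Complex (k l : T -> R) : measurable_fun setT k -> measurable_fun setT l ->
  cmeasurable (fun x => Complex (k x) (l x)).
Proof. by []. Qed.

Lemma cmeasurableD f g : cmeasurable f -> cmeasurable g -> cmeasurable (fun x => f x + g x).
Proof.
move=> [f1 f2] [g1 g2]; split.
- by under eq_fun do rewrite ReD; exact: measurable_funD.
- by under eq_fun do rewrite ImD; exact: measurable_funD.
Qed.

Lemma cmeasurableM f g : cmeasurable f -> cmeasurable g -> cmeasurable (fun x => f x * g x).
Proof.
move=> [f1 f2] [g1 g2]; split.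
- by under eq_fun do rewrite ReM; apply: measurable_funB; exact: measurable_funM.
- by under eq_fun do rewrite ImM; apply: measurable_funD; exact: measurable_funM.
Qed.

Lemma cmeasurableX f n : cmeasurable f -> cmeasurable (fun x => f x ^+ n).
Proof.
move=> mf; elim: n => [|n IH]; first exact: cmeasurable_cst.
by under eq_fun do rewrite exprS; exact: cmeasurableM.
Qed.

Lemma cmeasurable_cexp f : cmeasurable f -> cmeasurable (fun x => cexp (f x)).
Proof.
have mexp : measurable_fun setT (@expR R : measurableTypeR R -> measurableTypeR R).
  exact: (continuous_measurable_fun (@continuous_expR R)).
have mcos : measurable_fun setT (@cos R : measurableTypeR R -> measurableTypeR R).
  exact: (continuous_measurable_fun (@continuous_cos R)).
have msin : measurable_fun setT (@sin R : measurableTypeR R -> measurableTypeR R).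
  exact: (continuous_measurable_fun (@continuous_sin R)).
move=> [f1 f2]; split; apply: measurable_funM.
- exact: (measurableT_comp mexp).
- exact: (measurableT_comp mcos).
- exact: (measurableT_comp mexp).
- exact: (measurableT_comp msin).
Qed.

End bounded_measurable.

(* [cpairing u phi V] means that the bounded measurable function [phi] satisfies
   [\int u phi = V]. *)
Section pairing.
Context d (T : measurableType d) (R : realType).
Variable mu : {sigma_finite_measure set T -> \bar R}.
Variable u : T -> R.
Hypothesis ui : mu.-integrable setT (EFin \o u).
Implicit Types (f g : T -> R[i]) (V W a : R[i]).

Definition cpairing f V : Prop :=
  [/\ cmeasurable f, exists M, forall x, normc (f x) <= M,
      \int[mu]_x (u x * cRe (f x)) = cRe V & \int[mu]_x (u x * cIm (f x)) = cIm V].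

Lemma cpairing_integrable f V : cpairing f V ->
  mu.-integrable setT (fun x => (u x * cRe (f x))%:E) /\
  mu.-integrable setT (fun x => (u x * cIm (f x))%:E).
Proof.
move=> [[m1 m2] [M fM] _ _]; split.
- exact: (integrableM_bounded ui m1 (fun x => le_trans (ler_Re_normc _) (fM x))).
- exact: (integrableM_bounded ui m2 (fun x => le_trans (ler_Im_normc _) (fM x))).
Qed.

Lemma cpairing0 : cpairing (fun=> 0) 0.
Proof.
split; first exact: cmeasurable_cst.
- by exists 0 => x; rewrite ComplexField.Normc.normc0.
- by under eq_Rintegral do rewrite mulr0; rewrite /Rintegral integral0.
- by under eq_Rintegral do rewrite mulr0; rewrite /Rintegral integral0.
Qed.

Lemma cpairingD f g V W : cpairing f V -> cpairing g W ->
  cpairing (fun x => f x + g x) (V + W).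
Proof.
move=> fV gW; have [f1 f2] := cpairing_integrable fV; have [g1 g2] := cpairing_integrable gW.
have [mf [M fM] fV1 fV2] := fV; have [mg [N gN] gW1 gW2] := gW.
split; first exact: cmeasurableD.
- exists (M + N) => x; exact: le_trans (le_normcD _ _) (lerD (fM x) (gN x)).
- under eq_Rintegral do rewrite ReD mulrDr.
  by rewrite (RintegralD measurableT f1 g1) fV1 gW1 ReD.
- under eq_Rintegral do rewrite ImD mulrDr.
  by rewrite (RintegralD measurableT f2 g2) fV2 gW2 ImD.
Qed.

Lemma cpairingZ f V a : cpairing f V -> cpairing (fun x => a * f x) (a * V).
Proof.
move=> fV; have [f1 f2] := cpairing_integrable fV.
have [mf [M fM] fV1 fV2] := fV.
have Z (c : R) (k : T -> R) : mu.-integrable setT (EFin \o k) ->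
    mu.-integrable setT (EFin \o (fun x => c * k x)).
  by move=> ki; exact: (integrableZl measurableT c ki).
split; first by apply: cmeasurableM => //; exact: cmeasurable_cst.
- exists (normc a * M) => x; rewrite ComplexField.Normc.normcM ler_wpM2l//.
  exact: normc_ge0.
- transitivity (\int[mu]_x (cRe a * (u x * cRe (f x)) - cIm a * (u x * cIm (f x)))).
    by apply: eq_Rintegral => x _; rewrite ReM; ring.
  rewrite (RintegralB measurableT (Z _ _ f1) (Z _ _ f2)).
  by rewrite (RintegralZl _ measurableT f1) (RintegralZl _ measurableT f2) fV1 fV2 ReM.
- transitivity (\int[mu]_x (cRe a * (u x * cIm (f x)) + cIm a * (u x * cRe (f x)))).
    by apply: eq_Rintegral => x _; rewrite ImM; ring.
  rewrite (RintegralD measurableT (Z _ _ f2) (Z _ _ f1)).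
  by rewrite (RintegralZl _ measurableT f1) (RintegralZl _ measurableT f2) fV1 fV2 ImM.
Qed.

Lemma cpairing_sum (n : nat) (F : 'I_n -> T -> R[i]) (V : 'I_n -> R[i]) :
  (forall i, cpairing (F i) (V i)) ->
  cpairing (fun x => \sum_(i < n) F i x) (\sum_(i < n) V i).
Proof.
elim: n F V => [|n IH] F V FV.
  by rewrite big_ord0; under eq_fun do rewrite big_ord0; exact: cpairing0.
rewrite big_ord_recl; under eq_fun do rewrite big_ord_recl.
by apply: cpairingD => //; exact: IH.
Qed.

Lemma cpairing_cvg (F : (T -> R[i])^nat) f V M : (forall n, cpairing (F n) V) ->
  (forall n x, normc (F n x) <= M) ->
  (forall x, (fun n => cRe (F n x)) @ \oo --> cRe (f x)) ->
  (forall x, (fun n => cIm (F n x)) @ \oo --> cIm (f x)) -> cpairing f V.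
Proof.
move=> FV FM F1 F2.
have mF n : cmeasurable (F n) by case: (FV n).
have limM (k_ : T -> R^nat) (k : T -> R) : (forall n, measurable_fun setT (fun x => k_ x n)) ->
    (forall x, k_ x @ \oo --> k x) -> measurable_fun setT k.
  by move=> mk kk; apply: (measurable_fun_cvg (h := fun n x => k_ x n)).
have RM n x : `|cRe (F n x)| <= M := le_trans (ler_Re_normc _) (FM n x).
have IM n x : `|cIm (F n x)| <= M := le_trans (ler_Im_normc _) (FM n x).
split.
- by split; [exact: limM (fun n => (mF n).1) F1|exact: limM (fun n => (mF n).2) F2].
- exists (M + M) => x; apply: le_trans (ler_normc_ReIm _) _; apply: lerD.
  + have c : (fun n => `|cRe (F n x)|) @ \oo --> `|cRe (f x)| by exact: cvg_norm.
    by rewrite -(cvg_lim _ c)//; apply: limr_le; [by apply/cvg_ex; eexists; exact: c|exact: nearW].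
  + have c : (fun n => `|cIm (F n x)|) @ \oo --> `|cIm (f x)| by exact: cvg_norm.
    by rewrite -(cvg_lim _ c)//; apply: limr_le; [by apply/cvg_ex; eexists; exact: c|exact: nearW].
- apply: (Rintegral_bounded_cvg ui (fun n => (mF n).1) RM F1) => n.
  by case: (FV n).
- apply: (Rintegral_bounded_cvg ui (fun n => (mF n).2) IM F2) => n.
  by case: (FV n).
Qed.

End pairing.

Section characters.
Variable R : realType.

Definition cis (x : R) : R[i] := cexp (Complex 0 x).

Lemma cisE x : cis x = Complex (cos x) (sin x).
Proof. by rewrite /cis /cexp /= expR0 !mul1r. Qed.

Lemma cisD x y : cis (x + y) = cis x * cis y.
Proof. by rewrite /cis -cexpD; congr cexp; apply: complex_eqP => /=; rewrite ?addr0. Qed.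

Lemma cis0 : cis 0 = 1. Proof. exact: cexp0. Qed.

Lemma cisX x n : cis x ^+ n = cis (n%:R * x).
Proof.
elim: n => [|n IH]; first by rewrite mul0r cis0.
by rewrite exprS IH -cisD; congr cis; rewrite -[in RHS]natr1 mulrDl mul1r addrC.
Qed.

Lemma normc_cis x : normc (cis x) = 1.
Proof. by rewrite /cis normc_cexp /= expR0. Qed.

Lemma cis_period x n : cis (x + 2 * pi * n%:R) = cis x.
Proof.
have -> : 2 * pi * n%:R = pi *+ 2 *+ n :> R by rewrite mulr_natl mulr_natr.
by rewrite !cisE (periodicn (@cosD2pi R)) (periodicn (@sinD2pi R)).
Qed.

End characters.

Section orthogonality.
Variable R : realType.
Local Notation mR := (measurableTypeR R).
Local Notation leb := (@lebesgue_measure R).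
Variables (lam : R) (lam0 : 0 < lam).
Local Notation L := (2 * pi / lam).
Local Notation I := (`]0%R, L]%classic : set mR).

Let L0 : 0 < L.
Proof. by rewrite divr_gt0 ?mulr_gt0 ?pi_gt0. Qed.

Lemma Rintegral_indicE (f : mR -> R) :
  \int[leb]_s (\1_I s * f s) = \int[leb]_(s in I) f s.
Proof.
rewrite /Rintegral [in RHS]integral_mkcond; congr fine.
apply: eq_integral => s _; rewrite patchE indicE.
by case: ifPn => _ /=; rewrite ?mul1r ?mul0r.
Qed.

Let cosI (c : R) : c != 0 -> sin (c * L) = 0 -> \int[leb]_(s in I) cos (c * s) = 0.
Proof.
move=> c0 sc.
have d (x : R) : is_derive x (1 : R) (fun x => c^-1 * sin (c * x)) (cos (c * x)).
  apply: (is_derive_eq (is_deriveZ_fun _ (is_derive_comp_fun (is_derive_sin _) (is_derive_mulc c x)))).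
  by rewrite mulrCA mulVf// mulr1.
rewrite (Rintegral_FTC2 L0 _ d) ?mulr0 ?sin0 ?sc ?mulr0 ?subr0//.
move=> x; apply: (continuous_comp (f := fun x => c * x)); last exact: continuous_cos.
exact: mulrl_continuous.
Qed.

Let sinI (c : R) : c != 0 -> cos (c * L) = 1 -> \int[leb]_(s in I) sin (c * s) = 0.
Proof.
move=> c0 sc.
have d (x : R) : is_derive x (1 : R) (fun x => - c^-1 * cos (c * x)) (sin (c * x)).
  apply: (is_derive_eq (is_deriveZ_fun _ (is_derive_comp_fun (is_derive_cos _) (is_derive_mulc c x)))).
  by rewrite mulNr mulNr mulrN opprK mulrCA mulVf// mulr1.
rewrite (Rintegral_FTC2 L0 _ d) ?mulr0 ?cos0 ?sc ?mulr1 ?subrr//.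
move=> x; apply: (continuous_comp (f := fun x => c * x)); last exact: continuous_sin.
exact: mulrl_continuous.
Qed.

Lemma integrable_indic_period : leb.-integrable setT (EFin \o (\1_I : mR -> R)).
Proof.
apply: integrable_indic_lty; first exact: measurable_itv.
by rewrite /= lebesgue_measure_itv /= lte_fin L0 oppr0 adde0 ltry.
Qed.

Lemma cis_orthogonality (m k : nat) :
  cpairing leb (\1_I) (fun s : mR => cis (m%:R * (s * lam)) * cis (- (k%:R * (s * lam))))
    (if m == k then L%:C else 0).
Proof.
have l0 : lam != 0 by rewrite gt_eqF.
have mc (c : R) : cmeasurable (fun s : mR => cis (c * (s * lam))).
  apply: cmeasurable_cexp; apply: cmeasurable_Complex; first exact: measurable_cst.
  by apply: measurable_funM => //; exact: measurable_funM.
have lebI : fine (leb I) = L by rewrite lebesgue_measure_itv /= lte_fin L0 oppr0 adde0.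
have E s : cis (m%:R * (s * lam)) * cis (- (k%:R * (s * lam))) =
    cis ((m%:R - k%:R) * lam * s).
  by rewrite -cisD; congr cis; ring.
have cL (c : R) : cos (c * L) = cRe (cis (c * L)) by rewrite cisE.
have sL (c : R) : sin (c * L) = cIm (cis (c * L)) by rewrite cisE.
have per : m != k -> cis ((m%:R - k%:R) * lam * L) = 1.
  move=> mk; have -> : (m%:R - k%:R) * lam * L = 2 * pi * (m%:R - k%:R) by field.
  have [km|km] := leqP k m.
    by rewrite -natrB// -[X in cis X]add0r cis_period cis0.
  rewrite -[LHS](cis_period _ (k - m)) natrB; last exact: ltnW.
  by rewrite -mulrDr addrC subrKA subrr mulr0 cis0.
have c0 : m != k -> (m%:R - k%:R) * lam != 0.
  by move=> mk; rewrite mulf_neq0// subr_eq0 eqr_nat.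
split.
- by apply: cmeasurableM => //; under eq_fun do rewrite -mulNr.
- by exists 1 => s; rewrite ComplexField.Normc.normcM !normc_cis mulr1.
- rewrite Rintegral_indicE; under eq_Rintegral do rewrite E cisE /=.
  have [->|mk] := eqVneq m k; last by rewrite cosI ?c0// sL per.
  under eq_Rintegral do rewrite subrr !mul0r cos0.
  by rewrite Rintegral_cst ?mul1r ?lebI//; exact: measurable_itv.
- rewrite Rintegral_indicE; under eq_Rintegral do rewrite E cisE /=.
  have [->|mk] := eqVneq m k; last by rewrite sinI ?c0// cL per.
  under eq_Rintegral do rewrite subrr !mul0r sin0.
  by rewrite Rintegral_cst ?mul0r//; exact: measurable_itv.
Qed.

End orthogonality.

Section gaussian_monomials.
Variable R : realType.
Local Notation mR := (measurableTypeR R).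
Local Notation H := (mR * mR * mR)%type.
Implicit Types (q : H) (tau : R).

Definition zc q : R[i] := Complex q.1.1 q.1.2.
Definition zsqr q : R := q.1.1 ^+ 2 + q.1.2 ^+ 2.

Definition gmono tau (j : nat) q : R[i] :=
  cexp (Complex (- (tau / 4 * zsqr q)) (tau * q.2)) * zc q ^+ j.

Lemma cmeasurable_zc : cmeasurable zc.
Proof. by apply: cmeasurable_Complex; [exact: measurable_H11|exact: measurable_H12]. Qed.

Lemma measurable_zsqr : measurable_fun setT zsqr.
Proof.
by apply: measurable_funD; apply: measurable_funX; [exact: measurable_H11|exact: measurable_H12].
Qed.

Lemma zsqr_ge0 q : 0 <= zsqr q.
Proof. by rewrite addr_ge0 ?sqr_ge0. Qed.

Lemma normc_zc q : normc (zc q) ^+ 2 = zsqr q.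
Proof. by rewrite /= sqr_sqrtr// zsqr_ge0. Qed.

Lemma cmeasurable_gmono tau j : cmeasurable (gmono tau j).
Proof.
apply: cmeasurableM; last by apply: cmeasurableX; exact: cmeasurable_zc.
apply: cmeasurable_cexp; apply: cmeasurable_Complex.
- apply: measurableT_comp => //; apply: measurable_funM => //; exact: measurable_zsqr.
- by apply: measurable_funM => //; exact: measurable_H2.
Qed.

Lemma normc_gmono_le tau0 tau j q : 0 < tau0 -> tau0 <= tau ->
  normc (gmono tau j q) <= 1 + j`!%:R * (4 / tau0) ^+ j.
Proof.
move=> t0 t; rewrite ComplexField.Normc.normcM normc_cexp /= normcX.
have x0 := normc_ge0 (zc q); set x := normc (zc q) in x0 *.
have xj : x ^+ j <= 1 + zsqr q ^+ j.
  rewrite -normc_zc -/x; have [x1|x1] := leP x 1.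
    by rewrite (le_trans (exprn_ile1 _ x0 x1))// lerDl exprn_ge0// exprn_ge0.
  rewrite -exprM -[leLHS]add0r lerD// ler_weXn2l ?ltW//.
  by rewrite mul2n -addnn leq_addr.
have z0 := zsqr_ge0 q; set s := zsqr q in xj z0 *.
pose y := tau0 / 4 * s.
have y0 : 0 <= y by rewrite mulr_ge0 ?divr_ge0// ltW.
have ey : expR (- (tau / 4 * s)) <= expR (- y).
  by rewrite ler_expR lerN2 ler_wpM2r// ler_pM2r.
apply: le_trans (ler_pM (expR_ge0 _) (exprn_ge0 _ x0) ey xj) _.
rewrite mulrDr mulr1 lerD//; first by rewrite -(expR0 R) ler_expR oppr_le0.
have yj : y ^+ j <= j`!%:R * expR y.
  case: j {xj} => [|j]; first by rewrite expr0 mul1r -(expR0 R) ler_expR.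
  rewrite -ler_pdivrMl ?ltr0n ?fact_gt0// mulrC.
  by rewrite (le_trans _ (expR_ge1Dxn j y0))// lerDr.
have -> : s ^+ j = (4 / tau0) ^+ j * y ^+ j.
  by rewrite -exprMn /y; congr (_ ^+ _); field; rewrite gt_eqF.
rewrite mulrCA [leRHS]mulrC ler_wpM2l//; first by rewrite exprn_ge0// divr_ge0// ltW.
by rewrite expRN ler_pdivrMl ?expR_gt0// mulrC.
Qed.

End gaussian_monomials.

(* The generalized Laguerre polynomial L_j^(k). *)
Definition laguerre (R : realType) (j k : nat) (x : R) : R :=
  \sum_(m < j.+1) (-1) ^+ m * 'C(j + k, m + k)%:R / m`!%:R * x ^+ m.

Section adjoint_gmono.
Variable R : realType.
Variables (eps : R) (lam : {posnum R}) (j k : nat).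
Local Notation mR := (measurableTypeR R).
Local Notation H := (mR * mR * mR)%type.
Local Notation leb := (@lebesgue_measure R).
Local Notation r := (lam%:num^-1).
Local Notation L := (2 * pi / lam%:num).
Local Notation I := (`]0%R, L]%classic : set mR).
Local Notation tau := (2 * k%:R / (r ^+ 2 + 2 * eps ^+ 2)).
Local Notation n := (j + k)%N.
Hypothesis k0 : (0 < k)%N.

Let r0 : 0 < r. Proof. by rewrite invr_gt0. Qed.
Let den0 : 0 < r ^+ 2 + 2 * eps ^+ 2.
Proof. by rewrite ltr_wpDr ?exprn_gt0// mulr_ge0 ?sqr_ge0. Qed.

Let e (s : R) := cis (s * lam%:num).
Let e' (s : R) := cis (- (s * lam%:num)).

Let gmono_geodesic q s : gmono tau n (hmul q (hinv (geodesic eps lam%:num s))) =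
  cexp (Complex (- (tau / 4 * zsqr q)) (tau * q.2)) * (expR (- (tau / 4 * r ^+ 2)))%:C *
  ((zc q - r%:C * e s) ^+ n * cexp ((tau / 2 * r)%:C * zc q * e' s) * e' s ^+ k).
Proof.
have ln0 : lam%:num != 0 by rewrite gt_eqF.
have D0 : r ^+ 2 + 2 * eps ^+ 2 != 0 by rewrite gt_eqF.
have gE : geodesic eps lam%:num s = (r * cos (s * lam%:num), r * sin (s * lam%:num),
    s * ((r ^+ 2 + 2 * eps ^+ 2) / (2 * r))) by rewrite /geodesic invrK.
move: D0 gE; set D := r ^+ 2 + 2 * eps ^+ 2 => D0 gE.
have eE : e s = Complex (cos (s * lam%:num)) (sin (s * lam%:num)) by rewrite /e cisE.
have e'E : e' s = Complex (cos (s * lam%:num)) (- sin (s * lam%:num)).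
  by rewrite /e' cisE cosN sinN.
rewrite /gmono; have -> : zc (hmul q (hinv (geodesic eps lam%:num s))) = zc q - r%:C * e s.
  rewrite eE hmulE gE /hinv /zc /=.
  by apply: complex_eqP; rewrite ?ReD ?ImD ?ReN ?ImN ?ReM ?ImM /=; ring.
rewrite [e' s ^+ k]cisX -cexp_real.
rewrite [_ ^+ n * _]mulrC -!mulrA [_ ^+ n * cexp _]mulrC !mulrA -!cexpD; congr (cexp _ * _).
have cs := cos2Dsin2 (s * lam%:num).
rewrite e'E hmulE gE /hinv /zc /zsqr [fst _]/= [snd _]/=.
set c := cos _ in cs *; set d := sin _ in cs *.
apply: complex_eqP; rewrite ?ReD ?ImD ?ReM ?ImM /=; last by field; rewrite ln0 D0.
apply/eqP; rewrite -subr_eq0; set E := (X in X == 0).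
have -> : E = - (2 * k%:R / D / 4 * r ^+ 2) * (c ^+ 2 + d ^+ 2 - 1).
  by rewrite /E; field; rewrite ln0 D0.
by rewrite cs subrr mulr0.
Qed.

(* After expanding the binomial and the exponential in powers of [e s] and
   [e' s = (e s)^-1], only the terms of total degree 0 survive the average. *)
Let truncated_average q N :
  cpairing leb (\1_I)
    (fun s : mR => (zc q - r%:C * e s) ^+ n *
      cexp_sum (N + j.+1) ((tau / 2 * r)%:C * zc q * e' s) * e' s ^+ k)
    ((L * (- r) ^+ k * laguerre j k (tau / 2 * r ^+ 2))%:C * zc q ^+ j).
Proof.
move: (zc q) => w; set v := (tau / 2 * r)%:C * w.
pose co (i m : nat) : R[i] := (w ^+ (n - i) * (- r)%:C ^+ i *+ 'C(n, i)) * ((m`!%:R)^-1%:C * v ^+ m).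
have Efun (s : mR) : (w - r%:C * e s) ^+ n * cexp_sum (N + j.+1) (v * e' s) * e' s ^+ k =
    \sum_(i < n.+1) \sum_(m < N + j.+1)
      co i m * (cis (i%:R * (s * lam%:num)) * cis (- ((m + k)%:R * (s * lam%:num)))).
  rewrite -mulNr -rmorphN exprDn /cexp_sum big_distrlr /= big_distrl /=; apply: eq_bigr => i _.
  rewrite big_distrl /=; apply: eq_bigr => m _.
  rewrite /co exprMn [(v * e' s) ^+ m]exprMn -cisX -mulrN -[cis ((m + k)%:R * _)]cisX exprD.
  rewrite -/(e s) -/(e' s) -[in LHS](mulr_natr _ 'C(n, i)) -[in RHS](mulr_natr _ 'C(n, i)).
  move: (w ^+ _) (_ ^+ i) (e s ^+ i) ('C(n, i)%:R) ((m`!%:R)^-1%:C) (v ^+ m).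
  by move: (e' s ^+ m) (e' s ^+ k) => x1 x2 x3 x4 x5 x6 x7 x8; ring.
rewrite (funext Efun).
have -> : (L * (- r) ^+ k * laguerre j k (tau / 2 * r ^+ 2))%:C * w ^+ j =
    \sum_(i < n.+1) \sum_(m < N + j.+1) co i m * (if i == (m + k)%N :> nat then L%:C else 0).
  rewrite exchange_big /= /laguerre.
  have inner m : \sum_(i < n.+1) co i m * (if i == (m + k)%N :> nat then L%:C else 0) =
      if (m < j.+1)%N then co (m + k)%N m * L%:C else 0.
    case: ifPn => mj.
      have mk : (m + k < n.+1)%N by rewrite ltnS leq_add2r -ltnS.
      rewrite (bigD1 (Ordinal mk)) //= eqxx big1 ?addr0// => i ik.
      by case: ifPn => [/eqP h|]; rewrite ?mulr0//; case/eqP: ik; exact: val_inj.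
    apply: big1 => i _; case: ifPn => [/eqP h|]; rewrite ?mulr0//.
    by move: (ltn_ord i); rewrite h ltnS leq_add2r -ltnS (negbTE mj).
  under eq_bigr do rewrite inner.
  rewrite -big_mkcond /= -(big_ord_widen _ (fun m => co (m + k)%N m * L%:C)) ?leq_addl//.
  rewrite rmorphM rmorph_sum /= mulr_sumr mulr_suml; apply: eq_bigr => m _.
  have mj : (m <= j)%N by rewrite -ltnS.
  rewrite /co /v subnDr; have -> : w ^+ j = w ^+ (j - m) * w ^+ m by rewrite -exprD subnK.
  move: (w ^+ (j - m)) => w1.
  rewrite [((tau / 2 * r)%:C * w) ^+ m]exprMn -[in RHS](mulr_natr _ 'C(n, m + k)) exprD.
  move: (w ^+ m) => w2.
  have -> : 'C(n, m + k)%:R = ('C(n, m + k)%:R)%:C :> R[i] by rewrite rmorph_nat.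
  rewrite -!rmorphXn /=.
  have -> : (- r) ^+ m = (-1) ^+ m * r ^+ m by rewrite -exprMn mulN1r.
  have -> : (tau / 2 * r ^+ 2) ^+ m = (tau / 2 * r) ^+ m * r ^+ m.
    by rewrite -exprMn; congr (_ ^+ _); ring.
  move: ((tau / 2 * r) ^+ m) (r ^+ m) ((- r) ^+ k) L ('C(n, m + k)%:R) ((m`!)%:R^-1) ((-1) ^+ m).
  by move=> y1 y2 y3 y4 y5 y6 y7; rewrite !rmorphM /=; ring.
have l0 : 0 < lam%:num by [].
have ii := integrable_indic_period l0.
apply: (cpairing_sum ii) => i; apply: (cpairing_sum ii) => m.
by apply: (cpairingZ ii); exact: cis_orthogonality.
Qed.

Let cst := expR (- (tau / 4 * r ^+ 2)) * (L * (- r) ^+ k).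

Lemma average_gmono q :
  cpairing leb (\1_I) (fun s : mR => gmono tau n (hmul q (hinv (geodesic eps lam%:num s))))
    ((cst * laguerre j k (tau / 2 * r ^+ 2))%:C * gmono tau j q).
Proof.
have l0 : 0 < lam%:num by [].
have ii := integrable_indic_period l0.
rewrite (funext (gmono_geodesic q)).
have -> : (cst * laguerre j k (tau / 2 * r ^+ 2))%:C * gmono tau j q =
    cexp (Complex (- (tau / 4 * zsqr q)) (tau * q.2)) * (expR (- (tau / 4 * r ^+ 2)))%:C *
    ((L * (- r) ^+ k * laguerre j k (tau / 2 * r ^+ 2))%:C * zc q ^+ j).
  rewrite /gmono /cst -mulrA rmorphM /=; ring.
apply: (cpairingZ ii); set v := (tau / 2 * r)%:C * zc q.
have c (s : mR) : (fun N => cRe ((zc q - r%:C * e s) ^+ n * cexp_sum (N + j.+1) (v * e' s) * e' s ^+ k))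
    @ \oo --> cRe ((zc q - r%:C * e s) ^+ n * cexp (v * e' s) * e' s ^+ k) /\
  (fun N => cIm ((zc q - r%:C * e s) ^+ n * cexp_sum (N + j.+1) (v * e' s) * e' s ^+ k))
    @ \oo --> cIm ((zc q - r%:C * e s) ^+ n * cexp (v * e' s) * e' s ^+ k).
  have [h1 h2] := cexp_sum_cvg (v * e' s).
  rewrite -(cvg_shiftn j.+1) in h1; rewrite -(cvg_shiftn j.+1) in h2.
  split.
  - under eq_fun do rewrite mulrAC ReM; rewrite mulrAC ReM.
    by apply: cvgB; apply: cvgM => //; exact: cvg_cst.
  - under eq_fun do rewrite mulrAC ImM; rewrite mulrAC ImM.
    by apply: cvgD; apply: cvgM => //; exact: cvg_cst.
apply: (@cpairing_cvg _ _ _ _ _ ii _ _ _ ((normc (zc q) + r) ^+ n * expR (normc v))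
  (truncated_average q)) => [N s|s|s]; last 2 first.
- exact: (c s).1.
- exact: (c s).2.
have e1 : normc (e s) = 1 by exact: normc_cis.
have e'1 : normc (e' s) = 1 by exact: normc_cis.
rewrite !ComplexField.Normc.normcM !normcX e'1 expr1n mulr1 -ComplexField.Normc.normcM -/v.
apply: ler_pM; rewrite ?exprn_ge0 ?normc_ge0//.
- apply: lerXn2r; rewrite ?nnegrE ?normc_ge0//.
    by rewrite addr_ge0 ?normc_ge0// ltW.
  apply: le_trans (le_normcD _ _) _.
  by rewrite normcN ComplexField.Normc.normcM e1 mulr1 normc_real (gtr0_norm r0).
- by apply: le_trans (normc_cexp_sum _ _) _; rewrite ComplexField.Normc.normcM e'1 mulr1.
Qed.

Lemma gmono_annihilated (u : H -> R) (a : H) :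
  (haar R).-integrable setT (EFin \o u) -> xray_null eps lam u ->
  cpairing (haar_sf R) u
    (fun q => (laguerre j k (tau / 2 * r ^+ 2))%:C * gmono tau j (hmul a q)) 0.
Proof.
move=> ui u0.
have tau0 : 0 < tau by rewrite divr_gt0// mulr_gt0// ltr0n.
have cst0 : cst != 0.
  apply: mulf_neq0; first by rewrite gt_eqF// expR_gt0.
  apply: mulf_neq0; first by rewrite gt_eqF// divr_gt0// mulr_gt0// pi_gt0.
  by rewrite expf_neq0// oppr_eq0 gt_eqF.
pose h p := gmono tau n (hmul a p).
have mh : cmeasurable h.
  have ma : measurable_fun setT (hmul a).
    by apply: measurable_hmul => //; exact: measurable_cst.
  have [m1 m2] := cmeasurable_gmono tau n.
  by split; [exact: (measurableT_comp m1 ma)|exact: (measurableT_comp m2 ma)].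
have hM p : normc (h p) <= 1 + n`!%:R * (4 / tau) ^+ n by exact: normc_gmono_le.
have hP z t : h (z, t + period eps lam%:num) = h (z, t).
  have tP b c : tau * (b + (t + period eps lam%:num) + c) = tau * (b + t + c) + 2 * pi * k%:R.
    have D0 : r ^+ 2 + 2 * eps ^+ 2 != 0 by rewrite gt_eqF.
    by rewrite /period; set D := r ^+ 2 + 2 * eps ^+ 2 in D0 *; field.
  rewrite /h /gmono !hmulE /zc /zsqr /= tP; congr (_ * _).
  set x := tau * _; set y := - _.
  have E c : cexp (Complex y c) = (expR y)%:C * cis c.
    by rewrite /cis -cexp_real -cexpD; congr cexp; apply: complex_eqP; rewrite /= ?addr0 ?add0r.
  by rewrite !E cis_period.
have avg q : adjoint_average eps lam (fun p => cRe (h p)) q =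
      cRe ((cst * laguerre j k (tau / 2 * r ^+ 2))%:C * gmono tau j (hmul a q)) /\
    adjoint_average eps lam (fun p => cIm (h p)) q =
      cIm ((cst * laguerre j k (tau / 2 * r ^+ 2))%:C * gmono tau j (hmul a q)).
  have [_ _ <- <-] := average_gmono (hmul a q).
  rewrite !Rintegral_indicE /adjoint_average /h.
  by split; apply: eq_Rintegral => s _; rewrite hmulA.
have p0 : cpairing (haar_sf R) u
    (fun q => (cst * laguerre j k (tau / 2 * r ^+ 2))%:C * gmono tau j (hmul a q)) 0.
  have mg : cmeasurable (fun q => gmono tau j (hmul a q)).
    have ma : measurable_fun setT (hmul a).
      by apply: measurable_hmul => //; exact: measurable_cst.
    have [m1 m2] := cmeasurable_gmono tau j.
    by split; [exact: (measurableT_comp m1 ma)|exact: (measurableT_comp m2 ma)].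
  split.
  - by apply: cmeasurableM => //; exact: cmeasurable_cst.
  - exists (`|cst * laguerre j k (tau / 2 * r ^+ 2)| * (1 + j`!%:R * (4 / tau) ^+ j)) => q.
    by rewrite ComplexField.Normc.normcM normc_real ler_wpM2l// normc_gmono_le.
  - have hR p : `|cRe (h p)| <= 1 + n`!%:R * (4 / tau) ^+ n := le_trans (ler_Re_normc _) (hM p).
    rewrite -[RHS](annihilate ui u0 mh.1 hR (fun z t => congr1 cRe (hP z t))).
    by apply: eq_Rintegral => q _; rewrite (avg q).1.
  - have hI p : `|cIm (h p)| <= 1 + n`!%:R * (4 / tau) ^+ n := le_trans (ler_Im_normc _) (hM p).
    rewrite -[RHS](annihilate ui u0 mh.2 hI (fun z t => congr1 cIm (hP z t))).
    by apply: eq_Rintegral => q _; rewrite (avg q).2.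
have uis : (haar_sf R).-integrable setT (EFin \o u) := ui.
have := cpairingZ uis (cst^-1)%:C p0; rewrite mulr0; congr cpairing.
by apply/funext => q; rewrite mulrA -rmorphM mulKf.
Qed.

End adjoint_gmono.

Section laguerre_nonzero.
Variable R : realType.

Lemma laguerre_poly (c : R) (j k : nat) :
  laguerre j k (k%:R - c) = (\sum_(m < j.+1) ((-1) ^+ m / m`!%:R / (j - m)`!%:R) *:
    (('X - c%:P) ^+ m * \prod_(i < j - m) ('X + (j - i)%:R%:P))).[k%:R].
Proof.
rewrite horner_sum; apply: eq_bigr => m _.
have mj : (m <= j)%N by rewrite -ltnS.
rewrite hornerZ hornerM horner_exp hornerXsubC horner_prod.
have -> : \prod_(i < j - m) ('X + (j - i)%:R%:P).[k%:R] = ((j + k) ^_ (j - m))%:R :> R.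
  rewrite ffact_prod natr_prod; apply: eq_bigr => i _.
  rewrite hornerD hornerX hornerC -natrD addnBA; last by rewrite (leq_trans (ltnW (ltn_ord i)))// leq_subr.
  by rewrite addnC.
rewrite -bin_sub; last by rewrite leq_add2r.
rewrite subnDr -bin_ffact natrM; field.
by rewrite !pnatr_eq0 -!lt0n !fact_gt0.
Qed.

(* As a polynomial in [k], the left-hand side is nonzero: at [k = c] only the
   term [m = 0] is left, and it is a product of positive factors. *)
Lemma laguerre_neq0 (c : R) (j k0 : nat) : 0 < c ->
  exists2 k, (k0 <= k)%N & laguerre j k (k%:R - c) != 0.
Proof.
move=> c0.
set p := \sum_(m < j.+1) ((-1) ^+ m / m`!%:R / (j - m)`!%:R) *:
    (('X - c%:P) ^+ m * \prod_(i < j - m) ('X + (j - i)%:R%:P)) : {poly R}.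
have pc : p.[c] != 0.
  rewrite /p horner_sum big_ord_recl [X in _ + X]big1 ?addr0 => [|i _]; last first.
    by rewrite hornerZ hornerM horner_exp hornerXsubC subrr expr0n /= mul0r mulr0.
  rewrite hornerZ hornerM expr0 hornerC mul1r horner_prod !mulf_neq0 ?invr_eq0 ?pnatr_eq0 -?lt0n ?fact_gt0//.
  rewrite prodf_seq_neq0; apply/allP => i _ /=.
  by rewrite hornerD hornerX hornerC gt_eqF// ltr_wpDr.
have p0 : p != 0 by apply: contraNneq pc => ->; rewrite horner0.
pose s : seq R := [seq (k0 + i)%:R | i <- iota 0 (size p)].
have us : uniq s.
  rewrite map_inj_uniq ?iota_uniq// => i i' /eqP; rewrite eqr_nat eqn_add2l.
  by move/eqP.
have : ~~ all (root p) s.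
  apply/negP => rs; have := max_poly_roots p0 rs us.
  by rewrite size_map size_iota ltnn.
move/allPn => [_ /mapP[i _ ->] nr]; exists (k0 + i)%N; first exact: leq_addr.
by rewrite laguerre_poly.
Qed.

End laguerre_nonzero.

Lemma ae_dense (R : realType) (P : measurableTypeR R -> Prop) (a b : R) : a < b ->
  {ae (@lebesgue_measure R), forall l, P l} -> exists2 l : R, a < l < b & P l.
Proof.
move=> ab [N [mN N0 PN]]; apply: contrapT => nP.
have sub : (`]a, b[%classic : set R) `<=` N.
  move=> l /= lab; apply: PN => /= Pl; apply: nP.
  by exists l => //; move: lab; rewrite in_itv.
have : (lebesgue_measure (`]a, b[%classic : set R) <= lebesgue_measure N)%E.
  by apply: le_measure => //; rewrite inE//; exact: measurable_itv.
by rewrite N0 lebesgue_measure_itv /= lte_fin ab leNgt -EFinB lte_fin subr_gt0 ab.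
Qed.

Section annihilated_monomials.
Variable R : realType.
Variables (eps eta : R).
Hypotheses (eps0 : 0 < eps) (eta0 : 0 < eta).
Local Notation mR := (measurableTypeR R).
Local Notation H := (mR * mR * mR)%type.
Local Notation leb := (@lebesgue_measure R).
Variable u : H -> R.
Hypothesis ui : (haar_sf R).-integrable setT (EFin \o u).
Hypothesis u0 : {ae leb, forall l : mR, forall lam : {posnum R}, lam%:num = l -> l < eta ->
  xray_null eps lam u}.

Let tauk (k : nat) (l : R) := 2 * k%:R / (l^-1 ^+ 2 + 2 * eps ^+ 2).

Let cvg_inv2 (l_ : nat -> R) (l : R) : 0 < l -> l_ @ \oo --> l ->
  (fun n => (l_ n)^-1 ^+ 2) @ \oo --> l^-1 ^+ 2.
Proof.
move=> l0 ll; rewrite expr2; under eq_fun do rewrite expr2.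
by apply: cvgM; apply: cvgV => //; rewrite gt_eqF.
Qed.

Let den0 (l : R) : 0 < l -> 0 < l^-1 ^+ 2 + 2 * eps ^+ 2.
Proof.
by move=> l0; apply: addr_gt0; [rewrite exprn_gt0 ?invr_gt0|rewrite mulr_gt0 ?exprn_gt0].
Qed.

(* The charges are approached from above so that the frequencies are at least
   [tau], which makes the bound of the Gaussians uniform. *)
Lemma gmono_null (tau : R) (j : nat) (a : H) : 0 < tau ->
  cpairing (haar_sf R) u (fun q => gmono tau j (hmul a q)) 0.
Proof.
move=> tau0; have c0 : 0 < tau * eps ^+ 2 by rewrite mulr_gt0// exprn_gt0.
pose k1 := (Num.truncn (tau / 2 * (eta^-1 ^+ 2 + 2 * eps ^+ 2))).+1.
have [k kk1 lag0] := laguerre_neq0 j k1 c0.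
have k0 : (0 < k)%N by exact: leq_trans kk1.
have kR : tau / 2 * (eta^-1 ^+ 2 + 2 * eps ^+ 2) < k%:R.
  by rewrite (lt_le_trans (truncnS_gt _))// ler_nat.
pose r2 := 2 * k%:R / tau - 2 * eps ^+ 2.
have r2eta : eta^-1 ^+ 2 < r2.
  rewrite /r2 ltrBrDr -(ltr_pM2l (_ : 0 < tau / 2)) ?divr_gt0//.
  by rewrite (lt_le_trans kR)// le_eqVlt; apply/orP; left; apply/eqP; field; rewrite gt_eqF.
have r20 : 0 < r2 by rewrite (le_lt_trans _ r2eta)// sqr_ge0.
pose l := (Num.sqrt r2)^-1.
have l0 : 0 < l by rewrite invr_gt0 sqrtr_gt0.
have l2 : l^-1 ^+ 2 = r2 by rewrite invrK sqr_sqrtr// ltW.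
have leta : l < eta.
  rewrite -[eta]invrK ltf_pV2 ?posrE ?sqrtr_gt0 ?invr_gt0//.
  rewrite -(@ltr_pXn2r _ 2) ?nnegrE ?sqrtr_ge0 ?invr_ge0 ?ltW//.
  by rewrite sqr_sqrtr// ltW.
have taul : tauk k l = tau.
  rewrite /tauk l2 /r2 subrK; field.
  by rewrite gt_eqF// gt_eqF// ltr0n.
have xl : tau / 2 * l^-1 ^+ 2 = k%:R - tau * eps ^+ 2.
  by rewrite l2 /r2; field; rewrite gt_eqF.
have ex n : exists x : R, l < x < l + (eta - l) / n.+1%:R /\
    forall lam : {posnum R}, lam%:num = x -> x < eta -> xray_null eps lam u.
  have d0 : l < l + (eta - l) / n.+1%:R by rewrite ltrDl divr_gt0// subr_gt0.
  by have [x lx Px] := ae_dense d0 u0; exists x.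
have [l_ l_P] := choice ex.
have l_0 n : 0 < l_ n by have [/andP[h _] _] := l_P n; exact: lt_trans h.
have l_eta n : l_ n < eta.
  have [/andP[_ h] _] := l_P n; apply: lt_le_trans h _.
  by rewrite -lerBrDl ler_pdivrMr// ler_peMr ?ler1n// subr_ge0 ltW.
have cl : l_ @ \oo --> l.
  have h : (fun n => l + (eta - l) / n.+1%:R) @ \oo --> l.
    rewrite -[X in _ --> X]addr0 -(mulr0 (eta - l)).
    apply: cvgD; first exact: cvg_cst.
    by apply: cvgM; [exact: cvg_cst|exact: cvg_harmonic].
  apply: (squeeze_cvgr _ (cvg_cst l) h); apply: nearW => n.
  by have [/andP[h1 h2] _] := l_P n; rewrite !ltW.
pose T n := tauk k (l_ n).
pose Lg n := laguerre j k (T n / 2 * (l_ n)^-1 ^+ 2).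
have cT : T @ \oo --> tau.
  rewrite -taul; apply: cvgM; first exact: cvg_cst.
  apply: cvgV; first by rewrite gt_eqF ?den0.
  by apply: cvgD; [exact: cvg_inv2|exact: cvg_cst].
have Ttau n : tau <= T n.
  rewrite -taul /T /tauk ler_pM2l ?mulr_gt0 ?ltr0n// lef_pV2 ?posrE.
  - rewrite lerD2r lerXn2r ?nnegrE ?invr_ge0 ?(ltW l0) ?(ltW (l_0 n))//.
    by rewrite lef_pV2 ?posrE// ltW//; have [/andP[]] := l_P n.
  - exact: den0.
  - exact: den0.
have cLg : Lg @ \oo --> laguerre j k (k%:R - tau * eps ^+ 2).
  rewrite -xl; have cx : (fun n => T n / 2 * (l_ n)^-1 ^+ 2) @ \oo --> tau / 2 * l^-1 ^+ 2.
    by apply: cvgM; [apply: cvgM => //; exact: cvg_cst|exact: cvg_inv2].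
  have cl_ : continuous (laguerre j k : R -> R).
    rewrite (_ : laguerre j k = horner (\sum_(m < j.+1)
      ((-1) ^+ m * 'C(j + k, m + k)%:R / m`!%:R) *: 'X^m)); first exact: continuous_horner.
    apply/funext => x; rewrite horner_sum; apply: eq_bigr => m _.
    by rewrite hornerZ hornerXn.
  exact: (cvg_comp _ _ cx (cl_ _)).
have [M [_ /(_ (M + 1)) MLg]] := cvg_seq_bounded (cvgP _ cLg).
have p n : cpairing (haar_sf R) u (fun q => (Lg n)%:C * gmono (T n) j (hmul a q)) 0.
  have [_ /(_ (PosNum (l_0 n)) erefl (l_eta n)) un] := l_P n.
  exact: (gmono_annihilated (lam := PosNum (l_0 n)) j k0 a ui un).
pose cc (f : nat -> R[i]) (z : R[i]) := ((fun n => cRe (f n)) @ \oo --> cRe z) /\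
  ((fun n => cIm (f n)) @ \oo --> cIm z).
have ccM (f g : nat -> R[i]) (z w : R[i]) : cc f z -> cc g w -> cc (fun n => f n * g n) (z * w).
  move=> [f1 f2] [g1 g2]; split.
  - by under eq_fun do rewrite ReM; rewrite ReM; apply: cvgB; exact: cvgM.
  - by under eq_fun do rewrite ImM; rewrite ImM; apply: cvgD; exact: cvgM.
have cF q : cc (fun n => (Lg n)%:C * gmono (T n) j (hmul a q))
    ((laguerre j k (k%:R - tau * eps ^+ 2))%:C * gmono tau j (hmul a q)).
  apply: (ccM); first by split => //=; exact: cvg_cst.
  apply: (ccM); last by split; exact: cvg_cst.
  have c1 : (fun n => - (T n / 4 * zsqr (hmul a q))) @ \oo --> - (tau / 4 * zsqr (hmul a q)).
    by apply: cvgN; apply: cvgM; [apply: cvgM => //|]; exact: cvg_cst.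
  have c2 : (fun n => T n * (hmul a q).2) @ \oo --> tau * (hmul a q).2.
    by apply: cvgM => //; exact: cvg_cst.
  split => /=; apply: cvgM.
  - exact: (cvg_comp _ _ c1 (@continuous_expR R _)).
  - exact: (cvg_comp _ _ c2 (@continuous_cos R _)).
  - exact: (cvg_comp _ _ c1 (@continuous_expR R _)).
  - exact: (cvg_comp _ _ c2 (@continuous_sin R _)).
have lim : cpairing (haar_sf R) u
    (fun q => (laguerre j k (k%:R - tau * eps ^+ 2))%:C * gmono tau j (hmul a q)) 0.
  apply: (@cpairing_cvg _ _ _ _ _ ui _ _ _ ((M + 1) * (1 + j`!%:R * (4 / tau) ^+ j)) p).
  - move=> n q; rewrite ComplexField.Normc.normcM normc_real; apply: ler_pM => //.
    + exact: normc_ge0.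
    + by apply: MLg => //; rewrite ltrDl.
    + exact: normc_gmono_le.
  - by move=> q; exact: (cF q).1.
  - by move=> q; exact: (cF q).2.
have := cpairingZ ui ((laguerre j k (k%:R - tau * eps ^+ 2))^-1)%:C lim; rewrite mulr0; congr cpairing.
by apply/funext => q; rewrite mulrA -rmorphM mulVf// mul1r.
Qed.

End annihilated_monomials.

Lemma annihilated_gauss d (T : measurableType d) (R : realType)
    (mu : {sigma_finite_measure set T -> \bar R}) (u k : T -> R)
    (X : T -> measurableTypeR R) (sigma : R) :
  mu.-integrable setT (EFin \o u) -> measurable_fun setT k -> (forall q, `|k q| <= 1) ->
  measurable_fun setT X -> 0 < sigma ->
  (forall b, \int[mu]_q (u q * (k q * normal_fun (X q) sigma b)) = 0) ->
  \int[mu]_q (u q * k q) = 0.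
Proof.
move=> ui mk k1 mX s0 h; have sn0 : sigma != 0 by rewrite gt_eqF.
have pE m (x : R) : normal_pdf m sigma x = normal_peak sigma * normal_fun m sigma x.
  by rewrite normal_pdfE.
have p0 := normal_peak_ge0 sigma.
pose K (q : T * measurableTypeR R) : R := k q.1 * normal_pdf (X q.1) sigma q.2.
have mN : measurable_fun setT (fun q : T * measurableTypeR R => normal_fun (X q.1) sigma q.2).
  apply: measurableT_comp => //; apply: measurable_funM => //; apply: measurableT_comp => //.
  apply: measurable_funX; apply: measurable_funB => //.
  exact: (measurableT_comp mX measurable_fst).
have mK : measurable_fun setT K.
  apply: measurable_funM; first exact: (measurableT_comp mk measurable_fst).
  by under eq_fun do rewrite pE; exact: measurable_funM.
pose M := Num.max (normal_peak sigma) 1.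
have A1 q : `|K q| <= M.
  rewrite normrM (ger0_norm (normal_pdf_ge0 _ _ _)) (le_trans (ler_pM _ _ (k1 _) (normal_pdf_ub _ _ sn0)))//.
    exact: normal_pdf_ge0.
  by rewrite mul1r le_max lexx.
have A2 q : (\int[lebesgue_measure]_(s in setT) (`|K (q, s)|)%:E <= M%:E)%E.
  apply: (@le_trans _ _ (\int[lebesgue_measure]_s (normal_pdf (X q) sigma s)%:E)%E).
    apply: ge0_le_integral => //.
    - apply/measurable_EFinP; apply: measurableT_comp => //.
      exact: (measurableT_comp mK (pair1_measurable _)).
    - by apply/measurable_EFinP; exact: measurable_normal_pdf.
    - move=> s _; rewrite lee_fin normrM (ger0_norm (normal_pdf_ge0 _ _ _)).
      by rewrite ler_piMl// normal_pdf_ge0.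
  by rewrite integral_normal_pdf lee_fin le_max lexx orbT.
have kN b q : `|k q * normal_fun (X q) sigma b| <= 1.
  rewrite normrM mulr_ile1// ger0_norm ?normal_fun_ge0// -(expR0 R) ler_expR.
  by rewrite mulNr oppr_le0 divr_ge0// ?sqr_ge0// mulrn_wge0// sqr_ge0.
have A3 s : [set: measurableTypeR R] s -> \int[mu]_q (u q * K (q, s)) = 0.
  move=> _; have mkN : measurable_fun setT (fun q => k q * normal_fun (X q) sigma s).
    by apply: measurable_funM => //; exact: (measurableT_comp mN (pair2_measurable _)).
  have i := integrableM_bounded ui mkN (kN s).
  rewrite -[RHS](mulr0 (normal_peak sigma)) -(h s) -(RintegralZl _ measurableT i).
  by apply: eq_Rintegral => q _; rewrite /K pE /=; ring.
rewrite -[RHS](annihilated_average ui mK measurableT A1 A2 A3).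
apply: eq_Rintegral => q _; congr (_ * _).
have ip := integrable_normal_pdf (X q) sigma.
rewrite /K /= (RintegralZl _ measurableT ip).
by rewrite /Rintegral integral_normal_pdf mulr1.
Qed.

Section gaussian_span.
Variable R : realType.
Local Notation mR := (measurableTypeR R).
Local Notation H := (mR * mR * mR)%type.
Variables (u : H -> R).
Hypothesis ui : (haar_sf R).-integrable setT (EFin \o u).
Hypothesis u0 : forall (tau : R) (j : nat) (a : H), 0 < tau ->
  cpairing (haar_sf R) u (fun q => gmono tau j (hmul a q)) 0.

Let cexp_null (tau : R) (c : R[i]) (a : H) : 0 < tau ->
  cpairing (haar_sf R) u (fun q => cexp (c * zc (hmul a q)) * gmono tau 0 (hmul a q)) 0.
Proof.
move=> tau0.
have pN N : cpairing (haar_sf R) u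
    (fun q => cexp_sum N (c * zc (hmul a q)) * gmono tau 0 (hmul a q)) 0.
  have E q : cexp_sum N (c * zc (hmul a q)) * gmono tau 0 (hmul a q) =
      \sum_(m < N) (((m`!%:R)^-1)%:C * c ^+ m) * gmono tau m (hmul a q).
    rewrite mulr_suml; apply: eq_bigr => m _.
    by rewrite /gmono expr0 mulr1 exprMn; ring.
  rewrite (funext E).
  have p (m : 'I_N) := cpairingZ ui (((m`!%:R)^-1)%:C * c ^+ m) (u0 m a tau0).
  by have := cpairing_sum ui p; rewrite big1// => m _; rewrite mulr0.
apply: (@cpairing_cvg _ _ _ _ _ ui _ _ _ (expR (normc c ^+ 2 / tau)) pN).
- move=> N q; rewrite !ComplexField.Normc.normcM expr0 ComplexField.Normc.normc1 mulr1.
  rewrite normc_cexp /= -normc_zc.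
  apply: le_trans (ler_wpM2r (expR_ge0 _) (normc_cexp_sum _ _)) _.
  rewrite -expRD ler_expR ComplexField.Normc.normcM.
  move: (normc c) (normc (zc _)) => x y.
  have -> : x * y - tau / 4 * y ^+ 2 = x ^+ 2 / tau - (x - tau / 2 * y) ^+ 2 / tau.
    by field; rewrite gt_eqF.
  by rewrite lerBlDr lerDl divr_ge0 ?sqr_ge0// ltW.
- move=> q; have [h1 h2] := cexp_sum_cvg (c * zc (hmul a q)).
  under eq_fun do rewrite ReM; rewrite ReM.
  by apply: cvgB; apply: cvgM => //; exact: cvg_cst.
- move=> q; have [h1 h2] := cexp_sum_cvg (c * zc (hmul a q)).
  under eq_fun do rewrite ImM; rewrite ImM.
  by apply: cvgD; apply: cvgM => //; exact: cvg_cst.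
Qed.

(* The centre [a1 + i a2] and the coefficient [c] are found by matching the
   coefficients of [w] and of its conjugate in the exponents. *)
Let gauss_null (tau x y b1 b2 : R) : 0 < tau ->
  cpairing (haar_sf R) u (fun q => cexp (Complex
    (- (tau / 4 * ((q.1.1 - b1) ^+ 2 + (q.1.2 - b2) ^+ 2)))
    (x * q.1.1 + y * q.1.2 + tau * q.2))) 0.
Proof.
move=> tau0.
pose a1 := b1 / 2 - y / tau; pose a2 := b2 / 2 + x / tau.
pose c : R[i] := Complex (y / 2 + tau * b1 / 4) (x / 2 - tau * b2 / 4).
pose K : R[i] := c * Complex a1 a2 +
  (tau / 4 * (a1 ^+ 2 + a2 ^+ 2) - tau / 4 * (b1 ^+ 2 + b2 ^+ 2))%:C.
have := cpairingZ ui (cexp K) (cexp_null c (- a1, - a2, 0) tau0).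
rewrite mulr0; congr cpairing; apply/funext => -[[w1 w2] t].
rewrite /gmono expr0 mulr1 -!cexpD; congr cexp.
rewrite hmulE /zc /zsqr /K /c /a1 /a2 /=.
by apply: complex_eqP; rewrite ?ReD ?ImD ?ReM ?ImM /=; field; rewrite gt_eqF.
Qed.

Let fourier_null (x y t : R) : 0 < t ->
  \int[haar_sf R]_q (u q * cos (x * q.1.1 + y * q.1.2 + t * q.2)) = 0 /\
  \int[haar_sf R]_q (u q * sin (x * q.1.1 + y * q.1.2 + t * q.2)) = 0.
Proof.
move=> t0; pose sigma := Num.sqrt (2 / t).
have s0 : 0 < sigma by rewrite sqrtr_gt0 divr_gt0.
have s2 : sigma ^+ 2 = 2 / t by rewrite sqr_sqrtr// divr_ge0// ltW.
have nE m z : normal_fun m sigma z = expR (- (t / 4 * (m - z) ^+ 2)).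
  by rewrite /normal_fun s2; congr expR; field; rewrite gt_eqF.
have m11 := @measurable_H11 R; have m12 := @measurable_H12 R; have m2 := @measurable_H2 R.
have mth : measurable_fun setT (fun q : H => x * q.1.1 + y * q.1.2 + t * q.2).
  by apply: measurable_funD; [apply: measurable_funD|]; exact: measurable_funM.
have nf1 m (b : R) : normal_fun m sigma b <= 1.
  by rewrite nE -(expR0 R) ler_expR oppr_le0 mulr_ge0 ?sqr_ge0// divr_ge0// ltW.
have key (k : H -> R) : measurable_fun setT k -> (forall q, `|k q| <= 1) ->
    (forall b1 b2, \int[haar_sf R]_q (u q * (k q * normal_fun q.1.2 sigma b2 *
      normal_fun q.1.1 sigma b1)) = 0) -> \int[haar_sf R]_q (u q * k q) = 0.
  move=> mk k1 h; apply: (annihilated_gauss ui mk k1 m12 s0) => b2.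
  apply: (annihilated_gauss ui _ _ m11 s0) => [|q|b1]; last exact: h.
  - apply: measurable_funM => //; under eq_fun do rewrite nE.
    apply: measurableT_comp => //; apply: measurableT_comp => //; apply: measurable_funM => //.
    by apply: measurable_funX; exact: measurable_funB.
  - by rewrite normrM mulr_ile1// ger0_norm ?normal_fun_ge0.
split; apply: key.
- exact: (measurableT_comp (@measurable_cos R) mth).
- by move=> q; exact: ler_norm_cos.
- move=> b1 b2; have [_ _ h _] := gauss_null x y b1 b2 t0.
  rewrite -[RHS]h; apply: eq_Rintegral => q _; congr (_ * _).
  by rewrite /= mulrDr opprD expRD !nE; ring.
- exact: (measurableT_comp (@measurable_sin R) mth).
- by move=> q; exact: ler_norm_sin.
- move=> b1 b2; have [_ _ _ h] := gauss_null x y b1 b2 t0.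
  rewrite -[RHS]h; apply: eq_Rintegral => q _; congr (_ * _).
  by rewrite /= mulrDr opprD expRD !nE; ring.
Qed.

Lemma gmono_complete : {ae haar_sf R, forall q, u q = 0}.
Proof.
by apply: (fourier_uniqueness ui) => x y t t0; have [] := fourier_null x y t0.
Qed.

End gaussian_span.

Lemma xray_null_eq0 (R : realType) (eps eta : R) (F : L1 (haar R)) : 0 < eps -> 0 < eta ->
  {ae (@lebesgue_measure R), forall l : measurableTypeR R, forall lam : {posnum R},
    lam%:num = l -> l < eta ->
    xray_null eps lam (fun p => cRe (repr F p)) /\
    xray_null eps lam (fun p => cIm (repr F p))} -> F = 0.
Proof.
move=> eps0 eta0 h; have [Fre Fim] := repr_cintegrable F.
have vanish (u : _ -> R) : (haar_sf R).-integrable setT (EFin \o u) ->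
    {ae (@lebesgue_measure R), forall l : measurableTypeR R, forall lam : {posnum R},
      lam%:num = l -> l < eta -> xray_null eps lam u} ->
    {ae haar R, forall q, u q = 0}.
  move=> ui u0; apply: (gmono_complete ui) => tau j a.
  exact: (gmono_null eps0 eta0 ui u0).
have re0 : {ae haar R, forall q, cRe (repr F q) = 0}.
  by apply: (vanish _ Fre); apply: filterS h => l h lam e /(h lam e)[].
have im0 : {ae haar R, forall q, cIm (repr F q) = 0}.
  by apply: (vanish _ Fim); apply: filterS h => l h lam e /(h lam e)[].
apply: L1rep_inj (L1rep0 _); apply: L1rep_ae (L1rep_repr F); first exact: cintegrable0.
by apply: filterS2 re0 im0 => q r0 i0; exact: complex_eqP.
Qed.

Theorem theorem4 (R : realType) (eps : R) (heps : 0 < eps) :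
  injective (@xray R eps) /\
  (forall f : L1 (haar R),
     (exists eta : R, 0 < eta /\
        forall lam : {posnum R}, lam%:num < eta -> xray_lam eps lam f = 0) ->
     f = 0).
Proof.
split=> [F G FG|F [eta [eta0 F0]]].
  apply/eqP; rewrite -subr_eq0; apply/eqP.
  have FG0 : xray eps (F - G) = 0.
    by rewrite addrC -scaleN1r (xrayP eps F).2 FG scaleN1r addNr.
  apply: (xray_null_eq0 heps ltr01).
  by apply: filterS (xray_eq0 FG0) => l h lam e _; exact: h.
apply: (xray_null_eq0 heps eta0); apply: aeW => l lam <- leta.
exact/xray_lam_eq0/F0.
Qed.
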